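(* Let $M$ be a complete orientable cusped hyperbolic $3$-manifold. Any two geometric ideal triangulations of $M$ are related by a (finite) sequence of Pachner moves through geometric (possibly non-ideal) triangulations of $M$.
   Context: A cusped hyperbolic $3$-manifold is a non-compact complete hyperbolic $3$-manifold of finite volume. A geometric ideal triangulation of $M$ is a realisation of $M$ as the quotient of a (finite) collection of hyperbolic ideal tetrahedra by face-pairing isometries such that the tetrahedra glue together consistently to give the complete hyperbolic structure on $M$ (it need not be a simplicial complex). More generally, a topological triangulation of $M$, possibly with both ideal vertices and material (non-ideal) vertices, is called geometric if the relative interior of every $n$-simplex is a totally geodesic $n$-disk. Pachner (bistellar) moves: let $\mathrm{pr}:\mathbb{H}^3\to M$ be the universal covering and let $\tau$ be a topological triangulation of $M$ possibly with ideal and material vertices, with lift $\tilde\tau$. Let $D$ be a subcomplex of $\tau$ with a lift $\tilde D$ that is a simplicially triangulated closed $3$-ball subcomplex of $\tilde\tau$ in $\mathbb{H}^3\cup\partial\mathbb{H}^3$, and suppose $\tilde D$ is simplicially isomorphic to a triangulated closed $3$-ball subcomplex of the boundary $\partial\Delta^4$ of a $4$-simplex. The move removes $D$ and replaces it by the complementary $3$-ball of $\partial\Delta^4$, attached along the same boundary. In dimension 3 these are the four moves 1-4, 4-1, 2-3, 3-2. *)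

(* Defs.v *)
From HB Require Import structures.
From mathcomp Require Import all_boot all_order all_algebra.
From mathcomp Require Import finmap.
From mathcomp Require Import all_classical all_reals all_analysis.

Set Implicit Arguments.
Unset Strict Implicit.
Unset Printing Implicit Defensive.

Import Order.TTheory GRing.Theory Num.Theory.
Import numFieldNormedType.Exports.
Local Open Scope classical_set_scope.
Local Open Scope ring_scope.

(* Hyperbolic space is taken in the projective (Klein) model: H^3 is the open
   Euclidean unit ball of R^3 and its sphere at infinity is the unit sphere.
   Geodesics are chords, so totally geodesic simplices, with material or ideal
   vertices, are exactly Euclidean simplices with vertices in the closed ball.

   An isometry is an element of O^+(3,1), acting on the right on row vectors of
   R^{1,3}; a point x of the closed ball stands for the line through (1, x).  *)

Section HyperbolicSpace.
Variable R : realType.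

(* The norm that the library puts on row vectors is the sup norm. *)
Definition sqnorm (x : 'rV[R]_3) : R := \sum_(i < 3) x 0 i ^+ 2.

Definition H3 : set 'rV[R]_3 := [set x | sqnorm x < 1].

Definition sphere_infty : set 'rV[R]_3 := [set x | sqnorm x = 1].

Definition lorentz : 'M[R]_(1 + 3) := block_mx (- 1)%:M 0 0 1%:M.

Definition is_isometry (g : 'M[R]_(1 + 3)) : Prop :=
  g *m lorentz *m g^T = lorentz /\ 0 < g 0 0.

Definition homog (x : 'rV[R]_3) : 'rV[R]_(1 + 3) := row_mx 1%:M x.

Definition act (g : 'M[R]_(1 + 3)) (x : 'rV[R]_3) : 'rV[R]_3 :=
  let y := homog x *m g in (y 0 0)^-1 *: rsubmx y.

(* R^3 with its Borel sigma-algebra. *)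
Definition R3 := (measurableTypeR R * measurableTypeR R * measurableTypeR R)%type.

Definition point_of_coords (p : R3) : 'rV[R]_3 :=
  \row_(i < 3) [:: p.1.1 : R; p.1.2 : R; p.2 : R]`_i.

(* The hyperbolic volume element in the Klein model is dx / (1 - |x|^2)^2. *)
Definition hyp_volume (F : set 'rV[R]_3) : \bar R :=
  (\int[(@lebesgue_measure R \x @lebesgue_measure R) \x @lebesgue_measure R]_(p in
     point_of_coords @^-1` F) ((1 - sqnorm (point_of_coords p)) ^- 2)%:E)%E.

End HyperbolicSpace.

(* A complete hyperbolic 3-manifold H^3 / Gamma, given by its group Gamma of
   deck transformations. *)
Record hyperbolic_manifold (R : realType) := HyperbolicManifold {
  deck : set 'M[R]_(1 + 3);
  deck_isometry : forall g, deck g -> is_isometry g;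
  deck1 : deck 1%:M;
  deckM : forall g h, deck g -> deck h -> deck (g *m h);
  deckV : forall g, deck g -> deck (invmx g);
  deck_free : forall g x, deck g -> H3 x -> act g x = x -> g = 1%:M;
  deck_properly_discontinuous : forall K : set 'rV[R]_3,
    compact K -> K `<=` @H3 R ->
    finite_set [set g | deck g /\ (act g @` K) `&` K !=set0]
}.

Section ActTheory.
Variable R : realType.
Implicit Types (g h : 'M[R]_(1 + 3)) (x : 'rV[R]_3).

Let ord00 : lshift 3 (0 : 'I_1) = 0.
Proof. exact: val_inj. Qed.

Let lform (y : 'rV[R]_(1 + 3)) : R := (y *m lorentz R *m y^T) 0 0.

Let lformE (y : 'rV[R]_(1 + 3)) : lform y = - y 0 0 ^+ 2 + sqnorm (rsubmx y).
Proof.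
rewrite /lform -[y in LHS]hsubmxK /lorentz mul_row_block tr_row_mx.
rewrite !mulmx0 add0r addr0 mul_mx_scalar mulmx1 mul_row_col mxE.
congr (_ + _).
  rewrite -scalemxAl !mxE big_ord1 !mxE mulN1r expr2.
  by rewrite ord00.
by rewrite mxE; apply: eq_bigr => i _; rewrite !mxE expr2.
Qed.

Let homog00 x : homog x 0 0 = 1.
Proof.
by rewrite -ord00 row_mxEl mxE eqxx.
Qed.

Lemma homog_act_neq0 g x :
  is_isometry g -> H3 x -> (homog x *m g) 0 0 != 0.
Proof.
move=> [gJ _] Hx; apply/eqP => y0.
have : lform (homog x *m g) = lform (homog x).
  by rewrite /lform trmx_mul -!mulmxA (mulmxA g) (mulmxA (g *m _)) gJ.
rewrite !lformE y0 homog00 /homog row_mxKr expr0n oppr0 add0r expr1n => E.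
have : sqnorm (rsubmx (row_mx 1%:M x *m g)) >= 0.
  by apply: sumr_ge0 => i _; rewrite sqr_ge0.
by rewrite E addrC subr_ge0 leNgt Hx.
Qed.

Let homog_act g x : (homog x *m g) 0 0 != 0 ->
  homog x *m g = (homog x *m g) 0 0 *: homog (act g x).
Proof.
move=> y0; rewrite {3}/homog scale_row_mx /act scalerA mulfV // scale1r.
rewrite -[LHS]hsubmxK; congr row_mx.
by apply/matrixP => i j; rewrite !mxE !ord1 eqxx mulr1 ord00.
Qed.

Lemma act1 x : act 1%:M x = x.
Proof. by rewrite /act mulmx1 homog00 invr1 scale1r /homog row_mxKr. Qed.

Lemma actM g h x : is_isometry g -> H3 x ->
  act (g *m h) x = act h (act g x).
Proof.
move=> /homog_act_neq0 /[apply] c0; rewrite {1}/act mulmxA homog_act //.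
rewrite -scalemxAl mxE invfM linearZ /= scalerA.
by rewrite (mulrAC (_^-1)) mulVf // mul1r.
Qed.

Lemma isometry_unit g : is_isometry g -> g \in unitmx.
Proof.
move=> [gJ _]; suff: lorentz R *m lorentz R = 1%:M.
  by move=> JJ; have /mulmx1_unit[] : g *m (lorentz R *m g^T *m lorentz R) = 1%:M
    by rewrite !mulmxA gJ.
rewrite /lorentz mulmx_block !mulmx0 !mul0mx !addr0 !add0r mulmx1.
by rewrite -scalar_mxM mulrNN mulr1 -scalar_mx_block.
Qed.

End ActTheory.

Section Manifold.
Variables (R : realType) (M : hyperbolic_manifold R).

Definition same_orbit (x y : 'rV[R]_3) : Prop :=
  exists2 g, deck M g & act g x = y.

Definition deck_rel (x y : @H3 R) : bool := `[< same_orbit (val x) (val y) >].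

Lemma deck_rel_equiv : equiv_class_of deck_rel.
Proof.
have H (x : @H3 R) : H3 (val x) by exact: set_valP.
split.
- by move=> x; apply/asboolP; exists 1%:M; [exact: deck1|exact: act1].
- suff S x y : deck_rel x y -> deck_rel y x by move=> x y; apply/idP/idP; exact: S.
  move=> /asboolP[g Mg gx]; apply/asboolP; exists (invmx g); first exact: deckV.
  have ig := deck_isometry Mg.
  by rewrite -gx -actM ?mulmxV ?act1 ?isometry_unit.
- move=> y x z /asboolP[g Mg gx] /asboolP[h Mh hy]; apply/asboolP.
  exists (g *m h); first exact: deckM.
  by rewrite actM ?gx //; exact: deck_isometry Mg.
Qed.

Definition deck_equiv : equiv_rel (@H3 R) := EquivRelPack deck_rel_equiv.

Definition quotient_space : topologicalType :=
  quotient_topology {eq_quot deck_equiv}%qT.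

Definition orientable : Prop := forall g, deck M g -> \det g = 1.

Definition finite_volume : Prop :=
  exists F : set 'rV[R]_3,
    [/\ F `<=` @H3 R,
        forall x, H3 x -> exists! y, F y /\ same_orbit x y,
        measurable (@point_of_coords R @^-1` F)
      & (hyp_volume F < +oo)%E].

Definition cusped : Prop :=
  ~ compact [set: quotient_space] /\ finite_volume.

End Manifold.

Section Triangulations.
Variables (R : realType) (M : hyperbolic_manifold R).
Local Notation point := 'rV[R]_3.
Local Open Scope fset_scope.
Implicit Types (F V W : {fset point}).

(* Simplices are represented by their vertex sets. *)

Definition hull F : set point :=
  [set x | exists w : point -> R,
     [/\ forall v, v \in F -> 0 <= w v, \sum_(v <- F) w v = 1
       & x = \sum_(v <- F) w v *: v]].

Definition rel_interior F : set point :=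
  [set x | exists w : point -> R,
     [/\ forall v, v \in F -> 0 < w v, \sum_(v <- F) w v = 1
       & x = \sum_(v <- F) w v *: v]].

Definition affinely_independent F : Prop :=
  forall w : point -> R,
    \sum_(v <- F) w v = 0 -> \sum_(v <- F) w v *: v = 0 ->
    forall v, v \in F -> w v = 0.

Definition tetrahedron V : Prop :=
  [/\ #|` V| = 4%N, affinely_independent V
    & forall v, v \in V -> H3 v \/ sphere_infty v].

(* A 3-simplex of M is recorded by the set of its lifts to H^3. *)
Definition simplex_orbit V : set {fset point} :=
  [set [fset act g v | v in V] | g in deck M].

(* A triangulation is recorded by its set of 3-simplices. *)
Definition triangulation := set (set {fset point}).

Implicit Type t : triangulation.

Definition lifted t : set {fset point} := [set V | exists2 s, t s & s V].

Definition lifted_simplex t F : Prop :=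
  F != fset0 /\ exists2 V, lifted t V & F `<=` V.

(* The third clause says that M is the disjoint union of the open simplices of
   t, each of them embedded in M.  The last one makes the topology of M the
   quotient topology of the glued tetrahedra minus their ideal vertices. *)
Definition geometric_triangulation t : Prop :=
  [/\ finite_set t,
      forall s, t s -> exists2 V, tetrahedron V & s = simplex_orbit V,
      forall x, H3 x -> exists! F, lifted_simplex t F /\ rel_interior F x
    & forall K : set point, compact K -> (K `<=` @H3 R)%classic ->
        finite_set [set V | lifted t V /\ (hull V `&` K !=set0)%classic]].

Definition geometric_ideal_triangulation t : Prop :=
  geometric_triangulation t /\
  forall V v, lifted t V -> v \in V -> sphere_infty v.

(* The facets of the 4-simplex with vertex set W that are opposite to the points
   of A. *)
Definition facets W (A : {fset point}) : set {fset point} :=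
  [set (W `\ a)%fset | a in [set` A]]%classic.

Definition region (B : set {fset point}) : set point :=
  \bigcup_(V in B) hull V.

(* The ball B removed consists of some, but not all, facets of a 4-simplex, and
   the ball B' inserted consists of the other facets; B and B' are lifts to
   hyperbolic space and have to fill the same region.  Injectivity of
   simplex_orbit on B says that the interior of B projects injectively to M. *)
Definition pachner_move t t' : Prop :=
  exists W A : {fset point},
    [/\ #|` W| = 5%N, A != fset0 & A `<` W] /\
    let B := facets W A in
    let B' := facets W (W `\` A) in
    [/\ {in B &, injective simplex_orbit},
        (simplex_orbit @` B `<=` t)%classic,
        t' = ((t `\` simplex_orbit @` B) `|` simplex_orbit @` B')%classic
      & region B = region B'].

End Triangulations.

(* Main.v *)
(* In homogeneous coordinates a simplex is a cone in R^{1,3}, isometries are linear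
   and a geometric triangulation is a locally finite fan of cones, invariant under
   the deck group. The five vertices of a Pachner move satisfy one linear
   dependence; the signs of its coefficients tell the two balls apart.

   (1) Starring a region from a generic point q is a product of Pachner moves if the
   tetrahedra of the region can be ordered by visibility from q: add them to the
   starred region one at a time. Stars of edges and of bigger faces have this
   property, since their fans are regular.

   (2) Let X refine Y so that, inside each cell of Y, the cells of X are ordered by
   visibility in every direction. Starring the stars of the faces of Y in both
   triangulations, by decreasing dimension, keeps this relation and makes the two
   triangulations equal in the end, so X and Y are connected by Pachner moves. With
   X = Y this yields a triangulation no cell of which has two equivalent vertices.

   (3) Hence it suffices to find a common refinement of this kind. Cut the first
   triangulation along the face planes of the cells of both triangulations that are
   near to a given cell, by splitting edges where they cross a plane. This is a
   finite process as soon as every tetrahedron of one triangulation meets only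
   finitely many of the other one.

   (4) This finiteness is clear away from the cusps. Every ideal vertex is fixed by
   a parabolic element, and an element of small displacement deep in a cusp fixes the
   cusp, so both triangulations have the same ideal vertices; near a common ideal
   vertex the tetrahedra of both are cones to it and are compared on a horosphere. *)

Require Import Defs.
From mathcomp Require Import all_boot all_order all_algebra.
From mathcomp Require Import fingroup perm.
From mathcomp Require Import finmap.
From mathcomp Require Import all_classical all_reals all_analysis.
From mathcomp Require Import ring lra.

Set Implicit Arguments.
Unset Strict Implicit.
Unset Printing Implicit Defensive.

Import Order.TTheory GRing.Theory Num.Theory.
Import numFieldNormedType.Exports.
Local Open Scope classical_set_scope.
Local Open Scope fset_scope.
Local Open Scope ring_scope.

(** * Cones over simplices and their coordinates *)

(** Two obstacles shape the proof. First, visibility can be cyclic for a general set of tetrahedra,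
    so an arbitrary refinement cannot be handled by starring. Acyclicity is therefore built into the
    notion of refinement, [fine]: it comes from regularity for stars of faces and from a separating
    plane for edge splits, and it passes lexicographically to compositions. Edge splits need not be
    moves themselves, because any fine refinement gets connected to what it refines. Second,
    tetrahedra changed together must be inequivalent under the deck group. For stars of faces this
    follows from the order by decreasing dimension: the star of F is treated when F is all that is
    left of the original vertices in the cells around it, so an element carrying F into one of these
    cells stabilises F. For edge splits it follows from [nodup], which is why the first
    triangulation is prepared before any cutting. In the cusps the estimates must hold for
    infinitely many lifts at once; they do because all deck elements carrying one ideal vertex to
    another rescale its lightlike vector by the same factor. *)

Section Cones.
Variable R : realType.
Local Notation point := 'rV[R]_3.
Local Notation vec := 'rV[R]_(1 + 3).
Local Notation simplex := {fset 'rV[R]_3}.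
Implicit Types (F G V W P : simplex) (x y z b : vec) (u v a : point).

Definition comb F (w : point -> R) : vec := \sum_(v <- F) w v *: homog v.

(* [co F] and [cc F] are the cones over the relative interior and over the hull of [F]. *)
Definition co F y : Prop :=
  exists2 w : point -> R, forall v, v \in F -> 0 < w v & y = comb F w.

Definition cc F y : Prop :=
  exists2 w : point -> R, forall v, v \in F -> 0 <= w v & y = comb F w.

Definition indep F : Prop :=
  forall w : point -> R, comb F w = 0 -> forall v, v \in F -> w v = 0.

Lemma eq_comb F (w w' : point -> R) : (forall v, v \in F -> w v = w' v) ->
  comb F w = comb F w'.
Proof.
by move=> e; rewrite /comb; apply: eq_big_seq => v vF; rewrite e.
Qed.

Lemma combD F (w w' : point -> R) :
  comb F (fun v => w v + w' v) = comb F w + comb F w'.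
Proof. by rewrite /comb -big_split; apply: eq_bigr => v _; rewrite scalerDl. Qed.

Lemma combZ F c (w : point -> R) : comb F (fun v => c * w v) = c *: comb F w.
Proof. by rewrite /comb scaler_sumr; apply: eq_bigr => v _; rewrite scalerA. Qed.

Lemma combN F (w : point -> R) : comb F (fun v => - w v) = - comb F w.
Proof. by rewrite /comb -sumrN; apply: eq_bigr => v _; rewrite scaleNr. Qed.

Lemma comb0 F (w : point -> R) : (forall v, v \in F -> w v = 0) -> comb F w = 0.
Proof.
by move=> e; rewrite /comb big_seq big1 // => v vF; rewrite e // scale0r.
Qed.

Lemma comb_sub F V (w : point -> R) : F `<=` V ->
  (forall v, v \in V -> v \notin F -> w v = 0) -> comb F w = comb V w.
Proof.
by move=> FV w0; rewrite /comb; apply: big_fset_incl => // v vV vF;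
  rewrite w0 // scale0r.
Qed.

Lemma comb1 F v : v \in F -> comb F (fun u => (u == v)%:R) = homog v.
Proof.
move=> vF; rewrite /comb (big_fsetD1 v) //= eqxx scale1r big_seq big1 ?addr0 //.
by move=> u; rewrite !inE => /andP[/negbTE -> _]; rewrite scale0r.
Qed.

Lemma comb_set1 v (w : point -> R) : comb [fset v] w = w v *: homog v.
Proof. by rewrite /comb big_seq_fset1. Qed.

Lemma combD1 F v (w : point -> R) : v \in F ->
  comb F w = w v *: homog v + comb (F `\ v) w.
Proof. by move=> vF; rewrite /comb (big_fsetD1 v). Qed.

Lemma combE F (w : point -> R) :
  comb F w = row_mx (\sum_(v <- F) w v)%:M (\sum_(v <- F) w v *: v).
Proof.
rewrite /comb (eq_bigr (fun v => row_mx (w v)%:M (w v *: v))); last first.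
  by move=> v _; rewrite /homog scale_row_mx scalemx1.
by elim/big_rec3: _ => [|v A B C _ ->]; rewrite ?raddf0 ?row_mx0 // add_row_mx raddfD.
Qed.

Lemma homog_comb F (w : point -> R) (p : point) :
  homog p = comb F w <-> \sum_(v <- F) w v = 1 /\ p = \sum_(v <- F) w v *: v.
Proof.
rewrite combE /homog; split=> [/eq_row_mx[e ->]|[-> ->]//]; split=> //.
by have := congr1 (fun A : 'M[R]_1 => A 0 0) e; rewrite !mxE eqxx.
Qed.

Lemma rel_interiorE F p : rel_interior F p <-> co F (homog p).
Proof.
split=> [[w [w0 w1 w2]]|[w w0 /homog_comb[w1 w2]]]; last by exists w.
by exists w => //; apply/homog_comb.
Qed.

Lemma hullE F p : hull F p <-> cc F (homog p).
Proof.
split=> [[w [w0 w1 w2]]|[w w0 /homog_comb[w1 w2]]]; last by exists w.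
by exists w => //; apply/homog_comb.
Qed.

Lemma indepE F : affinely_independent F <-> indep F.
Proof.
split=> H w.
  rewrite combE => e; have : row_mx (\sum_(v <- F) w v)%:M (\sum_(v <- F) w v *: v)
    = row_mx (0 : 'M[R]_1) 0 by rewrite e row_mx0.
  move=> /eq_row_mx[e1 e2]; apply: H => //.
  by have := congr1 (fun A : 'M[R]_1 => A 0 0) e1; rewrite !mxE eqxx.
by move=> e1 e2; apply: H; rewrite combE e1 e2 raddf0 row_mx0.
Qed.

Lemma homog00 (p : point) : homog p 0 0 = 1.
Proof.
have -> : (0 : 'I_(1 + 3)) = lshift 3 (0 : 'I_1) by exact: val_inj.
by rewrite row_mxEl mxE eqxx.
Qed.

Lemma homog_inj : injective (@homog R).
Proof. by move=> p q /eq_row_mx[]. Qed.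

Lemma homog_scale c u v : homog u = c *: homog v -> u = v.
Proof.
move=> e; apply: homog_inj; rewrite e.
have := congr1 (fun A : vec => A 0 0) e; rewrite [RHS]mxE !homog00 mulr1 => <-.
by rewrite scale1r.
Qed.

Lemma comb00 F (w : point -> R) : comb F w 0 0 = \sum_(v <- F) w v.
Proof.
rewrite /comb summxE; apply: eq_bigr => v _; by rewrite mxE homog00 mulr1.
Qed.

Lemma indep_sub F V : F `<=` V -> indep V -> indep F.
Proof.
move=> FV iV w e v vF.
have := iV (fun u => if u \in F then w u else 0).
rewrite -(comb_sub FV); last by move=> u _ /negbTE ->.
rewrite (@eq_comb _ _ w) => [|u -> //] /(_ e v (fsubsetP FV _ vF)).
by rewrite vF.
Qed.

Lemma indep_inj F (w w' : point -> R) : indep F -> comb F w = comb F w' ->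
  forall v, v \in F -> w v = w' v.
Proof.
move=> iF e v vF; apply/eqP; rewrite -subr_eq0; apply/eqP.
apply: (iF (fun v => w v - w' v)) => //.
by rewrite (combD F w (fun v => - w' v)) combN e subrr.
Qed.

Definition frame V : Prop := indep V /\ #|` V| = 4%N.

Lemma frame_span V y : frame V -> exists w, y = comb V w.
Proof.
move=> [iV cV].
have sX : size [seq homog v | v <- V] == 4%N by rewrite size_map cV.
pose X : 4.-tuple vec := Tuple sX.
have XE (i : 'I_4) : X`_i = homog V`_i by rewrite (nth_map 0) // cV.
have ix (i : 'I_4) : insub (index V`_i V) = Some i.
  rewrite index_uniq ?fset_uniq ?cV //.
  by rewrite insubT //= => h; congr Some; apply: val_inj.
have cE (k : 'I_4 -> R) : \sum_(i < 4) k i *: X`_i =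
    comb V (fun v => if insub (index v V) is Some i then k i else 0).
  rewrite /comb [RHS](big_nth 0) big_mkord -/(size V) cV.
  by apply: eq_bigr => i _; rewrite ix XE.
have fX : free X.
  apply/freeP => k; rewrite cE => /iV iw i.
  by have := iw V`_i; rewrite mem_nth ?cV // ix => /(_ isT).
have bX : basis_of fullv X.
  by rewrite basisEfree fX subvf size_tuple dimvf /= /dim.
have yX : y \in <<X>>%VS by rewrite (span_basis bX) memvf.
by rewrite (coord_span yX) cE; eexists.
Qed.

(* The coordinates of [y] in the basis [homog v], [v \in V]; only meaningful if [V] is a frame. *)
Definition crd V y : point -> R := xget (fun _ => 0) [set w | y = comb V w].

Lemma crdK V y : frame V -> comb V (crd V y) = y.
Proof. by move=> /frame_span-/(_ y)[w e]; rewrite /crd; case: xgetP => // /(_ w). Qed.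

Lemma crd_comb V y (w : point -> R) v : frame V -> v \in V -> y = comb V w ->
  crd V y v = w v.
Proof. by move=> fV vV e; apply: (indep_inj fV.1); rewrite ?crdK. Qed.

Lemma crdD V y z v : frame V -> v \in V -> crd V (y + z) v = crd V y v + crd V z v.
Proof.
move=> fV vV; rewrite (@crd_comb _ _ (fun v => crd V y v + crd V z v)) //.
by rewrite combD !crdK.
Qed.

Lemma crdZ V c y v : frame V -> v \in V -> crd V (c *: y) v = c * crd V y v.
Proof.
move=> fV vV; rewrite (@crd_comb _ _ (fun v => c * crd V y v)) //.
by rewrite combZ !crdK.
Qed.

Lemma crdN V y v : frame V -> v \in V -> crd V (- y) v = - crd V y v.
Proof. by move=> fV vV; rewrite -scaleN1r crdZ // mulN1r. Qed.

Lemma crdB V y z v : frame V -> v \in V -> crd V (y - z) v = crd V y v - crd V z v.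
Proof. by move=> fV vV; rewrite crdD // crdN. Qed.

Lemma crd_homog V v a : frame V -> v \in V -> a \in V ->
  crd V (homog v) a = (a == v)%:R.
Proof. by move=> fV vV aV; rewrite (@crd_comb _ _ (fun u => (u == v)%:R)) // comb1. Qed.

Lemma crd_sum V F (w : point -> R) v : frame V -> v \in V ->
  crd V (comb F w) v = \sum_(u <- F) w u * crd V (homog u) v.
Proof.
move=> fV vV; rewrite /comb; elim/big_rec2: _ => [|u A B _ <-].
  by rewrite -(scale0r 0) crdZ // mul0r.
by rewrite crdD // crdZ.
Qed.

Lemma frame_cosub V F y : frame V -> F `<=` V ->
  co F y <-> (forall v, v \in F -> 0 < crd V y v) /\
             (forall v, v \in V -> v \notin F -> crd V y v = 0).
Proof.
move=> fV FV; split=> [[w w0 ->]|[H0 H1]]; last first.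
  by exists (crd V y) => //; rewrite (comb_sub FV) // crdK.
have e : comb F w = comb V (fun v => if v \in F then w v else 0).
  by rewrite -(comb_sub FV) => [|v _ /negbTE -> //]; apply: eq_comb => v ->.
split=> v vF; first by rewrite (crd_comb fV (fsubsetP FV _ vF) e) vF w0.
by move=> /negbTE vF'; rewrite (crd_comb fV vF e) vF'.
Qed.

Lemma frame_ccsub V F y : frame V -> F `<=` V ->
  cc F y <-> (forall v, v \in F -> 0 <= crd V y v) /\
             (forall v, v \in V -> v \notin F -> crd V y v = 0).
Proof.
move=> fV FV; split=> [[w w0 ->]|[H0 H1]]; last first.
  by exists (crd V y) => //; rewrite (comb_sub FV) // crdK.
have e : comb F w = comb V (fun v => if v \in F then w v else 0).
  by rewrite -(comb_sub FV) => [|v _ /negbTE -> //]; apply: eq_comb => v ->.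
split=> v vF; first by rewrite (crd_comb fV (fsubsetP FV _ vF) e) vF w0.
by move=> /negbTE vF'; rewrite (crd_comb fV vF e) vF'.
Qed.

Lemma frame_co V y : frame V -> co V y <-> forall v, v \in V -> 0 < crd V y v.
Proof.
move=> fV; have H := frame_cosub y fV (fsubset_refl V).
rewrite H; split=> [[]//|H']; split=> // v ->//.
Qed.

Lemma frame_cc V y : frame V -> cc V y <-> forall v, v \in V -> 0 <= crd V y v.
Proof.
move=> fV; have H := frame_ccsub y fV (fsubset_refl V).
rewrite H; split=> [[]//|H']; split=> // v ->//.
Qed.

Definition supp V y : simplex := [fset v in V | 0 < crd V y v].

Lemma supp_sub V y : supp V y `<=` V.
Proof. by apply/fsubsetP => v; rewrite !inE => /andP[]. Qed.

Lemma co_supp V y : frame V -> cc V y -> co (supp V y) y.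
Proof.
move=> fV; rewrite frame_cc // => H; rewrite (frame_cosub _ fV (supp_sub _ _)).
split=> v; first by rewrite !inE => /andP[].
move=> vV; rewrite !inE vV /= -leNgt => h; apply/eqP.
by rewrite eq_le h H.
Qed.

Lemma co_sub_uniq V F G y : frame V -> F `<=` V -> G `<=` V ->
  co F y -> co G y -> F = G.
Proof.
move=> fV FV GV; rewrite !(@frame_cosub V) // => -[F0 F1] [G0 G1].
apply/fsetP => v; apply/idP/idP => h.
  apply: contraT => h'; have := F0 _ h.
  by rewrite G1 ?ltxx // (fsubsetP FV).
apply: contraT => h'; have := G0 _ h.
by rewrite F1 ?ltxx // (fsubsetP GV).
Qed.

Lemma co_cc F y : co F y -> cc F y.
Proof. by move=> [w w0 ->]; exists w => // v /w0/ltW. Qed.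

Lemma coZ F c y : 0 < c -> co F y -> co F (c *: y).
Proof.
by move=> c0 [w w0 ->]; exists (fun v => c * w v); rewrite ?combZ // => v /w0 h;
  rewrite mulr_gt0.
Qed.

Lemma ccZ F c y : 0 <= c -> cc F y -> cc F (c *: y).
Proof.
by move=> c0 [w w0 ->]; exists (fun v => c * w v); rewrite ?combZ // => v /w0 h;
  rewrite mulr_ge0.
Qed.

Lemma coZE F c y : 0 < c -> co F (c *: y) <-> co F y.
Proof.
move=> c0; split; last exact: coZ.
by move=> /(@coZ _ c^-1); rewrite scalerA mulVf ?gt_eqF // scale1r invr_gt0; apply.
Qed.

Lemma comb_ext F V (w : point -> R) : F `<=` V ->
  comb F w = comb V (fun v => if v \in F then w v else 0).
Proof.
move=> FV; rewrite -(comb_sub FV) => [|v _ /negbTE -> //].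
by apply: eq_comb => v ->.
Qed.

Lemma coD F G y z : co F y -> co G z -> co (F `|` G) (y + z).
Proof.
move=> [w w0 ->] [w' w0' ->].
rewrite (comb_ext _ (fsubsetUl F G)) (comb_ext _ (fsubsetUr F G)) -combD.
eexists; last by [].
move=> v /=; rewrite inE; case: ifP => [vF _|_ /= vG]; last by rewrite vG add0r w0'.
by case: ifP => vG; rewrite ?addr0 ?addr_gt0 ?w0 ?w0'.
Qed.

Lemma ccD F y z : cc F y -> cc F z -> cc F (y + z).
Proof.
move=> [w w0 ->] [w' w0' ->]; rewrite -combD; eexists; last by [].
by move=> v vF /=; rewrite addr_ge0 ?w0 ?w0'.
Qed.

Lemma cc_sub F G y : F `<=` G -> cc F y -> cc G y.
Proof.
move=> FG [w w0 ->]; rewrite (comb_ext _ FG); eexists; last by [].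
by move=> v _ /=; case: ifP => // /w0.
Qed.

Lemma cc_trans F P y : (forall v, v \in F -> cc P (homog v)) -> cc F y -> cc P y.
Proof.
move=> H [w w0 ->]; rewrite /comb big_seq.
elim/big_rec: _ => [|v z vF]; first by exists (fun=> 0) => //; rewrite comb0.
by apply: ccD; apply: ccZ; [exact: w0|exact: H].
Qed.

Lemma cc_homog F v : v \in F -> cc F (homog v).
Proof.
by move=> vF; exists (fun u => (u == v)%:R); rewrite ?comb1.
Qed.

Lemma co_ex F : exists y, co F y.
Proof. by exists (comb F (fun=> 1)), (fun=> 1). Qed.

End Cones.

(** * Perturbation of a point *)

Section Eventually.
Variable R : realType.
Implicit Types (P Q : R -> Prop) (e d : R).

(* [P e] holds for all small enough [e > 0]. *)
Definition evt P : Prop := exists2 d, 0 < d & forall e, 0 < e -> e <= d -> P e.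

Lemma evtT P : (forall e, 0 < e -> P e) -> evt P.
Proof. by move=> H; exists 1 => // e /H. Qed.

Lemma evtI P Q : evt P -> evt Q -> evt (fun e => P e /\ Q e).
Proof.
move=> [d d0 H] [d' d0' H']; exists (Num.min d d'); first by rewrite lt_min d0.
by move=> e e0; rewrite le_min => /andP[h h']; split; [exact: H|exact: H'].
Qed.

Lemma evt_imp P Q : (forall e, 0 < e -> P e -> Q e) -> evt P -> evt Q.
Proof. by move=> PQ [d d0 H]; exists d => // e e0 /H h; apply/PQ/h. Qed.

Lemma evt_ex P : evt P -> exists2 e, 0 < e & P e.
Proof. by move=> [d d0 H]; exists d => //; apply: H. Qed.

Lemma evt_all (T : eqType) (s : seq T) (Q : T -> R -> Prop) :
  (forall v, v \in s -> evt (Q v)) -> evt (fun e => forall v, v \in s -> Q v e).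
Proof.
elim: s => [|a s IH] H; first exact: evtT.
have H1 := H a (mem_head _ _).
have H2 : evt (fun e => forall v, v \in s -> Q v e).
  by apply: IH => v vs; apply: H; rewrite inE vs orbT.
apply: evt_imp (evtI H1 H2) => e _ [h1 h2] v.
by rewrite inE => /orP[/eqP ->|/h2].
Qed.

Lemma evt_lin (a c : R) : 0 < a -> evt (fun e => 0 < a + e * c).
Proof.
move=> a0; have s0 : 0 < 1 + `|c| by rewrite ltr_pwDl.
exists (a / 2 / (1 + `|c|)); first by rewrite !divr_gt0.
move=> e e0; rewrite ler_pdivlMr // => H.
have : e * - c <= e * (1 + `|c|).
  by rewrite ler_pM2l // (le_trans (ler_norm _)) // normrN lerDr.
lra.
Qed.

Lemma evt_lt (a : R) : 0 < a -> evt (fun e => e < a).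
Proof. by move=> a0; exists (a / 2) => [|e e0 h]; lra. Qed.

End Eventually.

Section Perturb.
Variable R : realType.
Local Notation point := 'rV[R]_3.
Local Notation vec := 'rV[R]_(1 + 3).
Local Notation simplex := {fset 'rV[R]_3}.
Implicit Types (F G V W P : simplex) (x y z b : vec) (u v a : point).

(** For small e the coordinates positive at y stay positive, and those vanishing at y become e times
    those of z. So the open face containing the moved point does not depend on e. *)
Lemma cc_pert V y z : frame V -> cc V y ->
  (forall v, v \in V -> crd V y v = 0 -> 0 <= crd V z v) ->
  evt (fun e => co [fset v in V | (0 < crd V y v) || (0 < crd V z v)] (y + e *: z)).
Proof.
move=> fV; rewrite frame_cc // => y0 z0.
have sV : [fset v in V | (0 < crd V y v) || (0 < crd V z v)] `<=` V.
  by apply/fsubsetP => v; rewrite !inE => /andP[].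
suff : evt (fun e => forall v, v \in V -> (0 < crd V y v) || (0 < crd V z v) ->
    0 < crd V (y + e *: z) v).
  apply: evt_imp => e e0 H; rewrite (frame_cosub _ fV) //; split=> v.
    by rewrite !inE => /andP[/H].
  move=> vV; rewrite !inE vV /= negb_or -!leNgt => /andP[h1 h2].
  have yv : crd V y v = 0 by apply/eqP; rewrite eq_le h1 y0.
  have zv : crd V z v = 0 by apply/eqP; rewrite eq_le h2 z0.
  by rewrite crdD // crdZ // yv zv mulr0 addr0.
apply: evt_all => v vV; case: (ltP 0 (crd V y v)) => /= [h|h].
  by apply: evt_imp (evt_lin (crd V z v) h) => e e0; rewrite crdD // crdZ.
have yv : crd V y v = 0 by apply/eqP; rewrite eq_le h y0.
by apply: evtT => e e0 h'; rewrite crdD // crdZ // yv add0r mulr_gt0.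
Qed.

Lemma co_pert V y z : frame V -> co V y -> evt (fun e => co V (y + e *: z)).
Proof.
move=> fV yV; have := cc_pert (z := z) fV (co_cc yV).
have yV' := yV; rewrite frame_co // in yV'.
have -> : [fset v in V | (0 < crd V y v) || (0 < crd V z v)] = V.
  by apply/fsetP => v; rewrite !inE; case: (boolP (v \in V)) => //= /yV' ->.
by apply=> v /yV' h h'; rewrite h' ltxx in h.
Qed.

Lemma cc_co V y z e : 0 < e -> cc V y -> co V z -> co V (y + e *: z).
Proof.
move=> e0 [w w0 ->] [w' w0' ->]; rewrite -combZ -combD; eexists; last by [].
by move=> v vV /=; rewrite ltr_wpDl ?mulr_gt0 ?w0 ?w0'.
Qed.

Lemma co_sub_pert F V y z e : F `<=` V -> 0 < e -> co F y -> co V z ->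
  co V (y + e *: z).
Proof. by move=> FV e0 /co_cc/(cc_sub FV) yV; apply: cc_co. Qed.

End Perturb.

(** * The Lorentz form *)

Section Lorentz.
Variable R : realType.
Local Notation point := 'rV[R]_3.
Local Notation vec := 'rV[R]_(1 + 3).
Implicit Types (x y z : vec) (v : point) (g h : 'M[R]_(1 + 3)).

Definition lf x y : R := (x *m lorentz R *m y^T) 0 0.

Local Notation c1 x := (x 0 (rshift 1 (0 : 'I_3))).
Local Notation c2 x := (x 0 (rshift 1 (1 : 'I_3))).
Local Notation c3 x := (x 0 (rshift 1 (2%:R : 'I_3))).

Lemma ord00 : lshift 3 (0 : 'I_1) = 0.
Proof. exact: val_inj. Qed.

Lemma lfE x y : lf x y = - (x 0 0 * y 0 0) + (c1 x * c1 y + c2 x * c2 y + c3 x * c3 y).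
Proof.
rewrite /lf -[x in LHS]hsubmxK -[y in LHS]hsubmxK /lorentz mul_row_block tr_row_mx.
rewrite !mulmx0 add0r addr0 mul_mx_scalar mulmx1 mul_row_col mxE.
congr (_ + _).
  by rewrite -scalemxAl !mxE big_ord1 !mxE mulN1r ord00.
rewrite mxE !big_ord_recl big_ord0 addr0 !mxE addrA.
by congr (_ + _ * _ + _ * _); congr (_ _ (rshift _ _)); apply: val_inj.
Qed.

Lemma lfDl x y z : lf (x + y) z = lf x z + lf y z.
Proof. by rewrite /lf !mulmxDl mxE. Qed.
Lemma lfZl k x z : lf (k *: x) z = k * lf x z.
Proof. by rewrite /lf -!scalemxAl mxE. Qed.
Lemma lfC x y : lf x y = lf y x.
Proof. rewrite !lfE; ring. Qed.
Lemma lfDr x y z : lf z (x + y) = lf z x + lf z y.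
Proof. by rewrite !(lfC z) lfDl. Qed.
Lemma lfZr k x z : lf z (k *: x) = k * lf z x.
Proof. by rewrite !(lfC z) lfZl. Qed.
Lemma lfNl x y : lf (- x) y = - lf x y.
Proof. by rewrite -scaleN1r lfZl mulN1r. Qed.
Lemma lfNr x y : lf x (- y) = - lf x y.
Proof. by rewrite !(lfC x) lfNl. Qed.

Lemma lf_iso g x y : is_isometry g -> lf (x *m g) (y *m g) = lf x y.
Proof. by move=> [gJ _]; rewrite /lf trmx_mul -!mulmxA (mulmxA g) (mulmxA (g *m _)) gJ. Qed.

(* The future timelike and the future causal vectors. *)
Definition tl y : Prop := 0 < y 0 0 /\ lf y y < 0.
Definition causal y : Prop := 0 < y 0 0 /\ lf y y <= 0.

Lemma tl_causal y : tl y -> causal y.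
Proof. by move=> [? /ltW]. Qed.

Lemma vecP x y : x 0 0 = y 0 0 -> c1 x = c1 y -> c2 x = c2 y -> c3 x = c3 y -> x = y.
Proof.
move=> e0 e1 e2 e3; apply/rowP => i; rewrite -(splitK i).
case: (fintype.split i) => j /=; first by rewrite ord1 ord00.
case: j => [[|[|[|//]]] h].
- by rewrite (_ : Ordinal h = 0) //; exact: val_inj.
- by rewrite (_ : Ordinal h = 1) //; exact: val_inj.
- by rewrite (_ : Ordinal h = 2%:R) //; exact: val_inj.
Qed.

(** Reversed Cauchy-Schwarz: the Euclidean inequality for the spatial parts, neither of which is
    longer than its time coordinate. *)
Lemma causal_lf x y : causal x -> causal y -> lf x y <= 0.
Proof.
move=> [x0 +] [y0 +]; rewrite !lfE.
move: (x 0 0) (y 0 0) (c1 x) (c1 y) (c2 x) (c2 y) (c3 x) (c3 y) x0 y0.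
move=> a b p p' q q' r r' a0 b0 H H'.
rewrite addrC subr_le0.
have ab : 0 < a * b by rewrite mulr_gt0.
case: (leP (p * p' + q * q' + r * r') 0) => [h|h]; first by rewrite (le_trans h) // ltW.
have CS : (p * p' + q * q' + r * r') ^+ 2 <= (p * p + q * q + r * r) * (p' * p' + q' * q' + r' * r').
  rewrite -subr_ge0.
  have -> : (p * p + q * q + r * r) * (p' * p' + q' * q' + r' * r') -
    (p * p' + q * q' + r * r') ^+ 2 = (p * q' - q * p') ^+ 2 + (p * r' - r * p') ^+ 2 + (q * r' - r * q') ^+ 2 by ring.
  by rewrite !addr_ge0 ?sqr_ge0.
rewrite -ler_sqr ?nnegrE; [|exact: ltW|exact: ltW]; apply: (le_trans CS).
have -> : (a * b) ^+ 2 = (a * a) * (b * b) by ring.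
by apply: ler_pM; rewrite ?addr_ge0 -?expr2 ?sqr_ge0 //; rewrite ?expr2; lra.
Qed.

Lemma causalD x y : causal x -> causal y -> causal (x + y).
Proof.
move=> Hx Hy; have h := causal_lf Hx Hy; case: Hx Hy => x0 hx [y0 hy].
split; first by rewrite mxE addr_gt0.
by rewrite lfDl !lfDr (lfC y x); lra.
Qed.

Lemma causalZ k x : 0 < k -> causal x -> causal (k *: x).
Proof.
move=> k0 [x0 hx]; split; first by rewrite mxE mulr_gt0.
by rewrite lfZl lfZr pmulr_rle0 // pmulr_rle0.
Qed.

Lemma tlZ k x : 0 < k -> tl x -> tl (k *: x).
Proof.
move=> k0 [x0 hx]; split; first by rewrite mxE mulr_gt0.
by rewrite lfZl lfZr pmulr_rlt0 // pmulr_rlt0.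
Qed.

(** Equality case of the reversed inequality: the difference of the two sides has time coordinate
    zero and nonpositive square, so it vanishes. *)
Lemma causal_parallel x y : causal x -> causal y -> lf x y = 0 ->
  y 0 0 *: x = x 0 0 *: y.
Proof.
move=> [x0 hx] [y0 hy] e.
have : lf (y 0 0 *: x - x 0 0 *: y) (y 0 0 *: x - x 0 0 *: y) <= 0.
  rewrite lfDl !lfDr !(lfNl, lfNr) !(lfZl, lfZr) e (lfC y x) e !(mulr0, oppr0, addr0, add0r).
  rewrite opprK; have := mulr_ge0 (sqr_ge0 (y 0 0)) (_ : 0 <= - lf x x).
  have := mulr_ge0 (sqr_ge0 (x 0 0)) (_ : 0 <= - lf y y).
  rewrite !oppr_ge0 => /(_ hy) + /(_ hx); rewrite !expr2; lra.
set d := _ - _.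
have d0 : d 0 0 = 0 by rewrite /d !mxE; ring.
rewrite lfE d0 => h; apply/eqP; rewrite -subr_eq0 -/d; apply/eqP.
have s1 := sqr_ge0 (c1 d); have s2 := sqr_ge0 (c2 d); have s3 := sqr_ge0 (c3 d).
by apply: vecP; rewrite ?d0 [RHS]mxE //; apply/eqP; rewrite -sqrf_eq0 eq_le ?s1 ?s2 ?s3 andbT; lra.
Qed.

Lemma tl_lf x y : tl x -> causal y -> lf x y < 0.
Proof.
move=> tx cy; rewrite lt_neqAle causal_lf ?andbT //; last exact: tl_causal.
apply/eqP => e; have := causal_parallel (tl_causal tx) cy e.
move=> /(congr1 (lf x)); rewrite !lfZr e mulr0 => /eqP.
rewrite mulf_eq0 gt_eqF ?cy.1 //= => /eqP e'.
by case: tx => _; rewrite e' ltxx.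
Qed.

Lemma tlD x y : tl x -> causal y -> tl (x + y).
Proof.
move=> Hx Hy; have h := tl_lf Hx Hy; case: Hx Hy => x0 hx [y0 hy].
split; first by rewrite mxE addr_gt0.
by rewrite lfDl !lfDr (lfC y x); lra.
Qed.

Lemma causal_tlD x y : causal x -> causal y -> (forall k, x <> k *: y) -> tl (x + y).
Proof.
move=> cx cy H; have h := causal_lf cx cy.
have h' : lf x y != 0.
  apply/eqP => /(causal_parallel cx cy) e; apply: (H ((y 0 0)^-1 * x 0 0)).
  by rewrite -scalerA -e scalerA mulVf ?scale1r // gt_eqF // cy.1.
case: cx cy => x0 hx [y0 hy]; split; first by rewrite mxE addr_gt0.
have : lf x y < 0 by rewrite lt_neqAle h'.
by rewrite lfDl !lfDr (lfC y x); lra.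
Qed.

Definition e0 : vec := row_mx 1%:M 0.

Lemma e0_tl : tl e0.
Proof.
have e : e0 0 0 = 1 by rewrite /e0 -ord00 row_mxEl mxE eqxx.
split; first by rewrite e.
by rewrite lfE e /e0 !row_mxEr !mxE; lra.
Qed.

(** Only the image of [e0] is known to point to the future. The sign passes to any other causal
    vector because its pairing with [e0] is negative and is preserved by g. *)
Lemma iso_gt0 g x : is_isometry g -> causal x -> 0 < (x *m g) 0 0.
Proof.
move=> ig cx; have [_ g0] := ig.
have eg : tl (e0 *m g).
  split; last by rewrite lf_iso //; exact: e0_tl.2.
  suff -> : (e0 *m g) 0 0 = g 0 0 by [].
  rewrite mxE (bigD1 0) //= big1 => [|i i0].
    by rewrite addr0 /e0 -{1}ord00 row_mxEl mxE eqxx mul1r.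
  rewrite /e0 -[i]/(i : 'I_(1 + 3)); case: (@splitP 1 3 i) => j ij.
    by case/eqP: i0; apply: val_inj; rewrite /= ij ord1.
  have -> : i = rshift 1 j by exact: val_inj.
  by rewrite row_mxEr mxE mul0r.
have h : lf (x *m g) (e0 *m g) < 0 by rewrite lf_iso // lfC tl_lf //; exact: e0_tl.
have hx : lf (x *m g) (x *m g) <= 0 by rewrite lf_iso //; exact: cx.2.
rewrite ltNge; apply/negP => le0.
move: le0; rewrite le_eqVlt => /orP[/eqP z|neg]; last first.
  have : causal (- (x *m g)) by split; [rewrite mxE oppr_gt0|rewrite lfNl lfNr opprK].
  by move=> /(tl_lf eg); rewrite lfNr lfC; lra.
suff z0 : x *m g = 0 by move: h; rewrite z0 -(scale0r 0) lfZl mul0r ltxx.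
set d := x *m g in z hx *; move: hx; rewrite lfE z => hx.
have s1 := sqr_ge0 (c1 d); have s2 := sqr_ge0 (c2 d); have s3 := sqr_ge0 (c3 d).
by apply: vecP; rewrite ?z [RHS]mxE //; apply/eqP; rewrite -sqrf_eq0 eq_le ?s1 ?s2 ?s3 andbT; lra.
Qed.

Lemma iso_causal g x : is_isometry g -> causal x -> causal (x *m g).
Proof. by move=> ig cx; split; [exact: iso_gt0|rewrite lf_iso //; exact: cx.2]. Qed.

Lemma iso_tl g x : is_isometry g -> tl x -> tl (x *m g).
Proof.
by move=> ig cx; split; [exact: (iso_gt0 ig (tl_causal cx))|rewrite lf_iso //; exact: cx.2].
Qed.

Definition pt y : point := (y 0 0)^-1 *: rsubmx y.

Lemma homog_pt y : y 0 0 != 0 -> homog (pt y) = (y 0 0)^-1 *: y.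
Proof.
move=> y0; have -> : (y 0 0)^-1 *: y = row_mx ((y 0 0)^-1 *: lsubmx y) ((y 0 0)^-1 *: rsubmx y).
  by rewrite -scale_row_mx hsubmxK.
congr row_mx.
by apply/matrixP => i j; rewrite !ord1 !mxE eqxx ord00 mulVf.
Qed.

Lemma ptK v : pt (homog v) = v.
Proof. by rewrite /pt homog00 invr1 scale1r /homog row_mxKr. Qed.

Lemma ptZ k y : k != 0 -> pt (k *: y) = pt y.
Proof.
move=> k0; rewrite /pt linearZ scalerA; congr (_ *: _).
by rewrite mxE invfM mulrAC mulVf // mul1r.
Qed.

Lemma actE g v : act g v = pt (homog v *m g).
Proof. by []. Qed.

Lemma lf_homog v : lf (homog v) (homog v) = sqnorm v - 1.
Proof.
rewrite lfE homog00 !row_mxEr /sqnorm !big_ord_recl big_ord0.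
rewrite (_ : lift _ _ = 1); last exact: val_inj.
rewrite (_ : lift _ _ = 2%:R); last exact: val_inj.
by rewrite !expr2; lra.
Qed.

Lemma H3E v : H3 v <-> tl (homog v).
Proof.
rewrite /H3 /= /tl homog00 lf_homog; split=> [h|[_]]; last by lra.
by split=> //; lra.
Qed.

Definition ball v : Prop := H3 v \/ sphere_infty v.

Lemma ballE v : ball v <-> causal (homog v).
Proof.
rewrite /ball /H3 /sphere_infty /= /causal homog00 lf_homog.
split=> [[h|h]|[_ h]]; [by split=> //; lra|by split=> //; lra|].
by case: (ltP (sqnorm v) 1) => h'; [left|right; lra].
Qed.

Lemma tl_pt y : tl y -> H3 (pt y) /\ homog (pt y) = (y 0 0)^-1 *: y.
Proof.
move=> ty; have y0 : y 0 0 != 0 by rewrite gt_eqF // ty.1.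
split; last exact: homog_pt.
by rewrite H3E homog_pt //; apply: tlZ => //; rewrite invr_gt0 ty.1.
Qed.

Lemma homog_act g v : is_isometry g -> ball v ->
  exists2 c, 0 < c & homog v *m g = c *: homog (act g v).
Proof.
move=> ig /ballE bv; have h := iso_gt0 ig bv.
exists ((homog v *m g) 0 0) => //.
by rewrite actE homog_pt ?gt_eqF // scalerA mulfV ?scale1r // gt_eqF.
Qed.

Lemma act_ball g v : is_isometry g -> ball v -> ball (act g v).
Proof.
move=> ig bv; have [c c0 e] := homog_act ig bv; apply/ballE.
have -> : homog (act g v) = c^-1 *: (homog v *m g) by rewrite e scalerA mulVf ?scale1r // gt_eqF.
by apply: causalZ; rewrite ?invr_gt0 //; apply: iso_causal => //; apply/ballE.
Qed.

Lemma act_mul g h v : is_isometry g -> ball v -> act (g *m h) v = act h (act g v).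
Proof.
move=> ig bv; have [c c0 e] := homog_act ig bv.
by rewrite (actE (g *m h)) mulmxA e -scalemxAl ptZ ?gt_eqF.
Qed.

End Lorentz.

(** * Triangulations as invariant sets of tetrahedra *)

Section Deck.
Variables (R : realType) (M : hyperbolic_manifold R).
Local Notation point := 'rV[R]_3.
Local Notation vec := 'rV[R]_(1 + 3).
Local Notation simplex := {fset 'rV[R]_3}.
Local Notation D := (deck M).
Local Notation orb := (simplex_orbit M).
Implicit Types (F G V W P : simplex) (x y z b : vec) (u v a : point).
Implicit Types (g h : 'M[R]_(1 + 3)) (L : set simplex).

Definition mv g F : simplex := [fset act g v | v in F].
Definition balls F : Prop := forall v, v \in F -> ball v.

Lemma deck_iso g : D g -> is_isometry g.
Proof. exact: deck_isometry. Qed.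
Lemma deck_unit g : D g -> g \in unitmx.
Proof. by move=> /deck_iso/isometry_unit. Qed.

Lemma balls_sub F V : F `<=` V -> balls V -> balls F.
Proof. by move=> FV bV v /(fsubsetP FV)/bV. Qed.

Lemma balls_mv g F : D g -> balls F -> balls (mv g F).
Proof. by move=> /deck_iso Dg bF u /imfsetP[v /= /bF bv ->]; exact: act_ball. Qed.

Lemma act1' v : act 1%:M v = v.
Proof. by rewrite actE mulmx1 ptK. Qed.

Lemma mv1 F : mv 1%:M F = F.
Proof.
apply/fsetP => v; apply/imfsetP/idP => /= [[u uF ->]|vF]; first by rewrite act1'.
by exists v; rewrite ?act1'.
Qed.

Lemma mvM g h F : D g -> balls F -> mv (g *m h) F = mv h (mv g F).
Proof.
move=> Dg bF; rewrite /mv -imfset_comp; apply: eq_in_imfset => //= v vF.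
by rewrite act_mul //; [exact: deck_iso|exact: bF].
Qed.

Lemma actK g v : D g -> ball v -> act (invmx g) (act g v) = v.
Proof.
by move=> Dg bv; rewrite -act_mul ?mulmxV ?act1' ?deck_unit //; exact: deck_iso.
Qed.
Lemma actKV g v : D g -> ball v -> act g (act (invmx g) v) = v.
Proof.
move=> Dg bv; rewrite -act_mul ?mulVmx ?act1' ?deck_unit //.
by apply: deck_iso; exact: deckV.
Qed.

Lemma mvK g F : D g -> balls F -> mv (invmx g) (mv g F) = F.
Proof. by move=> Dg bF; rewrite -mvM ?mulmxV ?mv1 ?deck_unit. Qed.
Lemma mvKV g F : D g -> balls F -> mv g (mv (invmx g) F) = F.
Proof. by move=> Dg bF; rewrite -mvM ?mulVmx ?mv1 ?deck_unit //; exact: deckV. Qed.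

Lemma act_inj g u v : D g -> ball u -> ball v -> act g u = act g v -> u = v.
Proof. by move=> Dg bu bv e; rewrite -(actK Dg bu) e actK. Qed.

Lemma mem_mv g v F : D g -> balls F -> ball v -> (act g v \in mv g F) = (v \in F).
Proof.
move=> Dg bF bv; apply/imfsetP/idP => /= [[u uF e]|vF]; last by exists v.
by rewrite (act_inj Dg bv (bF _ uF) e).
Qed.

Lemma card_mv g F : D g -> balls F -> #|` mv g F| = #|` F|.
Proof.
move=> Dg bF; apply/eqP; rewrite -/(mv g F) /mv.
apply/eqP/card_in_imfset => u v /= uF vF; exact: act_inj Dg (bF _ uF) (bF _ vF).
Qed.

Lemma mv_sub g F V : F `<=` V -> mv g F `<=` mv g V.
Proof.
move=> FV; apply/fsubsetP => u /imfsetP[v /= vF ->].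
by apply/imfsetP; exists v => //=; exact: (fsubsetP FV).
Qed.

Lemma mv_inj g F V : D g -> balls F -> balls V -> mv g F = mv g V -> F = V.
Proof. by move=> Dg bF bV e; rewrite -(mvK Dg bF) e mvK. Qed.

Lemma mv0 g F : (mv g F == fset0) = (F == fset0).
Proof.
apply/eqP/eqP => [e|->]; last by rewrite /mv imfset0.
apply/eqP; apply/fset0Pn => -[v vF]; have : act g v \in mv g F.
  by apply/imfsetP; exists v.
by rewrite e inE.
Qed.

Lemma mvD1 g F v : D g -> balls F -> ball v -> mv g (F `\ v) = mv g F `\ act g v.
Proof.
move=> Dg bF bv; apply/fsetP => u; rewrite !inE; apply/imfsetP/andP => /=.
  move=> [w]; rewrite !inE => /andP[wv wF] ->; split; last by apply/imfsetP; exists w.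
  by apply: contraNneq wv => /(act_inj Dg (bF _ wF) bv) ->.
move=> [uv /imfsetP[/= w wF e]]; exists w => //; rewrite !inE wF andbT.
by apply: contraNneq uv => <-; rewrite e.
Qed.

(** The linear action rescales each [homog v]. The weights absorb these factors, which are positive
    on the closed ball, so cones go to cones. *)
Lemma comb_mv g F (w : point -> R) : D g -> balls F ->
  comb F w *m g = comb (mv g F)
    (fun u => w (act (invmx g) u) * (homog (act (invmx g) u) *m g) 0 0).
Proof.
move=> Dg bF; rewrite /comb mulmx_suml [RHS]big_imfset /=; last first.
  by move=> u v uF vF; exact: act_inj Dg (bF _ uF) (bF _ vF).
apply: eq_big_seq => v vF; rewrite actK //; last exact: bF.
rewrite -scalemxAl -scalerA; congr (_ *: _).
have [c c0 e] := homog_act (deck_iso Dg) (bF _ vF).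
by rewrite {2}e e mxE homog00 mulr1.
Qed.

Let co_mv1 g F y : D g -> balls F -> co F y -> co (mv g F) (y *m g).
Proof.
move=> Dg bF [w w0 ->]; rewrite comb_mv //; eexists; last by [].
move=> u /imfsetP[v /= vF ->]; rewrite actK //; last exact: bF.
rewrite mulr_gt0 ?w0 // iso_gt0 //; first exact: deck_iso.
by apply/ballE/bF.
Qed.

Lemma co_mv g F y : D g -> balls F -> co (mv g F) (y *m g) <-> co F y.
Proof.
move=> Dg bF; split; last exact: co_mv1.
move=> /(co_mv1 (deckV Dg) (balls_mv Dg bF)); rewrite mvK // -mulmxA mulmxV ?deck_unit //.
by rewrite mulmx1.
Qed.

Let cc_mv1 g F y : D g -> balls F -> cc F y -> cc (mv g F) (y *m g).
Proof.
move=> Dg bF [w w0 ->]; rewrite comb_mv //; eexists; last by [].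
move=> u /imfsetP[v /= vF ->]; rewrite actK //; last exact: bF.
rewrite mulr_ge0 ?w0 // ltW // iso_gt0 //; first exact: deck_iso.
by apply/ballE/bF.
Qed.

Lemma cc_mv g F y : D g -> balls F -> cc (mv g F) (y *m g) <-> cc F y.
Proof.
move=> Dg bF; split; last exact: cc_mv1.
move=> /(cc_mv1 (deckV Dg) (balls_mv Dg bF)); rewrite mvK // -mulmxA mulmxV ?deck_unit //.
by rewrite mulmx1.
Qed.

Lemma indep_mv g F : D g -> balls F -> indep F -> indep (mv g F).
Proof.
move=> Dg bF iF w e u uF; have Dg' := deckV Dg.
have := comb_mv w Dg' (balls_mv Dg bF).
rewrite e mul0mx mvK // => /esym/iF h.
have [v vF ev] := imfsetP _ _ _ _ uF.
have := h v vF; rewrite ev invmxK => /eqP; rewrite mulf_eq0 => /orP[/eqP//|].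
rewrite gt_eqF // iso_gt0 //; first exact: deck_iso.
by apply/ballE; apply: act_ball; [exact: deck_iso|exact: bF].
Qed.

Definition tetra V : Prop := frame V /\ balls V.

Lemma tetraE V : tetrahedron V <-> tetra V.
Proof.
split=> [[cV /indepE iV bV]|[[iV cV] bV]]; first by [].
by split=> //; apply/indepE.
Qed.

Lemma tetra_mv g V : D g -> tetra V -> tetra (mv g V).
Proof.
move=> Dg [[iV cV] bV]; split; last exact: balls_mv.
by split; [exact: indep_mv|rewrite card_mv].
Qed.

Definition face L F : Prop := F != fset0 /\ exists2 V, L V & F `<=` V.

Definition locally_finite L : Prop := forall K : set point, compact K ->
  (K `<=` @H3 R)%classic -> finite_set [set V | L V /\ (hull V `&` K !=set0)%classic].

(* [L] is the set of all lifts of the tetrahedra of a geometric triangulation. *)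
Definition good L : Prop :=
  [/\ forall V, L V -> tetra V, forall g V, D g -> L V -> L (mv g V),
      finite_set (orb @` L)%classic,
      forall p, H3 p -> exists! F, face L F /\ co F (homog p)
    & locally_finite L].

Lemma orb_self V : orb V V.
Proof. by exists 1%:M; [exact: deck1|exact: mv1]. Qed.

Lemma orb_mv g V : D g -> balls V -> orb (mv g V) = orb V.
Proof.
move=> Dg bV; apply/seteqP; split=> W [h Dh <-].
  by exists (g *m h); [exact: deckM|exact: mvM].
exists (invmx g *m h); first by apply: deckM => //; exact: deckV.
by rewrite -/(mv _ _) mvM ?mvK //; [exact: deckV|exact: balls_mv].
Qed.

Lemma orb_eq V W : balls W -> orb V = orb W <-> exists2 g, D g & V = mv g W.
Proof.
move=> bW; split=> [e|[g Dg ->]]; last exact: orb_mv.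
by have := orb_self V; rewrite e => -[g Dg <-]; exists g.
Qed.

Lemma geo_good (t : triangulation R) : geometric_triangulation M t ->
  good (lifted t) /\ t = (orb @` lifted t)%classic.
Proof.
move=> [ft tt tu tl].
have TT V : lifted t V -> tetra V /\ t (orb V).
  move=> [s ts sV]; have [V0 /tetraE tV0 es] := tt s ts; move: sV; rewrite es => -[g Dg <-].
  split; first exact: tetra_mv.
  by rewrite (orb_mv Dg tV0.2) -es.
have et : t = (orb @` lifted t)%classic.
  apply/seteqP; split=> s; last by move=> [V /TT[_ h] <-].
  move=> ts; have [V0 tV0 es] := tt s ts; exists V0 => //.
  by exists s => //; rewrite es; exact: orb_self.
split=> //; split=> //.
- by move=> V /TT[].
- move=> g V Dg [s ts sV]; exists s => //; have [V0 /tetraE tV0 es] := tt s ts.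
  move: sV; rewrite es => -[h Dh <-]; exists (h *m g); first exact: deckM.
  by rewrite -/(mv _ _) mvM //; exact: tV0.2.
- by rewrite -et.
- move=> p /tu[F [[[F0 [V tV FV]] Fp] Fu]]; exists F; split.
    by split; [split=> //; exists V|apply/rel_interiorE].
  move=> G [[G0 [W tW GW]] Gp]; apply: Fu; split; last by apply/rel_interiorE.
  by split=> //; exists W.
Qed.

Lemma lifted_orb L : good L -> lifted (orb @` L)%classic = L.
Proof.
move=> [Lt Lg _ _ _]; apply/seteqP; split=> V.
  by move=> [s [W LW <-] [g Dg <-]]; exact: Lg.
by move=> LV; exists (orb V); [exists V|exact: orb_self].
Qed.

Lemma good_geo L : good L -> geometric_triangulation M (orb @` L)%classic.
Proof.
move=> gL; have e := lifted_orb gL; case: gL => Lt Lg Lf Lu Ll; split=> //.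
- by move=> s [V /Lt tV <-]; exists V => //; apply/tetraE.
- move=> p /Lu[F [[[F0 [V tV FV]] Fp] Fu]]; exists F; split.
    by split; [split=> //; exists V => //; rewrite e|apply/rel_interiorE].
  move=> G [[G0 [W]]]; rewrite e => tW GW /rel_interiorE Gp; apply: Fu; split=> //.
  by split=> //; exists W.
- by rewrite e.
Qed.

Section Good.
Variables (L : set simplex) (gL : good L).

Lemma good_tetra V : L V -> tetra V. Proof. by case: gL => H _ _ _ _ /H. Qed.
Lemma good_frame V : L V -> frame V. Proof. by move=> /good_tetra[]. Qed.
Lemma good_balls V : L V -> balls V. Proof. by move=> /good_tetra[]. Qed.
Lemma good_mv g V : D g -> L V -> L (mv g V). Proof. by case: gL => _ H _ _ _ Dg /H; apply. Qed.

Lemma face_balls F : face L F -> balls F.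
Proof. by move=> [_ [V LV FV]]; apply: balls_sub FV (good_balls LV). Qed.

Lemma face_indep F : face L F -> indep F.
Proof. by move=> [_ [V LV FV]]; apply: indep_sub FV (good_frame LV).1. Qed.

Lemma face_mv g F : D g -> face L F -> face L (mv g F).
Proof.
move=> Dg [F0 [V LV FV]]; split; first by rewrite mv0.
by exists (mv g V); [exact: good_mv|exact: mv_sub].
Qed.

Lemma tetra_neq0 V : L V -> V != fset0.
Proof. by move=> /good_frame[_ cV]; rewrite -cardfs_gt0 cV. Qed.

Lemma face_self V : L V -> face L V.
Proof. by move=> LV; split; [exact: tetra_neq0|exists V]. Qed.

Lemma carrier y : tl y -> exists2 F, face L F & co F y.
Proof.
move=> ty; have [h e] := tl_pt ty; case: gL => _ _ _ Lu _.
have [F [[fF cF] _]] := Lu _ h; exists F => //; move: cF; rewrite e coZE //.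
by rewrite invr_gt0 ty.1.
Qed.

Lemma face_uniq F G y : tl y -> face L F -> face L G -> co F y -> co G y -> F = G.
Proof.
move=> ty fF fG cF cG; have [h e] := tl_pt ty; case: gL => _ _ _ Lu _.
have [H [_ Hu]] := Lu _ h.
have y0 : 0 < (y 0 0)^-1 by rewrite invr_gt0 ty.1.
by rewrite -(Hu F) ?e; [apply: Hu; split=> //; rewrite e|split=> //]; rewrite coZE.
Qed.

End Good.

End Deck.

(** * Stabilisers of simplices and the local structure of a triangulation *)

Section Local.
Variables (R : realType) (M : hyperbolic_manifold R).
Local Notation point := 'rV[R]_3.
Local Notation vec := 'rV[R]_(1 + 3).
Local Notation simplex := {fset 'rV[R]_3}.
Local Notation D := (deck M).
Local Notation good := (good M).
Implicit Types (F G V W P : simplex) (x y z b : vec) (u v a : point).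
Implicit Types (g h : 'M[R]_(1 + 3)) (L : set simplex).

Lemma co_causal F y : F != fset0 -> balls F -> co F y -> causal y.
Proof.
elim/finSet_rect: F y => F IH y F0 bF [w w0 e].
have [v vF] := fset0Pn _ F0.
have cv : causal (w v *: homog v) by apply: causalZ; [exact: w0|apply/ballE/bF].
rewrite e (combD1 _ vF); case: (F `\ v =P fset0) => [->|/eqP Fv0].
  by rewrite comb0 ?addr0 // => u; rewrite inE.
apply: causalD => //; apply: (IH (F `\ v)) => //; first exact: fproperD1.
  by apply: balls_sub bF; exact: fsubD1set.
by exists w => // u; rewrite !inE => /andP[_ /w0].
Qed.

(** Two non-parallel causal vectors have a timelike sum, and adding causal vectors keeps it
    timelike. So a face with at least two vertices has its interior in [H3], even if all its
    vertices are ideal. *)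
Lemma co_tl F y : balls F -> indep F -> (1 < #|` F|)%N -> co F y -> tl y.
Proof.
move=> bF iF cF [w w0 e].
have [v vF] : exists v, v \in F by apply/fset0Pn; rewrite -cardfs_gt0 ltnW.
have F'0 : F `\ v != fset0 by move: cF; rewrite (cardfsD1 v) vF -cardfs_gt0.
have [u] := fset0Pn _ F'0; rewrite !inE => /andP[uv uF].
have cv : causal (w v *: homog v) by apply: causalZ; [exact: w0|apply/ballE/bF].
have cu : causal (w u *: homog u) by apply: causalZ; [exact: w0|apply/ballE/bF].
have uF' : u \in F `\ v by rewrite !inE uv.
have vu : tl (w v *: homog v + w u *: homog u).
  apply: causal_tlD => // k ek.
  have := iF (fun p => w v * (p == v)%:R + - (k * w u) * (p == u)%:R).
  rewrite (combD F (fun p => w v * (p == v)%:R)) (combZ F (w v) (fun p => (p == v)%:R)).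
  rewrite (combZ F (- (k * w u)) (fun p => (p == u)%:R)) !comb1 // ek scaleNr scalerA subrr.
  move=> /(_ erefl v vF) /eqP; rewrite eqxx (_ : v == u = false) ?mulr0 ?addr0 ?mulr1.
    by rewrite gt_eqF ?w0.
  by rewrite eq_sym; apply: negbTE.
rewrite e (combD1 _ vF) (combD1 _ uF') addrA.
case: (F `\ v `\ u =P fset0) => [->|/eqP Fv0].
  by rewrite comb0 ?addr0 // => p; rewrite inE.
apply: tlD => //; apply: (co_causal Fv0).
  by apply: balls_sub bF; rewrite fsetDDl; exact: fsubsetDl.
by exists w => // p; rewrite !inE => /and3P[_ _ /w0].
Qed.

Lemma tetra_tl V y : tetra V -> co V y -> tl y.
Proof. by move=> [[iV cV] bV]; apply: co_tl => //; rewrite cV. Qed.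

Lemma fix_tl g y k : D g -> tl y -> y *m g = k *: y -> g = 1%:M.
Proof.
move=> Dg ty e; have [h hy] := tl_pt ty; apply: (deck_free Dg h).
have k0 : k != 0.
  apply/eqP => k0; have := iso_gt0 (deck_iso Dg) (tl_causal ty).
  by rewrite e k0 scale0r mxE ltxx.
by rewrite actE hy -scalemxAl e !ptZ // invr_neq0 // gt_eqF // ty.1.
Qed.

Fixpoint gp g n : 'M[R]_(1 + 3) := if n is n'.+1 then gp g n' *m g else 1%:M.

Lemma gp_deck g n : D g -> D (gp g n).
Proof. by move=> Dg; elim: n => [|n IH] /=; [exact: deck1|exact: deckM]. Qed.

(** Averaging: the sum of the images of [e0] under the powers of g is timelike and fixed by g,
    whereas deck transformations act freely. *)
Lemma torsion g n : D g -> (0 < n)%N -> gp g n = 1%:M -> g = 1%:M.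
Proof.
move=> Dg n0 e; pose y := \sum_(i < n) @e0 R *m gp g i.
have ty : tl y.
  rewrite /y; case: n n0 {e y} => // n _; elim: n => [|n IH].
    by rewrite big_ord1 mulmx1; exact: e0_tl.
  rewrite big_ord_recr; apply: tlD => //; apply: tl_causal.
  by apply: iso_tl; [exact: deck_iso (gp_deck _ Dg)|exact: e0_tl].
apply: (@fix_tl g y 1) => //; rewrite scale1r /y mulmx_suml.
case: n n0 e {ty y} => // n _ e.
under eq_bigr do rewrite -mulmxA -/(gp g _.+1).
by rewrite big_ord_recr /= [in RHS]big_ord_recl /= -[gp g n *m g]/(gp g n.+1) e addrC.
Qed.

Lemma gp_act g n v : D g -> ball v -> act (gp g n) v = iter n (act g) v.
Proof.
move=> Dg bv; elim: n => [|n IH]; first exact: act1'.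
by rewrite /= act_mul ?IH //; exact: deck_iso (gp_deck _ Dg).
Qed.

Lemma gp_mv g n V : D g -> balls V -> mv g V = V -> mv (gp g n) V = V.
Proof.
move=> Dg bV e; elim: n => [|n IH]; first exact: mv1.
by rewrite /= (mvM _ (gp_deck n Dg) bV) IH.
Qed.

Lemma gp_fix g V : D g -> balls V -> mv g V = V ->
  exists2 n, (0 < n)%N & forall v, v \in V -> act (gp g n) v = v.
Proof.
move=> Dg bV e.
have Vg (v : V) : act g (val v) \in V by rewrite -[X in _ \in X]e; apply/imfsetP; exists (val v) => //=; exact: valP.
pose f (v : V) : V := [` Vg v].
have fi : injective f.
  move=> u v /(congr1 val) /= h; apply: val_inj.
  by apply: act_inj Dg (bV _ (valP u)) (bV _ (valP v)) h.
pose s := perm fi; exists #[s]%g; first exact: order_gt0.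
move=> v vV; rewrite gp_act //; last exact: bV.
have it n : iter n (act g) v = val ((s ^+ n)%g [` vV]).
  elim: n => [|n IH]; first by rewrite expg0 perm1.
  by rewrite /= IH expgSr permM permE.
by rewrite it expg_order perm1.
Qed.

(** Some power of g fixes all vertices. If one of them is material, freeness applies. Otherwise the
    power scales three lightlike vectors, and invariance of the form makes the pairwise products of
    the factors 1. Being positive, they equal 1, and the sum of two of these vectors is a fixed
    timelike vector. *)
Lemma tetra_stab g V : D g -> tetra V -> mv g V = V -> g = 1%:M.
Proof.
move=> Dg [[iV cV] bV] e.
have [n n0 H] := gp_fix Dg bV e; apply: (torsion Dg n0).
set k := gp g n in H *; have Dk : D k by exact: gp_deck.
have [hv|hv] := pselect (exists2 v, v \in V & H3 v).
  by have [v vV hv'] := hv; apply: (deck_free Dk hv'); exact: H.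
have hc v : v \in V -> exists2 c, 0 < c & homog v *m k = c *: homog v.
  by move=> vV; have [c c0] := homog_act (deck_iso Dk) (bV _ vV); rewrite H //; exists c.
have [u uV] : exists u, u \in V by apply/fset0Pn; rewrite -cardfs_gt0 cV.
have [v] : exists v, v \in V `\ u.
  by apply/fset0Pn; rewrite -cardfs_gt0; move: cV; rewrite (cardfsD1 u) uV ; rewrite add1n => -[->].
rewrite !inE => /andP[vu vV].
have [w] : exists w, w \in V `\ u `\ v.
  by apply/fset0Pn; rewrite -cardfs_gt0; move: cV; rewrite (cardfsD1 u) uV (cardfsD1 v) !inE vu vV; rewrite !add1n => -[->].
rewrite !inE => /and3P[wv wu wV].
have pr p q c d : p \in V -> q \in V -> p != q -> homog p *m k = c *: homog p ->
    homog q *m k = d *: homog q -> c * d = 1.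
  move=> pV qV pq ep eq; have := lf_iso (homog p) (homog q) (deck_iso Dk).
  rewrite ep eq lfZl lfZr => h.
  have l0 : lf (homog p) (homog q) != 0.
    apply: contra pq => /eqP /causal_parallel.
    by rewrite !homog00 !scale1r => H'; apply/eqP/homog_inj/H'; apply/ballE/bV.
  by apply: (mulIf l0); rewrite mul1r -[RHS]h; ring.
have [c c0 ec] := hc _ uV; have [d d0 ed] := hc _ vV; have [f f0 ef] := hc _ wV.
have h1 : c * d = 1 by apply: pr ec ed; rewrite // eq_sym.
have h2 : c * f = 1 by apply: pr ec ef; rewrite // eq_sym.
have h3 : d * f = 1 by apply: pr ed ef; rewrite // eq_sym.
have df : d = f by apply: (mulfI (negbT (gt_eqF c0))); rewrite h1.
have d1 : d = 1.
  apply/eqP; rewrite -(@eqrXn2 _ 2) ?ltW // expr1n expr2 {2}df h3 //.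
have c1 : c = 1 by rewrite -[c]mulr1 -{1}d1 h1.
apply: (@fix_tl k (homog u + homog v) 1) => //.
  apply: (@co_tl [fset u; v]).
  - by move=> p; rewrite !inE => /orP[] /eqP ->; exact: bV.
  - by apply: indep_sub iV; apply/fsubsetP => p; rewrite !inE => /orP[] /eqP ->.
  - by rewrite cardfs2 eq_sym vu.
  by apply: coD; exists (fun=> 1) => //; rewrite comb_set1 scale1r.
by rewrite mulmxDl ec ed c1 d1 !scale1r.
Qed.

Lemma fset_of_finite (T : choiceType) (A : set T) : finite_set A ->
  exists X : {fset T}, forall p, A p <-> p \in X.
Proof.
move=> /finite_fsetP[X ->]; exists X => p; split=> //.
Qed.

Section Good.
Variables (L : set simplex) (gL : good L).

Lemma cc_face_sub V F y : tl y -> L V -> cc V y -> face L F -> co F y -> F `<=` V.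
Proof.
move=> ty LV Vy fF cF.
have cs := co_supp (good_frame gL LV) Vy.
suff <- : supp V y = F by exact: supp_sub.
apply: (face_uniq gL ty) => //; split; last by exists V => //; exact: supp_sub.
apply: contraTneq (ty.1) => e; move: cs; rewrite e => -[w _ ->].
by rewrite comb0 ?mxE ?ltxx // => v; rewrite inE.
Qed.

Lemma segment_finite y z : tl y -> tl z -> exists A : {fset simplex},
  forall V, L V -> (exists s t, [/\ 0 <= s, 0 <= t, 0 < s + t & cc V (s *: y + t *: z)]) ->
  V \in A.
Proof.
move=> ty tz; have [hy ey] := tl_pt ty; have [hz ez] := tl_pt tz.
pose f (s : R) : point := pt y + s *: (pt z - pt y).
pose K : set point := (f @` `[0, 1])%classic.
have cK : compact K.
  apply: continuous_compact; last exact: segment_compact.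
  apply: continuous_subspaceT => s; apply: cvgD; first exact: cvg_cst.
  by apply: cvgZr_tmp; exact: cvg_id.
have fE s : homog (f s) = (1 - s) *: homog (pt y) + s *: homog (pt z).
  rewrite /homog !scale_row_mx add_row_mx; congr row_mx.
    by apply/matrixP => i j; rewrite !mxE; ring.
  by apply/matrixP => i j; rewrite !mxE; ring.
have KH : (K `<=` @H3 R)%classic.
  move=> p [s]; rewrite /= in_itv /= => /andP[s0 s1] <-; apply/H3E; rewrite fE.
  move: s0; rewrite le_eqVlt => /orP[/eqP <-|s0].
    by rewrite subr0 scale1r scale0r addr0; apply/H3E.
  move: s1; rewrite le_eqVlt => /orP[/eqP ->|s1].
    by rewrite subrr scale0r scale1r add0r; apply/H3E.
  apply: tlD; first by apply: tlZ; [rewrite subr_gt0|apply/H3E].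
  by apply: causalZ => //; apply: tl_causal; apply/H3E.
case: gL => _ _ _ _ Ll; have [A HA] := fset_of_finite (Ll K cK KH).
exists A => V LV [s [t [s0 t0 st cV]]]; apply/HA; split=> //.
pose a := s * y 0 0; pose c := t * z 0 0.
have a0 : 0 <= a by rewrite mulr_ge0 // ltW // ty.1.
have c0 : 0 <= c by rewrite mulr_ge0 // ltW // tz.1.
have ac : 0 < a + c.
  move: s0 st; rewrite le_eqVlt => /orP[/eqP <-|s0 _].
    by rewrite add0r => t0'; rewrite ltr_wpDl // mulr_gt0 // tz.1.
  by rewrite ltr_pwDl // mulr_gt0 // ty.1.
exists (f (c / (a + c))); split; last first.
  exists (c / (a + c)) => //; rewrite /= in_itv /= divr_ge0 ?addr_ge0 //=.
  by rewrite ler_pdivrMr // mul1r lerDr.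
apply/hullE; rewrite fE ey ez !scalerA.
have -> : (1 - c / (a + c)) / y 0 0 = (a + c)^-1 * s.
  rewrite /a /c; move: (gt_eqF ac) (gt_eqF ty.1) => /negbT h1 /negbT h2.
  by rewrite /a /c in h1 *; field; rewrite h1 h2.
have -> : c / (a + c) / z 0 0 = (a + c)^-1 * t.
  rewrite /a /c; move: (gt_eqF ac) (gt_eqF tz.1) => /negbT h1 /negbT h2.
  by rewrite /a /c in h1 *; field; rewrite h1 h2.
rewrite -!scalerA -scalerDr; apply: ccZ => //.
by rewrite invr_ge0 ltW.
Qed.

Lemma point_finite y : tl y -> exists A : {fset simplex},
  forall V, L V -> cc V y -> V \in A.
Proof.
move=> ty; have [A HA] := segment_finite ty ty; exists A => V LV cV.
by apply: HA => //; exists 1, 0; split; rewrite ?addr0 // scale1r scale0r addr0.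
Qed.

Lemma evt_tl y z : tl y -> evt (fun e => tl (y + e *: z)).
Proof.
move=> [y0 yy].
have H1 := evt_lin (z 0 0) y0.
have yy' : 0 < - lf y y by rewrite oppr_gt0.
have H2 := evt_lin (- (lf y z *+ 2) - `|lf z z|) yy'.
have H3 := evt_lt (ltr01 : 0 < 1 :> R).
apply: evt_imp (evtI H1 (evtI H2 H3)) => e e0 [h1 [h2 h3]]; split.
  by rewrite !mxE.
rewrite lfDl !lfDr !(lfZl, lfZr) (lfC z y).
have hz : e * (e * lf z z) <= e * `|lf z z|.
  rewrite ler_pM2l //; apply: (le_trans (ler_norm _)); rewrite normrM gtr0_norm //.
  by rewrite ler_piMl // ltW.
move: h2; rewrite mulrDr mulrN mulrN mulr2n mulrDr; lra.
Qed.

(** Only finitely many tetrahedra meet a short segment from y in direction z, so one of them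
    contains [y + e *: z] for arbitrarily small e. Its coordinates are affine in e, which gives the
    sign conditions. *)
Lemma local_star y z : tl y -> exists2 V, L V & cc V y /\
  forall v, v \in V -> crd V y v = 0 -> 0 <= crd V z v.
Proof.
move=> ty; have [d d0 Hd] := evt_tl z ty.
have tyd := Hd d d0 (lexx _).
have [A HA] := segment_finite ty tyd.
have [[V VA [LV nV]]|H] := pselect (exists2 V, V \in A & L V /\ ~ evt (fun e => ~ cc V (y + e *: z))).
  have fV := good_frame gL LV.
  have key (c1 c2 : point -> R) v : v \in V -> evt (fun e => 0 < - crd V y v + e * - crd V z v) -> False.
    move=> vV H; apply: nV; apply: evt_imp H => e e0 H cV.
    move: cV; rewrite frame_cc // => /(_ v vV); rewrite crdD // crdZ //.
    move: H; rewrite mulrN; lra.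
  exists V => //; split.
    rewrite frame_cc // => v vV; rewrite leNgt; apply/negP => h.
    by apply: (key (crd V y) (crd V y) v vV); apply: evt_lin; rewrite oppr_gt0.
  move=> v vV yv; rewrite leNgt; apply/negP => h.
  apply: (key (crd V y) (crd V y) v vV); apply: evtT => e e0.
  by rewrite yv oppr0 add0r mulr_gt0 // oppr_gt0.
have H' : forall V, V \in A -> evt (fun e => L V -> ~ cc V (y + e *: z)).
  move=> V VA; case: (pselect (L V)) => LV; last by apply: evtT.
  case: (pselect (evt (fun e => ~ cc V (y + e *: z)))) => [|h].
    by apply: evt_imp.
  by case: H; exists V.
have [e e0 [[he te] ed]] := evt_ex (evtI (evtI (evt_all H') (evt_tl z ty)) (evt_lt d0)).
have [F [F0 [V LV FV]] cF] := carrier gL te.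
have cV : cc V (y + e *: z) by apply: cc_sub FV (co_cc cF).
exfalso; apply: (he V) => //; apply: HA => //.
exists (1 - e / d), (e / d); split.
- by rewrite subr_ge0 ler_pdivrMr // mul1r ltW.
- by rewrite divr_ge0 // ltW.
- by rewrite subrK.
by rewrite scalerDr scalerA divfK ?gt_eqF // addrA -scalerDl subrK scale1r.
Qed.

(** Modulo the span of F, z points into both tetrahedra. The left hand side of the inclusion is the
    carrier of [y + e *: z] for small e, computed in V; computed in [V'] it is the same face. *)
Lemma fan_uniq V V' F y z : L V -> L V' -> F `<=` V -> F `<=` V' -> tl y -> co F y ->
  (forall v, v \in V -> v \notin F -> 0 <= crd V z v) ->
  (forall v, v \in V' -> v \notin F -> 0 <= crd V' z v) ->
  F `|` [fset v in V | 0 < crd V z v] `<=` V' .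
Proof.
move=> LV LV' FV FV' ty cF H H'.
have fV := good_frame gL LV; have fV' := good_frame gL LV'.
have [y1 y2] := (frame_cosub y fV FV).1 cF; have [y1' y2'] := (frame_cosub y fV' FV').1 cF.
have cV := cc_sub FV (co_cc cF); have cV' := cc_sub FV' (co_cc cF).
have E : evt (fun e => co [fset v in V | (0 < crd V y v) || (0 < crd V z v)] (y + e *: z)).
  apply: cc_pert => // v vV yv; apply: H => //.
  by apply/negP => /y1; rewrite yv ltxx.
have E' : evt (fun e => co [fset v in V' | (0 < crd V' y v) || (0 < crd V' z v)] (y + e *: z)).
  apply: cc_pert => // v vV yv; apply: H' => //.
  by apply/negP => /y1'; rewrite yv ltxx.
have [e e0 [[h h'] t]] := evt_ex (evtI (evtI E E') (evt_tl z ty)).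
have sub W : [fset v in W | (0 < crd W y v) || (0 < crd W z v)] `<=` W.
  by apply/fsubsetP => v; rewrite !inE => /andP[].
have n0 W : [fset v in W | (0 < crd W y v) || (0 < crd W z v)] != fset0 \/ 
   ~ co [fset v in W | (0 < crd W y v) || (0 < crd W z v)] (y + e *: z).
  case: (_ =P fset0) => [->|/eqP]; [right|by left] => -[w _ e'].
  by have := t.1; rewrite e' comb0 ?mxE ?ltxx // => v; rewrite inE.
have fa W : L W -> co [fset v in W | (0 < crd W y v) || (0 < crd W z v)] (y + e *: z) ->
  face L [fset v in W | (0 < crd W y v) || (0 < crd W z v)].
  by move=> LW cW; split; [case: (n0 W)|exists W].
have e' := face_uniq gL t (fa _ LV h) (fa _ LV' h') h h'.
apply: fsubset_trans (sub V'); rewrite -e'.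
apply/fsubsetP => v; rewrite !inE => /orP[vF|/andP[-> ->]]; last by rewrite orbT.
by rewrite (fsubsetP FV) //= y1.
Qed.

Lemma fan_eq V V' F y z : L V -> L V' -> F `<=` V -> F `<=` V' -> tl y -> co F y ->
  (forall v, v \in V -> v \notin F -> 0 < crd V z v) ->
  (forall v, v \in V' -> v \notin F -> 0 <= crd V' z v) -> V = V'.
Proof.
move=> LV LV' FV FV' ty cF H H'.
have H1 v : v \in V -> v \notin F -> 0 <= crd V z v by move=> vV vF; apply/ltW/H.
have s : V `<=` V'.
  apply: fsubset_trans (fan_uniq LV LV' FV FV' ty cF H1 H').
  apply/fsubsetP => v vV; rewrite !inE vV /=; case: (boolP (v \in F)) => //= /H ->//.
by apply/eqP; rewrite eqEfcard s (good_frame gL LV).2 (good_frame gL LV').2.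
Qed.

(** The powers of g move V among the finitely many tetrahedra around an interior point of F, so two
    of them send V to the same place. Hence a positive power of g stabilises a tetrahedron and is
    trivial. *)
Lemma face_stab g F : D g -> face L F -> (1 < #|` F|)%N -> mv g F = F -> g = 1%:M.
Proof.
move=> Dg fF cF e; have bF := face_balls gL fF.
have [y Fy] := co_ex F; have ty := co_tl bF (face_indep gL fF) cF Fy.
have [F0 [V LV FV]] := fF; have bV := good_balls gL LV.
have [A HA] := point_finite ty.
have inA n : mv (gp g n) V \in A.
  have Dn := gp_deck n Dg; apply: HA; first exact: (good_mv gL).
  apply: cc_sub (co_cc Fy); rewrite -{1}(gp_mv n Dg bF e); exact: mv_sub.
pose f n : A := [` inA n].
have [i [j [ij fij]]] : exists i j, (i < j)%N /\ f i = f j.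
  apply: contrapT => H.
  have fi : injective (fun k : 'I_(#|{: A}|.+1) => f k).
    move=> i j eij; apply: val_inj; apply: contrapT => nij; apply: H.
    case: (ltngtP i j) => // lij; first by exists i, j.
    by exists j, i.
  by have := leq_card _ fi; rewrite card_ord ltnn.
have gpD n k : gp g (n + k) = gp g n *m gp g k.
  elim: k => [|k IH]; first by rewrite addn0 mulmx1.
  by rewrite [in LHS]addnS /= IH mulmxA.
have Di := gp_deck i Dg; have Dk := gp_deck (j - i) Dg.
apply: (torsion Dg (n := j - i)); first by rewrite subn_gt0.
apply: (tetra_stab (V := mv (gp g i) V)) => //.
  exact: tetra_mv Di (good_tetra gL LV).
by rewrite -(mvM _ Di bV) -gpD subnKC ?(ltnW ij) //; have := congr1 val fij.
Qed.

End Good.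
End Local.

(** * Replacing a region *)

Section Replace.
Variables (R : realType) (M : hyperbolic_manifold R).
Local Notation point := 'rV[R]_3.
Local Notation vec := 'rV[R]_(1 + 3).
Local Notation simplex := {fset 'rV[R]_3}.
Local Notation D := (deck M).
Local Notation orb := (simplex_orbit M).
Local Notation good := (good M).
Implicit Types (F G V W P : simplex) (x y z b : vec) (u v a : point).
Implicit Types (g h : 'M[R]_(1 + 3)) (L : set simplex).

(** A change in the quotient changes all translates of the chosen lifts. *)
Definition sat (T : set simplex) : set simplex :=
  [set V | exists g W, [/\ D g, T W & V = mv g W]]%classic.

Definition repl L (T T' : set simplex) : set simplex := ((L `\` sat T) `|` sat T')%classic.

Lemma sat_self (T : set simplex) V : T V -> sat T V.
Proof. by move=> TV; exists 1%:M, V; rewrite mv1; split=> //; exact: deck1. Qed.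

Lemma sat_mv (T : set simplex) g V : (forall W, T W -> balls W) -> D g -> sat T V -> sat T (mv g V).
Proof.
move=> bT Dg [h [W [Dh TW ->]]]; exists (h *m g), W; split=> //; first exact: deckM.
by rewrite (mvM _ Dh) //; exact: bT.
Qed.

Lemma sat_mvE (T : set simplex) g V : (forall W, T W -> balls W) -> balls V ->
  D g -> sat T (mv g V) -> sat T V.
Proof.
by move=> bT bV Dg /(sat_mv bT (deckV Dg)); rewrite (mvK Dg bV).
Qed.

Lemma sat_face (T : set simplex) F : (forall W, T W -> balls W) -> face (sat T) F ->
  exists g G, [/\ D g, face T G & F = mv g G].
Proof.
move=> bT [F0 [V [g [W [Dg TW eV]]] FV]].
have bF : balls F by apply: (balls_sub FV); rewrite eV; apply: (balls_mv Dg); exact: bT.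
exists g, (mv (invmx g) F); split=> //; last by rewrite (mvKV Dg bF).
split; first by rewrite mv0.
exists W => //; have -> : W = mv (invmx g) V by rewrite eV (mvK Dg (bT _ TW)).
exact: mv_sub.
Qed.

Lemma face_setU (T T' : set simplex) F : face (T `|` T')%classic F -> face T F \/ face T' F.
Proof. by move=> [F0 [V [TV|TV] FV]]; [left|right]; split=> //; exists V. Qed.

Lemma deck_eq g h : D g -> D h -> h *m invmx g = 1%:M -> h = g.
Proof.
move=> Dg Dh e; rewrite -[h]mulmx1 -(mulVmx (deck_unit Dg)) mulmxA e mul1mx //.
Qed.

Lemma mv_eq g h V : D g -> D h -> tetra V -> mv g V = mv h V -> g = h.
Proof.
move=> Dg Dh tV e; apply: deck_eq => //.
apply: (tetra_stab (deckM Dg (deckV Dh)) tV).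
by rewrite (mvM _ Dg tV.2) e (mvK Dh tV.2).
Qed.

Section Repl.
Variables (L : set simplex) (T T' : {fset simplex}).
Hypotheses (gL : good L) (TL : forall V, V \in T -> L V).
Hypothesis inj : forall g V, D g -> V \in T -> mv g V \in T -> g = 1%:M.
Hypothesis tT' : forall V, V \in T' -> tetra V.
Local Notation fT := (face [set` T]).
Local Notation fT' := (face [set` T']).
Hypothesis R2a : forall F y, tl y -> fT F -> co F y -> exists2 F', fT' F' & co F' y.
Hypothesis R2b : forall F y, tl y -> fT' F -> co F y -> exists2 F', fT F' & co F' y.
Hypothesis R2u : forall F G y, tl y -> fT' F -> fT' G -> co F y -> co G y -> F = G.
(** Faces on the boundary of the region are common to [T] and [T']; any other face has its whole
    star in [T]. So new faces never conflict with tetrahedra that stay. *)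
Hypothesis R3 : forall F F' y, tl y -> fT F -> fT' F' -> co F y -> co F' y ->
  F = F' \/ forall V, L V -> F `<=` V -> V \in T.

Local Notation L' := (repl L [set` T] [set` T']).

Let bT W : [set` T]%classic W -> balls W.
Proof. by move=> /TL/(good_balls gL). Qed.
Let bT' W : [set` T']%classic W -> balls W.
Proof. by move=> /tT'[]. Qed.
Let fTL F : fT F -> face L F.
Proof. by move=> [F0 [V /TL LV FV]]; split=> //; exists V. Qed.
Let bfT F : fT F -> balls F.
Proof. by move=> /fTL/(face_balls gL). Qed.
Let bfT' F : fT' F -> balls F.
Proof. by move=> [F0 [V /bT' bV FV]]; exact: balls_sub bV. Qed.

Let tl_mv g y : D g -> tl y -> tl (y *m g).
Proof. by move=> Dg; apply: iso_tl; exact: deck_iso Dg. Qed.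

Let invT g F y : D g -> balls F -> co (mv g F) y -> co F (y *m invmx g).
Proof.
by move=> Dg bF cF; apply/(co_mv _ Dg bF); rewrite (mulmxKV (deck_unit Dg)).
Qed.

Lemma repl_exists y : tl y -> exists2 F, face L' F & co F y.
Proof.
move=> ty; have [F fF cF] := carrier gL ty; have bF := face_balls gL fF.
have [[V [LV FV nV]]|H] := pselect (exists V, [/\ L V, F `<=` V & ~ sat [set` T]%classic V]).
  by exists F => //; split; [exact: fF.1|exists V => //; left].
have [F0 [V LV FV]] := fF.
have sV : sat [set` T]%classic V by apply: contrapT => nV; apply: H; exists V.
have [g [G [Dg fG eF]]] : exists g G, [/\ D g, fT G & F = mv g G].
  by apply: sat_face => //; split=> //; exists V.
rewrite eF in cF; have cG := invT Dg (bfT fG) cF.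
have [F' fF' cF'] := R2a (tl_mv (deckV Dg) ty) fG cG.
exists (mv g F').
  split; first by rewrite mv0; exact: fF'.1.
  have [_ [W TW FW]] := fF'; exists (mv g W); last exact: mv_sub.
  by right; exists g, W.
by move: cF'; rewrite -(co_mv _ Dg (bfT' fF')) (mulmxKV (deck_unit Dg)).
Qed.

Let typeB F y : tl y -> co F y -> face (sat [set` T']%classic) F ->
  exists g F' G, [/\ D g, fT' F', fT G, F = mv g F' &
     [/\ co F' (y *m invmx g), co G (y *m invmx g) & co (mv g G) y]].
Proof.
move=> ty cF /(sat_face bT')[g [F' [Dg fF' eF]]].
have cF' : co F' (y *m invmx g) by apply: invT => //; [exact: bfT'|rewrite -eF].
have [G fG cG] := R2b (tl_mv (deckV Dg) ty) fF' cF'.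
exists g, F', G; split=> //; split=> //.
by move: cG; rewrite -(co_mv _ Dg (bfT fG)) (mulmxKV (deck_unit Dg)).
Qed.

Let uAB F1 F2 y : tl y -> co F1 y -> co F2 y ->
  face (L `\` sat [set` T])%classic F1 -> face (sat [set` T']%classic) F2 -> F1 = F2.
Proof.
move=> ty c1 c2 [F10 [V [LV nV] FV]] /(typeB ty c2)[g [F' [G [Dg fF' fG e2 [cF' cG cgG]]]]].
have fF1 : face L F1 by split=> //; exists V.
have e1 : F1 = mv g G.
  by apply: (face_uniq gL ty) => //; apply: (face_mv gL Dg); exact: fTL.
rewrite e1 e2; congr mv.
have [->//|H] := R3 (tl_mv (deckV Dg) ty) fG fF' cG cF'.
exfalso; apply: nV; exists g, (mv (invmx g) V); split=> //; last first.
  by rewrite (mvKV Dg (good_balls gL LV)).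
apply: H; first by apply: (good_mv gL) => //; exact: deckV.
by rewrite -(mvK Dg (bfT fG)) -e1; exact: mv_sub.
Qed.

Let starT g h G H : D g -> D h -> fT H -> mv g G = mv h H -> fT G ->
  (forall V, L V -> G `<=` V -> V \in T) -> g = h.
Proof.
move=> Dg Dh fH e fG st; have [_ [W TW HW]] := fH.
have Dgi := deckV Dg.
have bW : balls W := bT TW.
have mW : mv (h *m invmx g) W = mv (invmx g) (mv h W) by rewrite (mvM _ Dh).
have : mv (h *m invmx g) W \in T.
  apply: st; first by rewrite mW; apply: (good_mv gL) => //; apply: (good_mv gL) => //; exact: TL.
  by rewrite mW -(mvK Dg (bfT fG)) e; apply: mv_sub; exact: mv_sub.
by move=> /(inj (deckM Dh Dgi) TW) /(deck_eq Dg Dh).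
Qed.

Lemma repl_uniq F1 F2 y : tl y -> face L' F1 -> face L' F2 -> co F1 y -> co F2 y -> F1 = F2.
Proof.
move=> ty /face_setU[f1|f1] /face_setU[f2|f2] c1 c2.
- apply: (face_uniq gL ty) => //.
    by have [? [V [LV _] FV]] := f1; split=> //; exists V.
  by have [? [V [LV _] FV]] := f2; split=> //; exists V.
- exact: uAB ty c1 c2 f1 f2.
- by apply/esym; exact: uAB ty c2 c1 f2 f1.
have [g [F1' [G [Dg fF1 fG e1 [cF1 cG cgG]]]]] := typeB ty c1 f1.
have [h [F2' [H [Dh fF2 fH e2 [cF2 cH chH]]]]] := typeB ty c2 f2.
have e : mv g G = mv h H.
  by apply: (face_uniq gL ty) => //; apply: (face_mv gL) => //; exact: fTL.
have [e1'|s1] := R3 (tl_mv (deckV Dg) ty) fG fF1 cG cF1; last first.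
  have gh := starT Dg Dh fH e fG s1; rewrite -gh in e2 cF2.
  by rewrite e1 e2; congr mv; exact: (R2u (tl_mv (deckV Dg) ty)).
have [e2'|s2] := R3 (tl_mv (deckV Dh) ty) fH fF2 cH cF2; last first.
  have gh := starT Dh Dg fG (esym e) fH s2; rewrite -gh in e1 cF1.
  by rewrite e1 e2; congr mv; exact: (R2u (tl_mv (deckV Dh) ty)).
by rewrite e1 e2 -e1' -e2'.
Qed.

Lemma repl_good : good L'.
Proof.
split.
- move=> V [[LV _]|[g [W [Dg TW ->]]]]; first exact: (good_tetra gL).
  exact: tetra_mv Dg (tT' TW).
- move=> g V Dg [[LV nV]|sV]; [left|right; exact: sat_mv].
  split; first exact: (good_mv gL).
  by move=> /(sat_mvE bT (good_balls gL LV) Dg).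
- case: gL => _ _ fL _ _.
  apply: (@sub_finite_set _ _ ((orb @` L) `|` (orb @` [set` T']))%classic).
    move=> s [V [[LV _]|[g [W [Dg TW ->]]]] <-]; first by left; exists V.
    by right; exists W => //; rewrite (orb_mv Dg (bT' TW)).
  rewrite finite_setU; split=> //; apply: finite_image; exact: finite_fset.
- move=> p /H3E tp; have [F fF cF] := repl_exists tp; exists F; split=> // G [fG cG].
  exact: repl_uniq tp fF fG cF cG.
move=> K cK KH; case: gL => _ _ _ _ Ll.
have fK := Ll K cK KH.
pose A := [set V | L V /\ (hull V `&` K !=set0)%classic]%classic.
(* A new tetrahedron [mv g W] that meets K shares a point of K with some old [mv g V0]. Stabilisers
   being trivial, g is determined by [V0] and [mv g V0], so these new tetrahedra are values of f on
   finitely many triples. *)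
pose f (q : simplex * simplex * simplex) :=
  mv (xget 1%:M [set g | D g /\ mv g q.1.1 = q.1.2]%classic) q.2.
apply: (@sub_finite_set _ _ (A `|` f @` (([set` T] `*` A) `*` [set` T'])))%classic; last first.
  rewrite finite_setU; split=> //; apply: finite_image; apply: finite_setX.
    by apply: finite_setX => //; exact: finite_fset.
  exact: finite_fset.
move=> V [[[LV _]|[g [W [Dg TW ->]]]] [p [/hullE hp Kp]]].
  by left; split=> //; exists p; split=> //; apply/hullE.
right.
have tp : tl (homog p) by apply/H3E/KH.
have tW := tT' TW.
have hp' : cc W (homog p *m invmx g).
  by apply/(cc_mv _ Dg tW.2); rewrite (mulmxKV (deck_unit Dg)).
have tp' := tl_mv (deckV Dg) tp.
have cS := co_supp tW.1 hp'.
have fS : fT' (supp W (homog p *m invmx g)).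
  split; last by exists W => //; exact: supp_sub.
  apply: contraTneq (tp'.1) => e; move: cS; rewrite e => -[w _ ->].
  by rewrite comb0 ?mxE ?ltxx // => v; rewrite inE.
have [F [F0 [V0 TV0 FV0]] cF] := R2b tp' fS cS.
have LV0 := TL TV0; have tV0 := good_tetra gL LV0.
exists (V0, mv g V0, W) => /=.
  split=> //=; split=> //=; split; first exact: (good_mv gL).
  exists p; split=> //; apply/hullE.
  have -> : homog p = homog p *m invmx g *m g by rewrite (mulmxKV (deck_unit Dg)).
  by apply/(cc_mv _ Dg tV0.2); exact: cc_sub FV0 (co_cc cF).
rewrite /f /=; case: xgetP => [h _ [Dh eh]|/(_ g)]; last by case.
by rewrite (mv_eq Dh Dg tV0 eh).
Qed.

End Repl.
End Replace.

Lemma fset_argmin (R : realType) (T : choiceType) (A : {fset T}) (f : T -> R) :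
  A != fset0 -> exists2 a, a \in A & forall c, c \in A -> f a <= f c.
Proof.
elim/finSet_rect: A => A IH /fset0Pn[a aA].
case: (A `\ a =P fset0) => [e|/eqP /(IH (A `\ a))].
  exists a => // c cA; case: (c =P a) => [->//|/eqP ca].
  by have : c \in A `\ a; [rewrite !inE ca|rewrite e inE].
case; first exact: fproperD1.
move=> d; rewrite !inE => /andP[da dA] H; case: (leP (f a) (f d)) => h.
  exists a => // c cA; case: (c =P a) => [->//|/eqP ca].
  by apply: (le_trans h); apply: H; rewrite !inE ca.
exists d => // c cA; case: (c =P a) => [->|/eqP ca]; first exact: ltW.
by apply: H; rewrite !inE ca.
Qed.

(** * Pachner moves *)

Section Circuit.
Variable R : realType.
Local Notation point := 'rV[R]_3.
Local Notation vec := 'rV[R]_(1 + 3).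
Local Notation simplex := {fset 'rV[R]_3}.
Implicit Types (F G V W P : simplex) (x y z b : vec) (u v a : point).
Implicit Types (l w : point -> R).

(* [l] is the linear dependence of the vertices of a degenerate 4-simplex; the facets opposite
   to its positive and to its negative coefficients fill the same region. *)
Definition circuit W l : Prop :=
  [/\ #|` W| = 5%N, comb W l = 0, forall v, v \in W -> l v != 0
    & exists2 a, a \in W & frame (W `\ a)].

Definition pos W l : simplex := [fset v in W | 0 < l v].
Definition side W l : {fset simplex} := [fset W `\ a | a in pos W l].

Variables (W : simplex) (l : point -> R).
Hypothesis cW : circuit W l.

Lemma circuitN : circuit W (fun v => - l v).
Proof.
case: cW => c0 c1 c2 c3; split=> //; first by rewrite combN c1 oppr0.
by move=> v vW; rewrite oppr_eq0 c2.
Qed.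

(** Subtracting the multiple of l that kills the weight at a leaves a dependence of the other four
    vertices, which are independent. *)
Lemma circuit_ker w : comb W w = 0 -> exists c, forall v, v \in W -> w v = c * l v.
Proof.
case: cW => c0 c1 c2 [a aW [ia _]] e; exists (w a / l a) => v vW.
pose m v := w v - w a / l a * l v.
have ma : m a = 0 by rewrite /m divfK ?subrr ?c2.
have em : comb W m = 0.
  rewrite /m (combD W w (fun v => - (w a / l a * l v))) e add0r.
  by rewrite (combN W (fun v => w a / l a * l v)) combZ c1 scaler0 oppr0.
case: (v =P a) => [->|/eqP va]; first by rewrite divfK ?c2.
move: em; rewrite (combD1 _ aW) ma scale0r add0r => /ia /(_ v).
by rewrite !inE va vW => /(_ isT) /eqP; rewrite subr_eq0 => /eqP.
Qed.

Lemma circuit_frame a : a \in W -> frame (W `\ a).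
Proof.
move=> aW; case: (cW) => c0 c1 c2 _; split; last first.
  by move: c0; rewrite (cardfsD1 a) aW add1n => -[].
move=> w e v vWa; pose m v := if v == a then 0 else w v.
have : comb W m = 0.
  rewrite (combD1 _ aW) /m eqxx scale0r add0r -[RHS]e; apply: eq_comb => u.
  by rewrite !inE => /andP[/negbTE -> _].
move=> /circuit_ker[c mc]; have := mc a aW; rewrite /m eqxx => /esym/eqP.
rewrite mulf_eq0 (negbTE (c2 a aW)) orbF => /eqP c00.
have := mc v; move: vWa; rewrite !inE => /andP[va vW] /(_ vW).
by rewrite /m (negbTE va) c00 mul0r.
Qed.

Lemma circuit_span y : exists w, y = comb W w.
Proof.
case: cW => _ _ _ [a aW fa]; have [w ->] := frame_span y fa.
by exists (fun v => if v \in W `\ a then w v else 0); rewrite -comb_ext // fsubD1set.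
Qed.

Lemma pos_sub : pos W l `<=` W.
Proof. by apply/fsubsetP => v; rewrite !inE => /andP[]. Qed.

Lemma circuit_sum : \sum_(v <- W) l v = 0.
Proof. by case: cW => _ c1 _ _; rewrite -comb00 c1 mxE. Qed.

Lemma pos_neq0 : pos W l != fset0.
Proof.
case: (cW) => c0 c1 c2 [a aW _]; apply/eqP => e.
have H v : v \in W -> l v < 0.
  move=> vW; rewrite lt_neqAle c2 //= leNgt; apply/negP => h.
  by have : v \in pos W l; [rewrite !inE vW|rewrite e inE].
have := circuit_sum; rewrite (big_fsetD1 a) //= => /eqP.
rewrite lt_eqF // -oppr_gt0 opprD ltr_pwDl ?oppr_gt0 ?H // oppr_ge0 big_seq.
by apply: sumr_le0 => v; rewrite !inE => /andP[_ /H/ltW].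
Qed.

Lemma pos_compl : pos W (fun v => - l v) = W `\` pos W l.
Proof.
case: cW => _ _ c2 _; apply/fsetP => v; rewrite !inE; case: (boolP (v \in W)) => vW; rewrite ?andbF //= andbT.
by rewrite oppr_gt0 -leNgt lt_neqAle c2.
Qed.

Lemma sideP F : F \in side W l -> exists a, [/\ a \in W, 0 < l a & F = W `\ a].
Proof. by move=> /imfsetP[a /=]; rewrite !inE => /andP[aW la] ->; exists a. Qed.

Lemma side_frame F : F \in side W l -> frame F.
Proof. by move=> /sideP[a [aW _ ->]]; exact: circuit_frame. Qed.

(** Subtract the largest multiple of l that keeps the weights nonnegative: a weight at a positive
    coefficient is the first to vanish, so the point lies in a facet of [side W l]. *)
Lemma circuit_low w : (forall v, v \in W -> 0 <= w v) ->
  exists w', [/\ forall v, v \in W -> 0 <= w' v, comb W w' = comb W w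
               & exists2 a, a \in pos W l & w' a = 0].
Proof.
move=> w0; case: (cW) => _ c1 c2 _.
have [a aP Ha] := fset_argmin (fun v => w v / l v) pos_neq0.
have := aP; rewrite !inE => /andP[aW la].
exists (fun v => w v - w a / l a * l v); split; last by exists a => //=; rewrite divfK ?subrr ?c2.
  move=> v vW; case: (ltP 0 (l v)) => lv.
    have := Ha v; rewrite !inE vW lv => /(_ isT).
    by rewrite ler_pdivlMr // subr_ge0.
  rewrite subr_ge0; apply: (le_trans _ (w0 v vW)); apply: mulr_ge0_le0 => //.
  by rewrite divr_ge0 ?w0 // ltW.
rewrite (combD W w (fun v => - (w a / l a * l v))).
by rewrite (combN W (fun v => w a / l a * l v)) combZ c1 scaler0 oppr0 addr0.
Qed.

Lemma side_cc y w : (forall v, v \in W -> 0 <= w v) -> y = comb W w ->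
  exists2 F, F \in side W l & cc F y.
Proof.
move=> w0 ->; have [w' [w0' <- [a aP a0]]] := circuit_low w0.
exists (W `\ a); first by apply/imfsetP; exists a.
have aW : a \in W by exact: (fsubsetP pos_sub).
exists w'; first by move=> v; rewrite !inE => /andP[_ /w0'].
by rewrite (combD1 _ aW) a0 scale0r add0r.
Qed.

Lemma side_face_ext F y : face [set` side W l] F -> co F y ->
  exists w, [/\ y = comb W w, forall v, v \in W -> 0 <= w v, forall v, v \in W -> (v \in F) = (0 < w v)
             & exists2 a, a \in pos W l & w a = 0].
Proof.
move=> [F0 [V /= /imfsetP[a /= aP ->] FV]] [w w0 ->].
have FW : F `<=` W by apply: fsubset_trans FV _; exact: fsubD1set.
exists (fun v => if v \in F then w v else 0); split.
- exact: comb_ext.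
- by move=> v vW; case: ifP => // /w0/ltW.
- by move=> v vW; case: ifP => [/w0 ->//|_]; rewrite ltxx.
exists a => //; case: ifP => // /(fsubsetP FV); by rewrite !inE eqxx.
Qed.

Lemma side_face F y : face [set` side W l] F -> co F y -> exists2 w, y = comb W w &
  forall v, v \in W -> 0 <= w v.
Proof. by move=> fF /(side_face_ext fF)[w [? ? _ _]]; exists w. Qed.

Lemma side_carrier y w : 0 < y 0 0 -> (forall v, v \in W -> 0 <= w v) -> y = comb W w ->
  exists2 F, face [set` side W l] F & co F y.
Proof.
move=> y0 w0 e; have [V VS cV] := side_cc w0 e.
have cS := co_supp (side_frame VS) cV; exists (supp V y) => //; split.
  apply: contraTneq y0 => e0; move: cS; rewrite e0 => -[w1 _ ->].
  by rewrite comb0 ?mxE ?ltxx // => v; rewrite inE.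
by exists V => //; exact: supp_sub.
Qed.

(** The two representations of y differ by c times l. Each vanishes at some vertex with positive
    coefficient, where the other is nonnegative; this forces both signs of c. *)
Lemma side_uniq F G y : face [set` side W l] F -> face [set` side W l] G ->
  co F y -> co G y -> F = G.
Proof.
move=> fF fG cF cG.
have [w [e w0 wF [a aP a0]]] := side_face_ext fF cF.
have [w' [e' w0' wG [a' aP' a0']]] := side_face_ext fG cG.
have sub H V : face [set` side W l] H -> H `<=` W.
  by move=> [_ [U /= /imfsetP[c /= _ ->] HU]]; apply: (fsubset_trans HU); exact: fsubD1set.
have : comb W (fun v => w v - w' v) = 0.
  by rewrite (combD W w (fun v => - w' v)) combN -e -e' subrr.
move=> /circuit_ker[c wc].
have [/andP[aW la] /andP[aW' la']] : (a \in W) && (0 < l a) /\ (a' \in W) && (0 < l a').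
  by move: aP aP'; rewrite !inE.
have c0 : c = 0.
  apply/eqP; rewrite eq_le; apply/andP; split.
    rewrite -(pmulr_lle0 _ la) -wc // a0 sub0r oppr_le0; exact: w0'.
  by rewrite -(pmulr_lge0 _ la') -wc // a0' subr0; exact: w0.
apply/fsetP => v; case: (boolP (v \in W)) => vW.
  by rewrite wF // wG //; have := wc v vW; rewrite c0 mul0r => /eqP; rewrite subr_eq0 => /eqP ->.
have nF H : face [set` side W l] H -> v \notin H.
  by move=> /(sub _ W)/fsubsetP s; apply: contra vW => /s.
by rewrite (negbTE (nF _ fF)) (negbTE (nF _ fG)).
Qed.

End Circuit.

(** * A Pachner move as the exchange of the two sides of a circuit *)

Section Flip.
Variables (R : realType) (M : hyperbolic_manifold R).
Local Notation point := 'rV[R]_3.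
Local Notation vec := 'rV[R]_(1 + 3).
Local Notation simplex := {fset 'rV[R]_3}.
Local Notation D := (deck M).
Local Notation orb := (simplex_orbit M).
Local Notation good := (good M).
Local Notation repl := (repl M).
Local Notation sat := (sat M).
Implicit Types (F G V W P : simplex) (x y z b : vec) (u v a : point).
Implicit Types (g h : 'M[R]_(1 + 3)) (L : set simplex) (l w : point -> R).
Local Notation nl l := (fun v => - l v).

(* Moves have this property, which propagates the finiteness of overlaps along a sequence of moves. *)
Definition cov L L' : Prop := forall V', L' V' -> exists B : {fset simplex},
  (forall V, V \in B -> L V) /\ forall y, cc V' y -> exists2 V, V \in B & cc V y.

Definition step L L' : Prop :=
  [/\ good L, good L', pachner_move M (orb @` L)%classic (orb @` L')%classic & cov L L'].

Definition flippable L W l : Prop :=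
  [/\ good L, circuit W l, balls W, forall V, V \in side W l -> L V
    & forall g V, D g -> V \in side W l -> mv g V \in side W l -> g = 1%:M].

Definition flip L W l : set simplex := repl L [set` side W l]%classic [set` side W (nl l)]%classic.

Section OneFlip.
Variables (L : set simplex) (W : simplex) (l : point -> R).
Hypothesis fl : flippable L W l.
Local Notation B := (side W l).
Local Notation B' := (side W (nl l)).

Let gL : good L. Proof. by case: fl. Qed.
Let cW : circuit W l. Proof. by case: fl. Qed.
Let cN : circuit W (nl l). Proof. exact: circuitN. Qed.
Let bW : balls W. Proof. by case: fl. Qed.
Let BL V : V \in B -> L V. Proof. by case: fl => _ _ _ H _; exact: H. Qed.
Let inj g V : D g -> V \in B -> mv g V \in B -> g = 1%:M.
Proof. by case: fl => _ _ _ _ H; exact: H. Qed.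

Let side_balls l' V : V \in side W l' -> balls V.
Proof. by move=> /sideP[a [_ _ ->]]; apply: balls_sub bW; exact: fsubD1set. Qed.
Let BtT V : V \in B' -> tetra V.
Proof. by move=> h; split; [exact: side_frame h|exact: side_balls h]. Qed.

(** The two carriers give nonnegative representations of y that differ by c times l. If c = 0, they
    agree. Otherwise their midpoint is positive at all five vertices, so a neighbourhood of y lies
    in the region and every tetrahedron of L around y belongs to the side [B]. *)
Lemma flip_star F F' y : tl y -> face [set` B] F -> face [set` B'] F' ->
  co F y -> co F' y -> F = F' \/ forall V, L V -> F `<=` V -> V \in B.
Proof.
move=> ty fF fF' cF cF'.
have [w [e w0 wF [a aP a0]]] := side_face_ext fF cF.
have [w' [e' w0' wF' _]] := side_face_ext fF' cF'.
have sub l' H : face [set` side W l'] H -> H `<=` W.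
  by move=> [_ [U /= /imfsetP[c /= _ ->] HU]]; apply: (fsubset_trans HU); exact: fsubD1set.
have : comb W (fun v => w v - w' v) = 0.
  by rewrite (combD W w (fun v => - w' v)) combN -e -e' subrr.
move=> /(circuit_ker cW)[c wc].
have [c0|c0] := eqVneq c 0; [left|right].
  apply/fsetP => v; case: (boolP (v \in W)) => vW.
    by rewrite wF // wF' //; have := wc v vW; rewrite c0 mul0r => /eqP; rewrite subr_eq0 => /eqP ->.
  have nF l' H : face [set` side W l'] H -> v \notin H.
    by move=> /sub/fsubsetP s; apply: contra vW => /s.
  by rewrite (negbTE (nF _ _ fF)) (negbTE (nF _ _ fF')).
move=> V LV FV; have [z cz] := co_ex V; have tz := tetra_tl (good_tetra gL LV) cz.
have [ze ez] := circuit_span cW z.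
case: (cW) => _ _ c2 _.
have mid v : v \in W -> 0 < w v / 2 + w' v / 2.
  move=> vW; have p := w0 v vW; have p' := w0' v vW.
  rewrite -mulrDl divr_gt0 // lt_neqAle addr_ge0 // andbT eq_sym paddr_eq0 //.
  apply/negP => /andP[/eqP q /eqP q']; have := wc v vW.
  by rewrite q q' subrr => /esym/eqP; rewrite mulf_eq0 (negbTE c0) (negbTE (c2 v vW)).
have E : evt (fun e => forall v, v \in W -> 0 < w v / 2 + w' v / 2 + e * ze v).
  by apply: evt_all => v vW; apply: evt_lin; exact: mid.
have [ep ep0 [H te]] := evt_ex (evtI E (evt_tl z ty)).
have ey : y + ep *: z = comb W (fun v => (w v / 2 + w' v / 2) + ep * ze v).
  rewrite (combD W (fun v => w v / 2 + w' v / 2) (fun v => ep * ze v)) combZ -ez.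
  congr (_ + _); rewrite (@eq_comb _ _ _ (fun v => 2^-1 * w v + 2^-1 * w' v)); last first.
    by move=> v _; rewrite !(mulrC 2^-1).
  rewrite (combD W (fun v => 2^-1 * w v) (fun v => 2^-1 * w' v)) !combZ -e -e' -scalerDl.
  by rewrite (_ : 2^-1 + 2^-1 = 1) ?scale1r //; lra.
have [F1 fF1 cF1] := side_carrier cW te.1 (fun v vW => ltW (H v vW)) ey.
have fF1L : face L F1 by have [? [U /= /BL LU FU]] := fF1; split=> //; exists U.
have eF1 : F1 = V.
  by apply: (face_uniq gL te) => //; [exact: (face_self gL)|exact: co_sub_pert FV ep0 cF cz].
have [_ [U /= BU FU]] := fF1; suff -> : V = U by [].
apply/eqP; rewrite eqEfcard -{1}eF1 FU /=.
by rewrite (good_frame gL LV).2 (side_frame cW BU).2.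
Qed.

Lemma flip_good : good (flip L W l).
Proof.
apply: repl_good => //.
- move=> F y ty fF cF; have [w e w0] := side_face fF cF.
  by have [F' fF' cF'] := side_carrier cN ty.1 w0 e; exists F'.
- move=> F y ty fF cF; have [w e w0] := side_face fF cF.
  by have [F' fF' cF'] := side_carrier cW ty.1 w0 e; exists F'.
- by move=> F G y ty; exact: side_uniq.
- exact: flip_star.
Qed.

Lemma opp_side V : V \in B' -> exists a, [/\ a \in W, l a < 0 & V = W `\ a].
Proof. by move=> /sideP[a [aW la ->]]; exists a; split=> //; rewrite -oppr_gt0. Qed.

Lemma opp_not_face V : V \in B' -> ~ face [set` B] V.
Proof.
move=> /opp_side[a [aW la ->]] [_ [U /= /sideP[c [cW' lc ->]]]] /fsubsetP/(_ c).
rewrite !inE eqxx cW' andbT /=; case: eqP => [eca|_ /(_ isT)//].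
by move: lc; rewrite eca ltNge (ltW la).
Qed.

Lemma flip_interior V y : V \in B' -> co V y -> tl y -> exists F,
  [/\ face [set` B] F, face L F, co F y & forall U, L U -> F `<=` U -> U \in B].
Proof.
move=> VB cV ty; have fV : face [set` B'] V.
  by split; [rewrite -cardfs_gt0 (side_frame cN VB).2|exists V].
have [w e w0] := side_face fV cV.
have [F fF cF] := side_carrier cW ty.1 w0 e; exists F; split=> //.
  by have [? [U /= /BL LU FU]] := fF; split=> //; exists U.
have [eF|//] := flip_star ty fF fV cF cV.
by case: (opp_not_face VB); rewrite -eF.
Qed.

(** An interior point of a new tetrahedron has its carrier in L inside the region, with the whole
    star in [B]. So an element carrying one new tetrahedron to another also carries some tetrahedron
    of [B] into [B]. *)
Lemma opp_inj g V : D g -> V \in B' -> mv g V \in B' -> g = 1%:M.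
Proof.
move=> Dg VB gVB; have [y cy] := co_ex V; have ty := tetra_tl (BtT VB) cy.
have tyg : tl (y *m g) by apply: iso_tl ty; exact: deck_iso Dg.
have [F [fF fFL cF sF]] := flip_interior VB cy ty.
have cyg : co (mv g V) (y *m g) by apply/(co_mv _ Dg (side_balls VB)).
have [G [fG fGL cG sG]] := flip_interior gVB cyg tyg.
have e : mv g F = G.
  apply: (face_uniq gL tyg) => //; first exact: (face_mv gL Dg).
  by apply/(co_mv _ Dg (face_balls gL fFL)).
have [_ [U /= BU FU]] := fF.
apply: (inj Dg BU); apply: sG; first exact: (good_mv gL Dg (BL BU)).
by rewrite -e; exact: mv_sub.
Qed.

Lemma opp_notin V : V \in B' -> ~ L V.
Proof.
move=> VB LV; have [y cy] := co_ex V; have ty := tetra_tl (BtT VB) cy.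
have [F [fF fFL cF sF]] := flip_interior VB cy ty.
have e : F = V by apply: (face_uniq gL ty) => //; exact: (face_self gL).
by apply: (opp_not_face VB); rewrite -e.
Qed.

Lemma flip_repl : repl (flip L W l) [set` B']%classic [set` B]%classic = L.
Proof.
have bB U : [set` B]%classic U -> balls U by move=> /side_balls.
apply/seteqP; split=> V.
  case=> [[[[LV _]|//]]//|[g [U [Dg /= BU ->]]]].
  exact: (good_mv gL Dg (BL BU)).
move=> LV; case: (pselect (sat [set` B]%classic V)) => s; first by right.
left; split; first by left.
move=> [g [U [Dg /= BU e]]]; apply: (opp_notin BU).
have -> : U = mv (invmx g) V by rewrite e (mvK Dg (side_balls BU)).
by apply: (good_mv gL) LV; exact: deckV.
Qed.

Lemma facetsE l' : facets W (pos W l') = [set` side W l']%classic.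
Proof.
apply/seteqP; split=> V; first by move=> [a aP <-]; apply/imfsetP; exists a.
by move=> /imfsetP[a /= aP ->]; exists a.
Qed.

Lemma orb_repl (T T' : {fset simplex}) : (forall V, V \in T -> L V) -> (forall V, V \in T' -> balls V) ->
  (orb @` (repl L [set` T] [set` T']) = (orb @` L `\` orb @` [set` T]) `|` orb @` [set` T'])%classic.
Proof.
move=> TL bT'; apply/seteqP; split=> s.
  move=> [V [[LV nV]|[g [U [Dg /= TU ->]]]] <-].
    left; split; first by exists V.
    move=> [U /= TU]; move=> /esym/(orb_eq _ _ (good_balls gL (TL _ TU)))[g Dg e].
    by apply: nV; exists g, U.
  by right; exists U => //; rewrite (orb_mv Dg (bT' _ TU)).
case=> [[[V LV <-] nV]|[V /= TV <-]]; last by exists V => //; right; exact: sat_self.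
exists V => //; left; split=> // -[g [U [Dg /= TU e]]]; apply: nV; exists U => //.
by rewrite e (orb_mv Dg (good_balls gL (TL _ TU))).
Qed.

Lemma side_region : region [set` B]%classic = region [set` B']%classic.
Proof.
have half l1 l2 : circuit W l2 -> (region [set` side W l1] `<=` region [set` side W l2])%classic.
  move=> c2 p [V /= VB /hullE cV].
  have [a [aW la eV]] := sideP VB.
  have : exists2 w, (forall v, v \in W -> 0 <= w v) & homog p = comb W w.
    rewrite eV in cV; case: cV => w w0 ->.
    exists (fun v => if v \in W `\ a then w v else 0); first by move=> v _; case: ifP => // /w0.
    by apply: comb_ext; exact: fsubD1set.
  by move=> [w w0 e]; have [F FB cF] := side_cc c2 w0 e; exists F => //; apply/hullE.
by apply/seteqP; split; apply: half.
Qed.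

Lemma flip_cov : cov L (flip L W l).
Proof.
move=> V [[LV _]|[g [U [Dg /= BU ->]]]].
  exists [fset V]; split; first by move=> U; rewrite inE => /eqP ->.
  by move=> y; exists V; rewrite ?inE.
exists [fset mv g V | V in B]; split.
  by move=> _ /imfsetP[U' /= BU' ->]; exact: (good_mv gL Dg (BL BU')).
move=> y cy.
have cy' : cc U (y *m invmx g).
  by apply/(cc_mv _ Dg (side_balls BU)); rewrite (mulmxKV (deck_unit Dg)).
have [a [aW la eU]] := sideP BU.
have [w w0 e] : exists2 w, (forall v, v \in W -> 0 <= w v) & y *m invmx g = comb W w.
  rewrite eU in cy'; case: cy' => w w0 ->.
  exists (fun v => if v \in W `\ a then w v else 0); first by move=> v _; case: ifP => // /w0.
  by apply: comb_ext; exact: fsubD1set.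
have [F FB cF] := side_cc cW w0 e; exists (mv g F); first by apply/imfsetP; exists F.
by move: cF; rewrite -(cc_mv _ Dg (side_balls FB)) (mulmxKV (deck_unit Dg)).
Qed.

Lemma flip_pachner : pachner_move M (orb @` L)%classic (orb @` flip L W l)%classic.
Proof.
exists W, (pos W l); split.
  case: (cW) => c5 _ _ _; split=> //; first exact: pos_neq0.
  rewrite fproperEneq pos_sub andbT; apply/eqP => e.
  by have := pos_neq0 cN; rewrite pos_compl // e fsetDv eqxx.
rewrite /= -pos_compl // !facetsE; split.
- move=> U V; rewrite !inE => BU BV /(orb_eq _ _ (side_balls BV))[g Dg e].
  by move: BU; rewrite e => /(inj Dg BV) ->; rewrite mv1.
- by move=> _ [V /= BV <-]; exists V => //; exact: BL.
- by rewrite orb_repl // => V /side_balls.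
exact: side_region.
Qed.

Lemma flip_step : step L (flip L W l).
Proof. by split; [|exact: flip_good|exact: flip_pachner|exact: flip_cov]. Qed.

End OneFlip.

Lemma flip_back L W l : flippable L W l -> step (flip L W l) L.
Proof.
move=> fl; have [gL cW bW BL inj] := fl.
have fl' : flippable (flip L W l) W (nl l).
  split=> //; [exact: flip_good|exact: circuitN| |].
    by move=> V VB; right; exact: sat_self.
  by move=> g V Dg h1 h2; exact: (opp_inj fl Dg h1 h2).
have := flip_step fl'.
suff -> : flip (flip L W l) W (nl l) = L by [].
rewrite -[RHS](flip_repl fl) /flip.
suff -> : side W (nl (nl l)) = side W l by [].
by rewrite (_ : (fun v => - - l v) = l) //; apply/funext => v; rewrite opprK.
Qed.

(** Each move is recorded with its inverse: this makes the relation symmetric and provides [cov] in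
    both directions. *)
Inductive conn L : set simplex -> Prop :=
| conn_refl : conn L L
| conn_step L' L'' : conn L L' -> step L' L'' -> step L'' L' -> conn L L''.

Lemma conn_trans L L' L'' : conn L L' -> conn L' L'' -> conn L L''.
Proof. by move=> c; elim=> // K K' _ c' s s'; exact: conn_step s s'. Qed.

Lemma conn_sym L L' : conn L L' -> conn L' L.
Proof.
elim=> [|K K' _ c s s']; first exact: conn_refl.
by apply: conn_trans c; apply: conn_step s' s; exact: conn_refl.
Qed.

Lemma conn_flip L W l : flippable L W l -> conn L (flip L W l).
Proof. by move=> fl; apply: conn_step (flip_step fl) (flip_back fl); exact: conn_refl. Qed.

Lemma conn_good L L' : good L -> conn L L' -> good L'.
Proof. by move=> gL; elim=> // K K' _ _ [_ gK _ _]. Qed.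

End Flip.

(** * Starring a region from a generic point *)

Section Starring.
Variables (R : realType) (M : hyperbolic_manifold R).
Local Notation point := 'rV[R]_3.
Local Notation vec := 'rV[R]_(1 + 3).
Local Notation simplex := {fset 'rV[R]_3}.
Local Notation D := (deck M).
Local Notation good := (good M).
Local Notation repl := (repl M).
Local Notation sat := (sat M).
Local Notation conn := (conn M).
Implicit Types (F G V W U P w : simplex) (x y z b : vec) (u v a q : point).
Implicit Types (g h : 'M[R]_(1 + 3)) (L : set simplex) (T E : {fset simplex}).

(* For [b = homog q]: some segment from a point of [V'] to [q] runs through [V]. *)
Definition behind b V V' : Prop := exists2 y, co V y & co V' (y - b).

(** Absence of cycles in the visibility relation, stated as it is used: in every finite nonempty
    subset some tetrahedron is hidden by no other one. *)
Definition acyc b (T : set simplex) : Prop := forall T0 : {fset simplex},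
  T0 != fset0 -> (forall V, V \in T0 -> T V) ->
  exists2 V, V \in T0 & forall V', V' \in T0 -> V' <> V -> ~ behind b V' V.

Lemma acyc_sub b (T T' : set simplex) : (T `<=` T')%classic -> acyc b T' -> acyc b T.
Proof. by move=> TT H T0 n0 sT; apply: H => // V /sT/TT. Qed.

Lemma wall_card V a : frame V -> a \in V -> #|` V `\ a| = 3%N.
Proof. by move=> [_ cV] aV; move: cV; rewrite (cardfsD1 a) aV add1n => -[]. Qed.

Lemma wall_other V V' a : frame V -> frame V' -> a \in V -> V `\ a `<=` V' -> V <> V' ->
  exists a', [/\ a' \in V', V' `\ a' = V `\ a & a' \notin V].
Proof.
move=> fV fV' aV wV' nVV.
have c1 : #|` V' `\` (V `\ a)| = 1%N.
  by rewrite cardfsD (fsetIidPr _) // fV'.2 wall_card.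
have /eqP/cardfs1P[a' ea'] := c1.
have : a' \in V' `\` (V `\ a) by rewrite ea' inE.
rewrite !inE negb_and negbK => /andP[naa a'V'].
have eW : V' `\ a' = V `\ a.
  apply/esym/eqP; rewrite eqEfcard (wall_card fV' a'V') (wall_card fV aV) leqnn andbT.
  apply/fsubsetP => v vw; rewrite !inE (fsubsetP wV' _ vw) andbT.
  apply: contraTneq vw => ->; rewrite !inE negb_and negbK; exact: naa.
exists a'; split=> //; case/orP: naa => // /eqP e.
by case: nVV; rewrite -(fsetD1K aV) -eW e fsetD1K // -e.
Qed.

Lemma crd_wall V V' a a' x : frame V -> frame V' -> a \in V -> a' \in V' ->
  V' `\ a' = V `\ a -> crd V x a = crd V' x a' * crd V (homog a') a.
Proof.
move=> fV fV' aV a'V' e.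
rewrite -[in LHS](crdK x fV') crd_sum // (big_fsetD1 a') //= big_seq big1 ?addr0 //.
by move=> u; rewrite e !inE => /andP[ua uV]; rewrite crd_homog // eq_sym (negbTE ua) mulr0.
Qed.

Section Walls.
Variables (L : set simplex) (gL : good L).

Lemma wall_tl V a y : L V -> a \in V -> co (V `\ a) y -> tl y.
Proof.
move=> LV aV; apply: co_tl.
- by apply: balls_sub (good_balls gL LV); exact: fsubD1set.
- by apply: indep_sub (good_frame gL LV).1; exact: fsubD1set.
- by rewrite (wall_card (good_frame gL LV) aV).
Qed.

(** Otherwise a point of the wall pushed towards [a'] would enter both tetrahedra. *)
Lemma wall_opp V V' a a' : L V -> L V' -> V <> V' -> a \in V -> a' \in V' ->
  V' `\ a' = V `\ a -> crd V (homog a') a < 0.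
Proof.
move=> LV LV' nVV aV a'V' e; rewrite ltNge; apply/negP => c0; apply: nVV.
have fV := good_frame gL LV; have fV' := good_frame gL LV'.
have cn0 : crd V (homog a') a != 0.
  apply/eqP => c00; have := crd_wall (homog a) fV fV' aV a'V' e.
  by rewrite c00 mulr0 crd_homog // eqxx => /eqP; rewrite oner_eq0.
have [y cy] := co_ex (V `\ a); have ty := wall_tl LV aV cy.
apply: (fan_eq gL (F := V `\ a) (y := y) (z := homog a')) => //.
- exact: fsubD1set.
- by rewrite -e; exact: fsubD1set.
- move=> v vV; rewrite !inE vV andbT negbK => /eqP ->.
  by rewrite lt_neqAle eq_sym cn0.
- by move=> v vV' _; rewrite crd_homog // ler0n.
Qed.

(** Three tetrahedra at a wall would be pairwise on opposite sides of it, but by [crd_wall] the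
    signs multiply. *)
Lemma wall_two V V' U a : L V -> L V' -> L U -> a \in V -> V `\ a `<=` V' -> V `\ a `<=` U ->
  V' <> V -> U <> V -> U = V'.
Proof.
move=> LV LV' LU aV wV' wU nV' nU; apply: contrapT => nUV.
have fV := good_frame gL LV; have fV' := good_frame gL LV'; have fU := good_frame gL LU.
have [a' [a'V' e' _]] := wall_other fV fV' aV wV' (fun e => nV' (esym e)).
have [u [uU eu _]] := wall_other fV fU aV wU (fun e => nU (esym e)).
have h1 := wall_opp LV LV' (fun e => nV' (esym e)) aV a'V' e'.
have h2 := wall_opp LV LU (fun e => nU (esym e)) aV uU eu.
have h3 : crd V' (homog u) a' < 0.
  by apply: (wall_opp LV' LU (fun e => nUV (esym e)) a'V' uU); rewrite e'.
have := crd_wall (homog u) fV fV' aV a'V' e'.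
by move=> e; move: h2; rewrite e ltNge mulr_le0 // ltW.
Qed.

Lemma behind_wall V V' a x : L V -> L V' -> V <> V' -> a \in V -> V `\ a `<=` V' ->
  (crd V x a < 0 -> behind x V' V) /\ (0 < crd V x a -> behind x V V').
Proof.
move=> LV LV' nVV aV wV'.
have fV := good_frame gL LV; have fV' := good_frame gL LV'.
have [a' [a'V' e' _]] := wall_other fV fV' aV wV' nVV.
have h1 := wall_opp LV LV' nVV aV a'V' e'.
have [y cy] := co_ex (V `\ a).
have e := crd_wall x fV fV' aV a'V' e'.
have toV s W c : frame W -> c \in W -> co (W `\ c) y -> 0 < crd W (s *: x) c ->
    evt (fun ep => co W (y + ep *: (s *: x))).
  move=> fW cW cyW h; have sW := fsubD1set W c.
  have [y1 y2] := (frame_cosub y fW sW).1 cyW.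
  have := cc_pert (z := s *: x) fW (cc_sub sW (co_cc cyW)).
  have -> : [fset v in W | (0 < crd W y v) || (0 < crd W (s *: x) v)] = W.
    apply/fsetP => v; rewrite !inE; case: (boolP (v \in W)) => //= vW.
    case: (eqVneq v c) => [->|vc]; first by rewrite h orbT.
    by rewrite y1 // !inE vc.
  apply=> v vW yv; case: (eqVneq v c) => [->|vc]; first exact: ltW.
  by have := y1 v; rewrite !inE vc vW yv ltxx => /(_ isT).
have cy' : co (V' `\ a') y by rewrite e'.
have fin W W' : evt (fun ep => co W (y + ep *: (1 *: x))) -> evt (fun ep => co W' (y + ep *: (- 1 *: x))) ->
   behind x W W'.
  move=> E E'; have [ep ep0 [H H']] := evt_ex (evtI E E').
  (* The points [y + ep *: x] and [y - ep *: x] lie on the two sides of the wall; dividing by twice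
     ep makes their difference exactly x. *)
  exists ((ep *+ 2)^-1 *: (y + ep *: (1 *: x))); first by apply: coZ => //; rewrite invr_gt0 pmulrn_lgt0.
  have -> : (ep *+ 2)^-1 *: (y + ep *: (1 *: x)) - x = (ep *+ 2)^-1 *: (y + ep *: (- 1 *: x)).
    have n0 : ep *+ 2 != 0 by rewrite gt_eqF // pmulrn_lgt0.
    apply: (scalerI n0); rewrite scalerBr !scalerA mulfV // !scale1r -addrA; congr (_ + _).
    by rewrite -scalerBl; congr (_ *: _); rewrite mulr2n mulrN1; ring.
  by apply: coZ => //; rewrite invr_gt0 pmulrn_lgt0.
split=> xa; apply: fin.
- by apply: (toV 1 V' a') => //; rewrite crdZ // mul1r; move: xa; rewrite e (nmulr_llt0 _ h1).
- by apply: (toV (- 1) V a) => //; rewrite crdZ // mulN1r oppr_gt0.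
- by apply: (toV 1 V a) => //; rewrite crdZ // mul1r.
- by apply: (toV (- 1) V' a') => //; rewrite crdZ // mulN1r oppr_gt0; move: xa; rewrite e (nmulr_lgt0 _ h1).
Qed.

End Walls.

(* The cone from [q] over the walls of the region [E] that belong to only one of its tetrahedra. *)
Definition cone q E : set simplex := [set U : simplex | exists V a, [/\ V \in E, a \in V,
  forall V', V' \in E -> V `\ a `<=` V' -> V' = V & U = q |` (V `\ a)]].

(** The point q lies on no plane of a wall, and the last clause makes the region star-shaped: a wall
    with q on its far side is not on the boundary. *)
Definition starable L T q : Prop :=
  [/\ good L, H3 q, forall V, V \in T -> L V, T != fset0 &
  [/\ forall g V, D g -> V \in T -> mv g V \in T -> g = 1%:M,
      forall V a, V \in T -> a \in V -> crd V (homog q) a != 0,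
      acyc (homog q) [set` T]%classic &
      forall V a, V \in T -> a \in V -> crd V (homog q) a < 0 ->
        exists V', [/\ V' \in T, V' <> V & V `\ a `<=` V']]].

Definition not_vertex L q := forall V, L V -> q \notin V.

Lemma interior_not_vertex L V q : good L -> L V -> co V (homog q) -> not_vertex L q.
Proof.
move=> gL LV cq U LU; apply/negP => qU.
have tq := tetra_tl (good_tetra gL LV) cq.
have e : V = [fset q].
  apply: (face_uniq gL tq) => //; first exact: (face_self gL).
    split; first by apply/fset0Pn; exists q; rewrite inE.
    by exists U => //; rewrite fsub1set.
  by exists (fun=> 1) => //; rewrite comb_set1 scale1r.
by have := (good_frame gL LV).2; rewrite e cardfs1.
Qed.

(** Vertices of L are carried to vertices of L, so q can only go to q, and deck transformations act
    freely. *)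
Lemma cone_stab L q g w w' : good L -> H3 q -> not_vertex L q -> D g ->
  (forall v, v \in w' -> exists2 V, L V & v \in V) ->
  mv g (q |` w) = q |` w' -> g = 1%:M.
Proof.
move=> gL Hq nq Dg Hw' e.
have : act g q \in q |` w' by rewrite -e; apply/imfsetP; exists q; rewrite ?inE ?eqxx.
rewrite !inE => /orP[/eqP|/Hw'[V LV aV]]; first by move=> eq; exact: (deck_free Dg Hq eq).
have := nq _ (good_mv gL (deckV Dg) LV).
rewrite -{1}(actK Dg (or_introl Hq)) (mem_mv (deckV Dg) (good_balls gL LV)) ?aV //.
by apply: act_ball; [exact: deck_iso Dg|left].
Qed.

(** * Adding one tetrahedron to the starred region is one Pachner move *)

Section Step.
Variables (L : set simplex) (T : {fset simplex}) (q : point).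
Hypothesis st : starable L T q.

Let gL : good L. Proof. by case: st. Qed.
Let Hq : H3 q. Proof. by case: st. Qed.
Let TL V : V \in T -> L V. Proof. by case: st => _ _ H _ _; exact: H. Qed.
Let inj g V : D g -> V \in T -> mv g V \in T -> g = 1%:M.
Proof. by case: st => _ _ _ _ [H _ _ _]; exact: H. Qed.
Let gen V a : V \in T -> a \in V -> crd V (homog q) a != 0.
Proof. by case: st => _ _ _ _ [_ H _ _]; exact: H. Qed.
Let front V a : V \in T -> a \in V -> crd V (homog q) a < 0 ->
        exists V', [/\ V' \in T, V' <> V & V `\ a `<=` V'].
Proof. by case: st => _ _ _ _ [_ _ _ H]; exact: H. Qed.

(** A tetrahedron hidden by no other one cannot have a wall with q on the far side, since the
    neighbour across it is in [T] and would hide it. *)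
Lemma starable_interior : exists2 V, V \in T & co V (homog q).
Proof.
case: st => _ _ _ T0 [_ _ ac _].
have [V VT HV] := ac T T0 (fun _ k => k); exists V => //.
have fV := good_frame gL (TL VT); rewrite frame_co // => a aV.
rewrite lt_neqAle eq_sym gen //= leNgt; apply/negP => h.
have [V' [V'T nV wV']] := front VT aV h.
apply: (HV V' V'T nV); exact: (behind_wall gL (homog q) (TL VT) (TL V'T) (fun e => nV (esym e)) aV wV').1.
Qed.

Lemma starable_nv : not_vertex L q.
Proof. by have [V VT cV] := starable_interior; exact: interior_not_vertex (TL VT) cV. Qed.

Section One.
Variables (E : {fset simplex}) (V : simplex).
Hypotheses (ET : E `<=` T) (VT : V \in T) (VE : V \notin E).
Hypothesis dc : forall U U', U \in T -> U' \in E -> U <> U' -> behind (homog q) U U' -> U \in E.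
Hypothesis mn : forall U, U \in T -> U \notin E -> U <> V -> ~ behind (homog q) U V.
Hypothesis gE : good (repl L [set` E] (cone q E)).

Local Notation LE := (repl L [set` E] (cone q E)).
Local Notation W := (q |` V).
Local Notation bt := (crd V (homog q)).

(** The expansion of [homog q] in V, read as a dependence. The positive side consists of V and the
    cones from q over the walls of V with q on the far side, the negative side of the cones over the
    other walls. *)
Let l : point -> R := fun v => if v == q then 1 else - bt v.
Let LV : L V := TL VT.
Let fV : frame V := good_frame gL LV.
Let bV : balls V := good_balls gL LV.
Let nv := starable_nv.
Let qV : q \notin V := nv LV.
Let EL U : U \in E -> L U. Proof. by move=> /(fsubsetP ET)/TL. Qed.

Let lq : l q = 1. Proof. by rewrite /l eqxx. Qed.
Let lv v : v \in V -> l v = - bt v.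
Proof. by move=> vV; rewrite /l; case: eqP => // e; move: vV; rewrite e (negbTE qV). Qed.
Let Wq : W `\ q = V. Proof. by rewrite fsetU1K. Qed.
Let Wa a : a \in V -> W `\ a = q |` (V `\ a).
Proof.
move=> aV; apply/fsetP => v; rewrite !inE; case: (eqVneq v q) => [->|]; last by rewrite orFb.
by rewrite orTb andbT; apply: contraNneq qV => ->.
Qed.

Let cW : circuit W l.
Proof.
split.
- by rewrite cardfsU1 qV fV.2.
- rewrite (combD1 _ (fset1U1 _ _)) Wq lq scale1r.
  rewrite (@eq_comb _ V _ (fun v => - bt v)); last exact: lv.
  by rewrite combN crdK // subrr.
- move=> v; rewrite !inE => /orP[/eqP ->|vV]; first by rewrite lq oner_eq0.
  by rewrite lv // oppr_eq0; exact: gen.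
by exists q; [exact: fset1U1|rewrite Wq].
Qed.

Let sideB U : U \in side W l <-> U = V \/ exists a, [/\ a \in V, bt a < 0 & U = q |` (V `\ a)].
Proof.
split.
  move=> /sideP[a [aW la ->]]; move: aW la; rewrite !inE => /orP[/eqP -> _|aV].
    by left.
  by rewrite lv // oppr_gt0 => h; right; exists a; rewrite Wa.
move=> H; apply/imfsetP => /=; case: H => [->|[a [aV h ->]]].
  by exists q; rewrite ?Wq // !inE eqxx lq ltr01.
by exists a; rewrite ?Wa // !inE aV orbT lv // oppr_gt0.
Qed.

Let sideB' U : U \in side W (fun v => - l v) <-> exists a, [/\ a \in V, 0 < bt a & U = q |` (V `\ a)].
Proof.
split.
  move=> /sideP[a [aW la ->]]; move: aW la; rewrite !inE => /orP[/eqP ->|aV].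
    by rewrite lq oppr_gt0 ltr10.
  by rewrite lv // opprK => h; exists a; rewrite Wa.
move=> [a [aV h ->]]; apply/imfsetP => /=.
by exists a; rewrite ?Wa // !inE aV orbT lv // opprK.
Qed.

Lemma front_E a : a \in V -> bt a < 0 -> exists V', [/\ V' \in E, V' <> V & V `\ a `<=` V'].
Proof.
move=> aV h; have [V' [V'T nV wV']] := front VT aV h; exists V'; split=> //.
apply: contraT => nE; exfalso; apply: (mn V'T nE nV).
exact: (behind_wall gL (homog q) LV (TL V'T) (fun e => nV (esym e)) aV wV').1.
Qed.

Lemma back_E a U : a \in V -> 0 < bt a -> U \in E -> V `\ a `<=` U -> False.
Proof.
move=> aV h UE wU.
have nVU : V <> U by move=> e; move: VE; rewrite e UE.
have := (behind_wall gL (homog q) LV (EL UE) nVU aV wU).2 h.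
by move=> /(dc VT UE nVU); rewrite (negbTE VE).
Qed.

Lemma front_cone a : a \in V -> bt a < 0 -> cone q E (q |` (V `\ a)).
Proof.
move=> aV h; have [V' [V'E nV wV']] := front_E aV h.
have fV' := good_frame gL (EL V'E).
have [a' [a'V' e _]] := wall_other fV fV' aV wV' (fun e => nV (esym e)).
exists V', a'; split; [exact: V'E|exact: a'V'| |by rewrite e].
rewrite e => U UE wU; apply: (wall_two gL LV (EL V'E) (EL UE) aV wV' wU nV).
by move=> eU; move: VE; rewrite -eU UE.
Qed.

Let vert w U : L U -> w `<=` U -> forall v, v \in w -> exists2 V0, L V0 & v \in V0.
Proof. by move=> LU wU v /(fsubsetP wU) vU; exists U. Qed.

Let nL_cone g w : D g -> ~ L (mv g (q |` w)).
Proof.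
move=> Dg LU; have Dg' := deckV Dg.
have := nv (good_mv gL Dg' LU).
have bU := good_balls gL LU; set U := mv g _ in LU bU *.
have : act g q \in U by apply/imfsetP; exists q; rewrite ?inE ?eqxx.
rewrite -{2}(actK Dg (or_introl Hq)) (mem_mv Dg' bU); first by move=> k1; rewrite k1.
by apply: act_ball; [exact: deck_iso Dg|left].
Qed.

Lemma V_notin : ~ sat [set` E]%classic V.
Proof.
move=> [g [U [Dg /= UE e]]].
have UT := fsubsetP ET _ UE.
have g1 : g = 1%:M by apply: (inj Dg UT); rewrite -e.
by move: VE; rewrite e g1 mv1 UE.
Qed.

Lemma star_flippable : flippable M LE W l.
Proof.
split=> //.
- by move=> v; rewrite !inE => /orP[/eqP ->|/bV//]; left.
- move=> U /sideB[->|[a [aV h ->]]]; first by left; split=> //; exact: V_notin.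
  by right; apply: sat_self; exact: front_cone.
move=> g U Dg UB gUB.
have vw a : forall v, v \in V `\ a -> exists2 V0, L V0 & v \in V0 by exact: vert LV (fsubD1set _ _).
case/sideB: UB => [eU|[a [aV h eU]]]; case/sideB: gUB => [egU|[a' [aV' h' egU]]].
- by apply: (tetra_stab Dg (good_tetra gL LV)); rewrite -{1}eU.
- exfalso; apply: (@nL_cone 1%:M (V `\ a') (deck1 M)); rewrite mv1 -egU eU; exact: (good_mv gL).
- by exfalso; apply: (@nL_cone g (V `\ a) Dg); rewrite -eU egU.
have e3 : mv g (q |` (V `\ a)) = q |` (V `\ a') by rewrite -eU egU.
exact: (cone_stab gL Hq nv Dg (vw a') e3).
Qed.

Let sat_cone_eq g h w w' : D g -> D h -> balls w -> 
  (forall v, v \in w' -> exists2 V0, L V0 & v \in V0) -> 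
  (forall v, v \in w -> exists2 V0, L V0 & v \in V0) -> 
  mv g (q |` w) = mv h (q |` w') -> g = h /\ w = w'.
Proof.
move=> Dg Dh bw Hw' Hw e.
have bqw : balls (q |` w) by move=> v; rewrite !inE => /orP[/eqP ->|/bw//]; left.
have bw' : balls w' by move=> v /Hw'[V0 /(good_balls gL)]; exact.
have bqw' : balls (q |` w') by move=> v; rewrite !inE => /orP[/eqP ->|/bw'//]; left.
have Dh' := deckV Dh.
have gh : g = h.
  apply: (deck_eq Dh Dg); apply: (cone_stab gL Hq nv (deckM Dg Dh') Hw' (w := w)).
  by rewrite (mvM _ Dg bqw) e (mvK Dh bqw').
split=> //; rewrite gh in e; have e' := mv_inj Dh bqw bqw' e.
have nw w0 : (forall v, v \in w0 -> exists2 V0, L V0 & v \in V0) -> q \notin w0.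
  by move=> H; apply/negP => /H[V0 /nv]; move=> /negbTE ->.
by rewrite -(fsetU1K (nw _ Hw)) -(fsetU1K (nw _ Hw')) e'.
Qed.

(** The cones that disappear stand on the walls of V shared with [E], by [front_E]. Those that
    appear stand on the other walls of V, which by [back_E] become free walls of the larger
    region. *)
Lemma star_flip_eq : flip M LE W l = repl L [set` V |` E] (cone q (V |` E)).
Proof.
have bwall V0 a : L V0 -> balls (V0 `\ a).
  by move=> L0; apply: balls_sub (good_balls gL L0); exact: fsubD1set.
have vwall V0 a : L V0 -> forall v, v \in V0 `\ a -> exists2 V1, L V1 & v \in V1.
  by move=> L0; exact: vert L0 (fsubD1set _ _).
have EV U : U \in E -> U \in V |` E by move=> UE; rewrite !inE UE orbT.
have VV : V \in V |` E by rewrite !inE eqxx.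
apply/seteqP; split=> U.
  case=> [[[[LU nU]|sU] nB]|[g [U0 [Dg /= /sideB'[a [aV h ->]] ->]]]].
  - left; split=> // -[g [V0 [Dg /= V0E e]]]; move: V0E; rewrite !inE => /orP[/eqP e0|V0E].
      by apply: nB; exists g, V; split=> //=; [apply/sideB; left|rewrite -e0].
    by apply: nU; exists g, V0.
  - move: sU => [g [U0 [Dg [V0 [a [V0E aV0 H e0]]] e]]].
    right; exists g, U0; split=> //; exists V0, a; split=> //; first exact: EV.
    move=> V'; rewrite !inE => /orP[/eqP ->|V'E]; last exact: H.
    move=> wV; exfalso; have L0 := EL V0E; have f0 := good_frame gL L0.
    have n0 : V0 <> V by move=> e1; move: VE; rewrite -e1 V0E.
    have [a' [a'V ea' _]] := wall_other f0 fV aV0 wV n0.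
    have wV0 : V `\ a' `<=` V0 by rewrite ea'; exact: fsubD1set.
    have := gen VT a'V; rewrite neq_lt => /orP[lt0|gt0]; last exact: (back_E a'V gt0 V0E wV0).
    apply: nB; exists g, U0; split=> //=; apply/sideB; right; exists a'; split=> //.
    by rewrite e0 ea'.
  right; exists g, (q |` (V `\ a)); split=> //; exists V, a; split=> // V'.
  rewrite !inE => /orP[/eqP ->//|V'E wV'].
  by case: (back_E aV h V'E wV').
case=> [[LU nU]|[g [U0 [Dg [V0 [a [V0E aV0 H e0]]] e]]]].
  left; split.
    left; split=> // -[g [V0 [Dg /= V0E e]]]; apply: nU; exists g, V0; split=> //=; exact: EV.
  move=> [g [U0 [Dg /= /sideB[e0|[a [aV h e0]]] e]]].
    by apply: nU; exists g, V; rewrite -e0; split=> //=; rewrite e0.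
  by apply: (@nL_cone g (V `\ a) Dg); rewrite -e0 -e.
move: V0E; rewrite !inE => /orP[/eqP eV0|V0E].
  rewrite eV0 in aV0 H e0; right; exists g, U0; split=> //=; apply/sideB'; exists a; split=> //.
  have := gen VT aV0; rewrite neq_lt => /orP[lt0|//].
  have [V' [V'E nV wV']] := front_E aV0 lt0.
  by case: nV; apply: H => //; exact: EV.
left; split.
  right; exists g, U0; split=> //; exists V0, a; split=> // V' V'E; apply: H; exact: EV.
move=> [h [U1 [Dh /= /sideB[e1|[a' [a'V h0 e1]]] e']]].
  have LU1 : L U by rewrite e' e1; exact: (good_mv gL).
  by apply: (@nL_cone g (V0 `\ a) Dg); rewrite -e0 -e.
have L0 := EL V0E.
have [_ ew] : g = h /\ V0 `\ a = V `\ a'.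
  apply: sat_cone_eq => //; [exact: bwall|exact: vwall|exact: vwall|].
  by rewrite -e0 -e1 -e -e'.
have : V = V0 by apply: H => //; rewrite ew; exact: fsubD1set.
by move=> eV; move: VE; rewrite eV V0E.
Qed.

End One.

Let state (E : {fset simplex}) := [/\ E `<=` T,
  forall U U', U \in T -> U' \in E -> U <> U' -> behind (homog q) U U' -> U \in E &
  conn L (repl L [set` E]%classic (cone q E))].

Lemma repl0 : repl L [set` (fset0 : {fset simplex})]%classic (cone q fset0) = L.
Proof.
apply/seteqP; split=> V.
  by case=> [[]//|[g [U [_ [V0 [a []]]]]]]; rewrite inE.
by move=> LV; left; split=> // -[g [U []]].
Qed.

Lemma star_conn : conn L (repl L [set` T]%classic (cone q T)).
Proof.
suff [E [[_ _ cE] ->]] : exists E, state E /\ T = E by [].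
have s0 : state fset0.
  by split; [exact: fsub0set| |rewrite repl0; exact: conn_refl].
have : exists E, state E /\ (#|` T| <= #|` E| + #|` T|)%N.
  by exists fset0; split=> //; rewrite leq_addl.
move: {2}(#|` T|) => n; elim: n => [|n IH] [E [[ET dc cE] cn]].
  exists E; split=> //; apply/eqP; rewrite eq_sym eqEfcard ET /=.
  by rewrite addn0 in cn.
case: (T `\` E =P fset0) => [e|/eqP TE].
  exists E; split=> //; apply/eqP; rewrite eqEfsubset ET andbT.
  by rewrite -fsetD_eq0 e.
have [V] : exists2 V, V \in T `\` E & forall V', V' \in T `\` E -> V' <> V -> ~ behind (homog q) V' V.
  case: st => _ _ _ _ [_ _ ac _]; apply: ac => // V; by rewrite inE => /andP[].
rewrite inE => /andP[VE VT] mV.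
apply: IH; exists (V |` E); split; last first.
  by rewrite cardfsU1 VE; rewrite addnS in cn; rewrite add1n addSn.
have mn U : U \in T -> U \notin E -> U <> V -> ~ behind (homog q) U V.
  by move=> UT UE nU; apply: mV => //; rewrite inE UE.
split.
- by rewrite fsubUset fsub1set VT.
- move=> U U' UT; rewrite !inE => /orP[/eqP ->|U'E] nU bU.
    case: (boolP (U \in E)) => UE; rewrite ?orbT //; case: (mn U UT UE nU bU).
  by rewrite (dc _ _ UT U'E nU bU) orbT.
have gE := conn_good gL cE.
apply: (conn_trans cE); rewrite -(star_flip_eq ET VT VE dc mn).
apply: conn_flip; exact: star_flippable.
Qed.

End Step.
End Starring.

Lemma card_le2 (T : choiceType) (A : {fset T}) : (#|` A| <= 2)%N ->
  A = fset0 \/ exists p r, A = [fset p; r].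
Proof.
move=> c2; have [->|[p pA]] := fset_0Vmem A; [by left|right].
move: c2; rewrite (cardfsD1 p) pA add1n ltnS => c1; exists p.
have [e|[r rA]] := fset_0Vmem (A `\ p).
  by exists p; rewrite -(fsetD1K pA) e; apply/fsetP => u; rewrite !inE orbF orbb.
exists r; rewrite -[in LHS](fsetD1K pA); congr (_ |` _).
by apply/eqP; rewrite eq_sym eqEfcard fsub1set rA cardfs1.
Qed.

(** * Stars of faces *)

Section Curve.
Variable R : realType.
Local Notation point := 'rV[R]_3.
Local Notation vec := 'rV[R]_(1 + 3).
Implicit Types (s : seq R) (e c : R).

(** Horner form of a polynomial, constant term first: for small positive e its sign is that of the
    first nonzero coefficient. *)
Definition hor s e : R := foldr (fun c acc => c + e * acc) 0 s.

Lemma hor_bounded s : exists2 B, 0 <= B & forall e, 0 < e -> e <= 1 -> `|hor s e| <= B.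
Proof.
elim: s => [|c s [B B0 H]]; first by exists 0 => // e _ _ /=; rewrite normr0.
exists (`|c| + B) => [|e e0 e1 /=]; first by rewrite addr_ge0.
apply: (le_trans (ler_normD _ _)); rewrite lerD2l normrM gtr0_norm //.
by apply: (le_trans _ (H e e0 e1)); rewrite ler_piMl.
Qed.

Lemma evt_hor_gt0 c s : 0 < c -> evt (fun e => 0 < hor (c :: s) e).
Proof.
move=> c0; have [B B0 H] := hor_bounded s.
have H1 := evt_lin (- B) c0; have H2 := evt_lt (ltr01 : 0 < 1 :> R).
apply: evt_imp (evtI H1 H2) => e e0 [h1 h2] /=.
apply: (lt_le_trans h1); rewrite lerD2l ler_pM2l //.
by have := H e e0 (ltW h2); rewrite ler_norml => /andP[].
Qed.

Lemma evt_hor_neq0 s : has (fun c => c != 0) s -> evt (fun e => hor s e != 0).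
Proof.
elim: s => // c s IH /=; case: (ltgtP c 0) => [c0 _|c0 _|-> /= /IH].
- have /evt_hor_gt0-/(_ (map -%R s)) : 0 < - c by rewrite oppr_gt0.
  apply: evt_imp => e e0; have -> : hor (- c :: map -%R s) e = - hor (c :: s) e.
    by rewrite /=; elim: s {IH} c {c0} => [|d s IH] c /=; [ring|rewrite IH; ring].
  by rewrite oppr_gt0 => /lt_eqF/negbT.
- by apply: evt_imp (evt_hor_gt0 s c0) => e e0 /gt_eqF/negbT.
by apply: evt_imp => e e0 h; rewrite add0r mulf_neq0 // gt_eqF.
Qed.

Definition basis3 (i : 'I_3) : point := delta_mx 0 i.
Definition dir (i : 'I_3) : vec := row_mx 0 (basis3 i).

(* A curve leaving [x] that meets every plane only finitely often near [x]. *)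
Definition curve (x : point) (e : R) : point :=
  x + e *: (basis3 0 + e *: (basis3 1 + e *: basis3 2%:R)).

Lemma homog_curve x e : homog (curve x e) =
  homog x + e *: dir 0 + (e ^+ 2) *: dir 1 + (e ^+ 3) *: dir 2%:R.
Proof.
rewrite /homog /dir !scale_row_mx !add_row_mx !scaler0 !addr0; congr row_mx.
rewrite /curve !scalerDr !scalerA -!addrA.
by rewrite (exprSr e 2) expr2.
Qed.

Lemma homog_dir (x a : point) : homog a = homog x +
  (a 0 0 - x 0 0) *: dir 0 + (a 0 1 - x 0 1) *: dir 1 + (a 0 2%:R - x 0 2%:R) *: dir 2%:R.
Proof.
rewrite /homog /dir !scale_row_mx !add_row_mx !scaler0 !addr0; congr row_mx.
apply/rowP => i; rewrite !mxE !eqxx /=.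
case: i => [[|[|[|//]]] h].
- by rewrite (_ : Ordinal h = 0) //=; [ring|exact: val_inj].
- by rewrite (_ : Ordinal h = 1) //=; [ring|exact: val_inj].
- by rewrite (_ : Ordinal h = 2%:R) //=; [ring|exact: val_inj].
Qed.

(** The coordinate is a cubic polynomial in e. If all its coefficients vanished, it would vanish at
    x and in all directions, hence at the vertex a, where it is 1. *)
Lemma curve_generic V a x : frame V -> a \in V -> evt (fun e => crd V (homog (curve x e)) a != 0).
Proof.
move=> fV aV; pose f y := crd V y a.
pose s := [:: f (homog x); f (dir 0); f (dir 1); f (dir 2%:R)].
have E e : crd V (homog (curve x e)) a = hor s e.
  by rewrite homog_curve /s /f !crdD // !crdZ //=; ring.
have [h|h] := boolP (has (fun c => c != 0) s).
  by apply: evt_imp (evt_hor_neq0 h) => e e0; rewrite E.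
exfalso; move: h => /=; rewrite !negb_or !negbK => /and5P[/eqP h0 /eqP h1 /eqP h2 /eqP h3 _].
have := crd_homog fV aV aV; rewrite (homog_dir x) !crdD // !crdZ //.
rewrite -/(f _) -/(f (dir 0)) -/(f (dir 1)) -/(f (dir 2%:R)) h0 h1 h2 h3 eqxx !mulr0 !addr0.
by move=> /eqP; rewrite eq_sym oner_eq0.
Qed.

Lemma curve_pos V a x : frame V -> a \in V -> 0 < crd V (homog x) a ->
  evt (fun e => 0 < crd V (homog (curve x e)) a).
Proof.
move=> fV aV h; pose f y := crd V y a.
apply: evt_imp (evt_hor_gt0 [:: f (dir 0); f (dir 1); f (dir 2%:R)] h) => e e0.
by rewrite homog_curve !crdD // !crdZ //= /f; congr (0 < _); ring.
Qed.

Lemma curve_H3 x : H3 x -> evt (fun e => H3 (curve x e)).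
Proof.
move=> /H3E[_ tx]; set c := lf _ _ in tx; pose X := homog x.
have c0 : 0 < - c by rewrite oppr_gt0.
pose s := [:: - (lf X (dir 0) *+ 2); - (lf (dir 0) (dir 0) + lf X (dir 1) *+ 2);
  - (lf X (dir 2%:R) *+ 2 + lf (dir 0) (dir 1) *+ 2);
  - (lf (dir 1) (dir 1) + lf (dir 0) (dir 2%:R) *+ 2); - (lf (dir 1) (dir 2%:R) *+ 2);
  - lf (dir 2%:R) (dir 2%:R)].
apply: evt_imp (evt_hor_gt0 s c0) => e e0 h; apply/H3E; split; first by rewrite homog00.
rewrite -oppr_gt0; move: h; congr (0 < _).
rewrite homog_curve -/X !(lfDl, lfDr) !(lfZl, lfZr) (lfC (dir 0) X) (lfC (dir 1) X)
 (lfC (dir 2%:R) X) (lfC (dir 1) (dir 0)) (lfC (dir 2%:R) (dir 0)) (lfC (dir 2%:R) (dir 1)).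
by rewrite /s /c -/X /=; ring.
Qed.

End Curve.

(** * Regularity of the fan around a face *)

Section Fan.
Variables (R : realType) (M : hyperbolic_manifold R).
Local Notation point := 'rV[R]_3.
Local Notation vec := 'rV[R]_(1 + 3).
Local Notation simplex := {fset 'rV[R]_3}.
Local Notation good := (good M).
Implicit Types (F G V W U P S : simplex) (x y z b : vec) (u v a t p r : point).
Implicit Types (L : set simplex).

Lemma sqrt_triangle (a1 a2 b1 b2 : R) : a1 * b2 - a2 * b1 != 0 ->
  Num.sqrt ((a1 + b1) ^+ 2 + (a2 + b2) ^+ 2) <
  Num.sqrt (a1 ^+ 2 + a2 ^+ 2) + Num.sqrt (b1 ^+ 2 + b2 ^+ 2).
Proof.
move=> d0; set A := a1 ^+ 2 + a2 ^+ 2; set B := b1 ^+ 2 + b2 ^+ 2.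
have A0 : 0 <= A by rewrite addr_ge0 ?sqr_ge0.
have B0 : 0 <= B by rewrite addr_ge0 ?sqr_ge0.
have s0 : 0 <= Num.sqrt A + Num.sqrt B by rewrite addr_ge0 ?sqrtr_ge0.
rewrite -(ger0_norm s0) -sqrtr_sqr ltr_sqrt; last first.
  rewrite exprn_gt0 // lt_neqAle s0 andbT eq_sym paddr_eq0 ?sqrtr_ge0 //.
  apply/negP => /andP[/eqP h _]; have : A = 0 by rewrite -(sqr_sqrtr A0) h expr0n.
  move=> /eqP; rewrite paddr_eq0 ?sqr_ge0 // !sqrf_eq0 => /andP[/eqP e1 /eqP e2].
  by move: d0; rewrite e1 e2 !mul0r subrr eqxx.
rewrite [X in _ < X]sqrrD !sqr_sqrtr //.
have CS : a1 * b1 + a2 * b2 < Num.sqrt A * Num.sqrt B.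
  rewrite -sqrtrM //; case: (ltP (a1 * b1 + a2 * b2) 0) => [h|h].
    by rewrite (lt_le_trans h) ?sqrtr_ge0.
  have pos : 0 < A * B - (a1 * b1 + a2 * b2) ^+ 2.
    have -> : A * B - (a1 * b1 + a2 * b2) ^+ 2 = (a1 * b2 - a2 * b1) ^+ 2 by rewrite /A /B; ring.
    by rewrite exprn_even_gt0.
  have AB : 0 < A * B by have := sqr_ge0 (a1 * b1 + a2 * b2); lra.
  by rewrite -(ger0_norm h) -sqrtr_sqr ltr_sqrt // -subr_gt0.
by rewrite /A /B mulr2n; lra.
Qed.

Variables (L : set simplex) (gL : good L).

(** If v had only nonnegative coordinates outside F, [fan_uniq] would make it a vertex of V. *)
Lemma fan_neg V V' F v : face L F -> (1 < #|` F|)%N -> L V -> L V' -> F `<=` V -> F `<=` V' ->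
  v \in V' -> v \notin V -> exists2 t, t \in V `\` F & crd V (homog v) t < 0.
Proof.
move=> fF cF LV LV' FV FV' vV' vV; apply: contrapT => H.
have [y cy] := co_ex F.
have ty := co_tl (face_balls gL fF) (face_indep gL fF) cF cy.
have fV' := good_frame gL LV'.
have s : F `|` [fset u in V' | 0 < crd V' (homog v) u] `<=` V.
  apply: (fan_uniq gL LV' LV FV' FV ty cy).
    by move=> u uV' _; rewrite crd_homog // ler0n.
  move=> u uV uF; rewrite leNgt; apply/negP => h; apply: H; exists u => //.
  by rewrite inE uF.
move: vV; rewrite (fsubsetP s) // !inE vV' /= crd_homog // eqxx ltr01 orbT //.
Qed.

(* The fan of the star of [F] in the quotient by the span of [F] is regular: interpolating a
   Euclidean norm linearly on its cones gives a strictly convex function. *)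
Lemma star_acyc F b : face L F -> (1 < #|` F|)%N -> acyc b [set V | L V /\ F `<=` V].
Proof.
move=> fF cF T0 T00 HT.
have [V0 V0T] := fset0Pn _ T00; have [LV0 FV0] := HT _ V0T.
have fr V : V \in T0 -> frame V.
  by move=> VT; have [LV _] := HT V VT; exact: (good_frame gL LV).
have cD V : V \in T0 -> #|` V `\` F| = (4 - #|` F|)%N.
  by move=> VT; rewrite cardfsDS ?(fr _ VT).2 //; case: (HT _ VT).
(* The points p and r may coincide, which covers the faces with three vertices. What remains is a
   tetrahedron F, whose star is F alone. *)
have [[p [r epr]]|nE] := pselect (exists p r, V0 `\` F = [fset p; r]); last first.
  exists V0 => // V' V'T nV; exfalso.
  have c4 : (#|` V0 `\` F| <= 2)%N by rewrite cD // leq_subLR addn2; move: cF; case: #|` F| => [|[|n]].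
  case: (card_le2 c4) => [/eqP|[p [r e]]]; last by apply: nE; exists p, r.
  rewrite -cardfs_eq0 cD // subn_eq0 => c4'; apply: nV.
  have [LV' FV'] := HT _ V'T.
  have e0 : F = V0 by apply/eqP; rewrite eqEfcard FV0 (fr _ V0T).2.
  by apply/eqP; rewrite eq_sym -e0 eqEfcard FV' (fr _ V'T).2.
have f0 := fr _ V0T.
have pV : p \in V0 by have : p \in V0 `\` F; [rewrite epr !inE eqxx|rewrite inE => /andP[]].
have rV : r \in V0 by have : r \in V0 `\` F; [rewrite epr !inE eqxx orbT|rewrite inE => /andP[]].
pose c1 y := crd V0 y p; pose c2 y := crd V0 y r.
pose N y := Num.sqrt (c1 y ^+ 2 + c2 y ^+ 2).
have N0 y : 0 <= N y by exact: sqrtr_ge0.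
have cF0 v : v \in F -> c1 (homog v) = 0 /\ c2 (homog v) = 0.
  move=> vF; have vV := fsubsetP FV0 _ vF; rewrite /c1 /c2 !crd_homog //.
  have : p \notin F by have : p \in V0 `\` F; [rewrite epr !inE eqxx|rewrite inE => /andP[]].
  have : r \notin F by have : r \in V0 `\` F; [rewrite epr !inE eqxx orbT|rewrite inE => /andP[]].
  by move=> rF pF; split; case: eqP => // e; [rewrite e vF in pF|rewrite e vF in rF].
have spanF y : c1 y = 0 -> c2 y = 0 -> y = comb F (crd V0 y).
  move=> h1 h2; rewrite -[LHS](crdK y f0); apply/esym/comb_sub => // v vV vF.
  have : v \in V0 `\` F by rewrite inE vF.
  by rewrite epr !inE => /orP[/eqP ->|/eqP ->].
have indF V (w : point -> R) t : V \in T0 -> comb (V `\` F) w = comb F (crd V0 (comb (V `\` F) w)) ->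
    t \in V `\` F -> w t = 0.
  move=> VT e tVF; have [LV FV] := HT _ VT; have [iV _] := fr _ VT.
  pose w' v := (if v \in F then - crd V0 (comb (V `\` F) w) v else 0) + (if v \in V `\` F then w v else 0).
  have : comb V w' = 0.
    rewrite /w' (combD V (fun v => if v \in F then - crd V0 (comb (V `\` F) w) v else 0)).
    rewrite -!comb_ext ?fsubsetDl // (combN F (crd V0 (comb (V `\` F) w))) -e addrC subrr //.
  move=> /iV /(_ t); move: tVF; rewrite inE => /andP[tF tV] /(_ tV).
  by rewrite /w' (negbTE tF) inE tF tV add0r.
(* N is a Euclidean norm on the quotient by the span of F. The linear function [l V] vanishes on F
   and agrees with N at the other vertices of V. *)
pose l V y := \sum_(t <- V `\` F) crd V y t * N (homog t).
have lsum V y z c : V \in T0 -> l V (y - c *: z) = l V y - c * l V z.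
  move=> VT; rewrite /l mulr_sumr -sumrB; apply: eq_big_seq => t; rewrite inE => /andP[_ tV].
  have fV := fr _ VT; by rewrite crdB // crdZ // mulrBl mulrA.
have key V V' v : V \in T0 -> V' \in T0 -> v \in V' `\` F -> v \notin V -> l V (homog v) < N (homog v).
  move=> VT VT' vVF vV; have [LV FV] := HT _ VT; have [LV' FV'] := HT _ VT'.
  have vV' : v \in V' by move: vVF; rewrite inE => /andP[].
  have Nv : 0 < N (homog v).
    rewrite lt_neqAle N0 andbT eq_sym; apply/negP => /eqP h.
    have : c1 (homog v) ^+ 2 + c2 (homog v) ^+ 2 = 0.
      by rewrite -[LHS]sqr_sqrtr ?addr_ge0 ?sqr_ge0 // -/(N _) h expr0n.
    move=> /eqP; rewrite paddr_eq0 ?sqr_ge0 // !sqrf_eq0 => /andP[/eqP h1 /eqP h2].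
    have e := spanF _ h1 h2.
    have := indF V' (fun u => (u == v)%:R) v VT'; rewrite comb1 // => /(_ e vVF)/eqP.
    by rewrite eqxx oner_eq0.
  have [t1] := fan_neg fF cF LV LV' FV FV' vV' vV.
  rewrite -/(crd _ _ _) => t1V ct1.
  have t1V' : t1 \in V by move: t1V; rewrite inE => /andP[].
  rewrite /l (big_fsetD1 t1) //=.
  case: (V `\` F `\ t1 =P fset0) => [->|/eqP n0].
    rewrite big_seq_fset0 addr0; apply: le_lt_trans Nv; rewrite mulr_le0_ge0 //; exact: ltW.
  have [t2 t2V] := fset0Pn _ n0.
  have e2 : V `\` F `\ t1 = [fset t2].
    apply/esym/eqP; rewrite eqEfcard fsub1set t2V cardfs1.
    have := cD _ VT; rewrite (cardfsD1 t1) t1V => e; rewrite -ltnS -add1n e leq_subLR addn2.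
    by move: cF; case: #|` F| => [|[|n]].
  rewrite e2 big_seq_fset1.
  move: t2V; rewrite !inE => /and3P[t21 t2F t2V].
  case: (leP (crd V (homog v) t2) 0) => ct2.
    apply: le_lt_trans Nv; apply: (le_trans (y := 0 + 0)); last by rewrite addr0.
    by apply: lerD; rewrite mulr_le0_ge0 //; exact: ltW.
  have sum2 (w : point -> R) : comb (V `\` F) w = w t1 *: homog t1 + w t2 *: homog t2.
    by rewrite (combD1 _ t1V) e2 comb_set1.
  set d1 := crd V (homog v) t1 in ct1 *; set d2 := crd V (homog v) t2 in ct2 *.
  have ce i (iV : i \in [fset p; r]) : crd V0 (homog v) i = d1 * crd V0 (homog t1) i + d2 * crd V0 (homog t2) i.
    have [iV0 iF] : i \in V0 /\ i \notin F by move: iV; rewrite -epr inE => /andP[].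
    rewrite -[homog v](crdK _ (fr _ VT)) crd_sum // (big_fsetID _ (mem F)) /=.
    rewrite [X in X + _]big_seq big1 ?add0r; last first.
      move=> u; rewrite !inE => /andP[_ uF].
      rewrite (crd_homog f0 (fsubsetP FV0 _ uF) iV0).
      by case: eqP => [e|]; rewrite ?mulr0 //; rewrite e uF in iF.
    rewrite (_ : [fset x in V | x \notin F] = V `\` F); last first.
      by apply/fsetP => u; rewrite !inE andbC.
    by rewrite (big_fsetD1 t1) //= e2 big_seq_fset1.
  have ep := ce p (fset21 _ _); have er := ce r (fset22 _ _).
  (* Modulo the span of F, [d2 *: homog t2] is the sum of [homog v] and [- d1 *: homog t1]. These
     are not parallel, so the triangle inequality for N is strict. *)
  have Ne : d2 * N (homog t2) = Num.sqrt ((c1 (homog v) + - d1 * c1 (homog t1)) ^+ 2 + (c2 (homog v) + - d1 * c2 (homog t1)) ^+ 2).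
    rewrite /N -(gtr0_norm ct2) -sqrtr_sqr -sqrtrM ?sqr_ge0 //; congr Num.sqrt.
    by rewrite /c1 /c2 ep er; ring.
  have Nd1 : - d1 * N (homog t1) = Num.sqrt ((- d1 * c1 (homog t1)) ^+ 2 + (- d1 * c2 (homog t1)) ^+ 2).
    have nd : 0 < - d1 by rewrite oppr_gt0.
    by rewrite /N -{1}(gtr0_norm nd) -sqrtr_sqr -sqrtrM ?sqr_ge0 //; congr Num.sqrt; ring.
  have dd : c1 (homog v) * (- d1 * c2 (homog t1)) - c2 (homog v) * (- d1 * c1 (homog t1)) != 0.
    apply/eqP => h0.
    have h : c1 (homog t2) * c2 (homog t1) - c2 (homog t2) * c1 (homog t1) = 0.
      have : - (d1 * d2) * (c1 (homog t2) * c2 (homog t1) - c2 (homog t2) * c1 (homog t1)) = 0.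
        by rewrite -[RHS]h0 /c1 /c2 ep er; ring.
      by move=> /eqP; rewrite mulf_eq0 oppr_eq0 mulf_eq0 (lt_eqF ct1) (gt_eqF ct2) /= => /eqP.
    pose w1 v := if v == t1 then - c2 (homog t2) else c2 (homog t1).
    pose w2 v := if v == t1 then - c1 (homog t2) else c1 (homog t1).
    have t1nF : t1 \notin F by move: t1V; rewrite inE => /andP[].
    have t2VF : t2 \in V `\` F by rewrite inE t2F.
    have w10 : forall t, t \in V `\` F -> w1 t = 0.
      move=> t; apply: indF => //; apply: spanF; rewrite sum2 /w1 eqxx (negbTE t21) /c1 /c2 crdD // !crdZ // -/(c1 _) -/(c1 (homog t2)) -/(c2 _) -/(c2 (homog t2)).
        by rewrite -[RHS]h /c1 /c2; ring.
      by rewrite /c1 /c2; ring.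
    have w20 : forall t, t \in V `\` F -> w2 t = 0.
      move=> t; apply: indF => //; apply: spanF; rewrite sum2 /w2 eqxx (negbTE t21) /c1 /c2 crdD // !crdZ // -/(c1 _) -/(c1 (homog t2)) -/(c2 _) -/(c2 (homog t2)).
        by rewrite /c1 /c2; ring.
      by rewrite -[RHS]oppr0 -h /c1 /c2; ring.
    have z1 : c1 (homog t1) = 0 by have := w20 t2 t2VF; rewrite /w2 (negbTE t21).
    have z2 : c2 (homog t1) = 0 by have := w10 t2 t2VF; rewrite /w1 (negbTE t21).
    have e := spanF _ z1 z2.
    have := indF V (fun u => (u == t1)%:R) t1 VT.
    rewrite sum2 eqxx (negbTE t21) scale1r scale0r addr0 => /(_ e t1V)/eqP.
    by rewrite oner_eq0.
  have := sqrt_triangle dd; rewrite -Ne -Nd1 -/(N (homog v)); lra.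
have less V V' y : V \in T0 -> V' \in T0 -> V <> V' -> co V' y -> l V y < l V' y.
  move=> VT VT' nVV cy; have [LV FV] := HT _ VT; have [LV' FV'] := HT _ VT'.
  have f' := fr _ VT'; have fV := fr _ VT; move: cy; rewrite frame_co // => cy.
  have -> : l V y = \sum_(v <- V' `\` F) crd V' y v * l V (homog v).
    rewrite /l; under [RHS]eq_bigr do rewrite mulr_sumr.
    rewrite exchange_big /=; apply: eq_big_seq => t; rewrite inE => /andP[tF tV].
    rewrite -[y in LHS](crdK y f') crd_sum // mulr_suml (big_fsetID _ (mem F)) /=.
    rewrite [X in X + _]big_seq big1 ?add0r; last first.
      move=> u; rewrite !inE => /andP[_ uF]; rewrite (crd_homog fV (fsubsetP FV _ uF) tV).
      by case: eqP => [e|]; rewrite ?mulr0 ?mul0r //; rewrite e uF in tF.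
    rewrite (_ : [fset x in V' | x \notin F] = V' `\` F); last first.
      by apply/fsetP => u; rewrite !inE andbC.
    by apply: eq_bigr => u _; rewrite mulrA.
  have [v vV' vV] : exists2 v, v \in V' & v \notin V.
    apply: contrapT => H; apply: nVV; apply/esym/eqP; rewrite eqEfcard f'.2 fV.2 leqnn andbT.
    by apply/fsubsetP => v vV'; apply: contraT => vV; case: H; exists v.
  have vVF : v \in V' `\` F by rewrite inE vV' andbT; apply: contra vV; exact: (fsubsetP FV).
  rewrite [X in _ < X]/l !(big_fsetD1 v vVF) /= ltr_leD //.
    by rewrite ltr_pM2l ?cy //; exact: key VT VT' vVF vV.
  rewrite !big_seq; apply: ler_sum => u; rewrite !inE => /and3P[_ uF uV'].
  rewrite ler_pM2l ?cy //; case: (boolP (u \in V)) => uV; last first.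
    by apply/ltW/(key V V') => //; rewrite inE uF.
  rewrite /l (big_fsetD1 u) ?inE ?uF //= crd_homog // eqxx mul1r big_seq big1 ?addr0 //.
  by move=> t; rewrite !inE => /and3P[tu _ tV]; rewrite crd_homog // (negbTE tu) mul0r.
(* A tetrahedron with the largest value at b is hidden by no other one: for y in [V'] and [y - b] in
   V, the two instances of [less] add up to a larger value at b for [V']. *)
have [V VT HV] := fset_argmin (fun V => - l V b) T00; exists V => // V' V'T nV [y cy cy'].
have h1 := less V V' y VT V'T (fun e => nV (esym e)) cy.
have h2 := less V' V (y - b) V'T VT nV cy'.
have := HV V' V'T; rewrite lerN2 => h3; move: h2.
by rewrite -(scale1r b) !lsum // !mul1r; lra.
Qed.

End Fan.

(** * Refinements *)

Section Refine.
Variables (R : realType) (M : hyperbolic_manifold R).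
Local Notation point := 'rV[R]_3.
Local Notation vec := 'rV[R]_(1 + 3).
Local Notation simplex := {fset 'rV[R]_3}.
Local Notation D := (deck M).
Local Notation orb := (simplex_orbit M).
Local Notation good := (good M).
Implicit Types (F G V W U P w : simplex) (x y z b : vec) (u v a t s p q : point).
Implicit Types (g h : 'M[R]_(1 + 3)) (L X Y : set simplex) (T : {fset simplex}).

Lemma indep_free F : indep F -> free [seq homog v | v <- F].
Proof.
move=> iF; have sX : size [seq homog v | v <- F] == #|` F| by rewrite size_map.
pose X : #|` F|.-tuple vec := Tuple sX.
rewrite -[X in free X]/(tval X); apply/freeP => k e i.
have ix (j : 'I_(#|` F|)) : insub (index F`_j F) = Some j.
  rewrite index_uniq ?fset_uniq //.
  by rewrite insubT //= => hj; congr Some; apply: val_inj.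
have cE : \sum_(j < #|` F|) k j *: X`_j =
    comb F (fun v => if insub (index v F) is Some j then k j else 0).
  rewrite /comb [RHS](big_nth 0) big_mkord -/(size F).
  by apply: eq_bigr => j _; rewrite ix (nth_map 0).
have := iF _ (etrans (esym cE) e) F`_i; rewrite mem_nth // ix; exact.
Qed.

Lemma indep_card G F : indep G -> (forall v, v \in G -> exists w : point -> R, homog v = comb F w) ->
  (#|` G| <= #|` F|)%N.
Proof.
move=> /indep_free fG H.
have eG : size [seq homog v | v <- G] = #|` G| by rewrite size_map.
have eF : size [seq homog v | v <- F] = #|` F| by rewrite size_map.
move: fG; rewrite /free => /eqP eq1; rewrite -eG -eF -eq1.
apply: leq_trans (dim_span _); apply: dimvS; apply/span_subvP => y /mapP[v vG ->].
have [w ->] := H v vG; rewrite /comb big_seq; apply: rpred_sum => u uF.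
by apply: rpredZ; apply: memv_span; apply/mapP; exists u.
Qed.

Definition inside G P : Prop := forall v, v \in G -> cc P (homog v).

Lemma inside_self P : inside P P.
Proof. by move=> v; exact: cc_homog. Qed.

Lemma inside_sub G G' P : G' `<=` G -> inside G P -> inside G' P.
Proof. by move=> /fsubsetP GG H v /GG/H. Qed.

Lemma inside_cc G P y : inside G P -> cc G y -> cc P y.
Proof. exact: cc_trans. Qed.

Lemma inside_mv g G P : D g -> balls G -> balls P -> inside G P -> inside (mv g G) (mv g P).
Proof.
move=> Dg bG bP H u /imfsetP[v /= vG ->].
have [c c0 e] := homog_act (deck_iso Dg) (bG _ vG).
have -> : homog (act g v) = c^-1 *: (homog v *m g) by rewrite e scalerA mulVf ?scale1r // gt_eqF.
apply: ccZ; first by rewrite invr_ge0 ltW.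
by apply/(cc_mv _ Dg bP)/H.
Qed.

Lemma inside_mvE g G P : D g -> balls G -> balls P -> inside (mv g G) (mv g P) -> inside G P.
Proof.
move=> Dg bG bP /(inside_mv (deckV Dg) (balls_mv Dg bG) (balls_mv Dg bP)).
by rewrite (mvK Dg bG) (mvK Dg bP).
Qed.

(** The coordinates of y outside F vanish, and they are combinations with positive weights of
    nonnegative coordinates of the vertices of G. *)
Lemma inside_face G P F y : frame P -> inside G P -> F `<=` P -> co G y -> co F y -> inside G F.
Proof.
move=> fP iG FP [w w0 ey] /(frame_cosub _ fP FP)[_ H] v vG.
have c0 := (frame_cc _ fP).1 (iG v vG).
apply/(frame_ccsub _ fP FP); split; first by move=> a /(fsubsetP FP)/c0.
move=> a aP aF; have := H a aP aF; rewrite ey crd_sum // (big_fsetD1 v) //=.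
move=> /eqP; rewrite paddr_eq0 ?mulr_ge0 ?c0 //; last 2 first.
- exact: ltW (w0 _ vG).
- rewrite big_seq; apply: sumr_ge0 => u; rewrite !inE => /andP[_ uG].
  by rewrite mulr_ge0 ?(ltW (w0 _ uG)) //; exact: ((frame_cc _ fP).1 (iG u uG)).
by rewrite mulf_eq0 (gt_eqF (w0 _ vG)) /= => /andP[/eqP].
Qed.

(** If y were on the boundary of F, all of G would lie in a proper face of F, whose span is too
    small for that many independent vectors. *)
Lemma inside_co G P F y : frame P -> F `<=` P -> indep G -> #|` G| = #|` F| -> inside G F ->
  co G y -> co F y.
Proof.
move=> fP FP iG cG H cy; have cF : cc F y := inside_cc H (co_cc cy).
have [h1 h2] := (frame_ccsub _ fP FP).1 cF.
apply/(frame_cosub _ fP FP); split=> // t tF; rewrite lt_neqAle h1 // andbT.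
apply/negP => /eqP e0.
have HP : inside G P by move=> v /H; exact: cc_sub.
have sF : supp P y `<=` F `\ t.
  apply/fsubsetP => v; rewrite !inE => /andP[vP vy]; apply/andP; split.
    by apply: contraTneq vy => ->; rewrite -e0 ltxx.
  by apply: contraTT vy => vF; rewrite h2 // ltxx.
have iF := inside_face fP HP (supp_sub _ _) cy (co_supp fP (inside_cc HP (co_cc cy))).
have : (#|` G| <= #|` F `\ t|)%N.
  apply: indep_card => // v /iF/(cc_sub sF)[w _ e]; by exists w.
by rewrite cG (cardfsD1 t F) tF add1n ltnn.
Qed.

Definition refines X Y : Prop := forall V, X V -> exists2 P, Y P & inside V P.

(** All directions b are included: the starring points are chosen later, directions are projected
    when cones are compared, and the deck group moves them. *)
Definition fine X Y : Prop :=
  [/\ good X, good Y, refines X Y &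
      forall P, Y P -> forall b, acyc b [set V | X V /\ inside V P]].

Lemma fine_refl Y : good Y -> fine Y Y.
Proof.
move=> gY; split=> //; first by move=> V YV; exists V => //; exact: inside_self.
move=> P YP b T0 /fset0Pn[V VT] HT; exists V => // V' V'T nV; exfalso; apply: nV.
have eP U : U \in T0 -> U = P.
  move=> UT; have [YU iU] := HT U UT.
  have [y cy] := co_ex U; have ty := tetra_tl (good_tetra gY YU) cy.
  apply: (face_uniq gY ty (face_self gY YU) (face_self gY YP) cy).
  apply: (inside_co (good_frame gY YP) (fsubset_refl P) (good_frame gY YU).1 _ iU cy).
  by rewrite (good_frame gY YU).2 (good_frame gY YP).2.
by rewrite (eP _ VT) (eP _ V'T).
Qed.

Lemma finite_pred (T : choiceType) (A : {fset T}) (Q : T -> Prop) :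
  (forall c, Q c -> c \in A) -> exists B : {fset T}, forall c, c \in B <-> Q c.
Proof.
move=> H; exists [fset c in A | `[< Q c >]] => c; rewrite !inE /=; split.
  by move=> /andP[_ /asboolP].
by move=> Qc; rewrite H //; apply/asboolP.
Qed.

Lemma star_finite L F : good L -> face L F -> (1 < #|` F|)%N ->
  exists A : {fset simplex}, forall V, V \in A <-> L V /\ F `<=` V.
Proof.
move=> gL fF cF; have [y cy] := co_ex F.
have ty := co_tl (face_balls gL fF) (face_indep gL fF) cF cy.
have [A HA] := point_finite gL ty; apply: (finite_pred (A := A)) => V [LV FV].
by apply: HA => //; exact: cc_sub FV (co_cc cy).
Qed.

Section Fine.
Variables (X Y : set simplex).
Hypothesis fXY : fine X Y.

Let gX : good X. Proof. by case: fXY. Qed.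
Let gY : good Y. Proof. by case: fXY. Qed.
Let rXY : refines X Y. Proof. by case: fXY. Qed.

Lemma inside_co4 V P y : X V -> Y P -> inside V P -> co V y -> co P y.
Proof.
move=> XV YP; apply: (inside_co (good_frame gY YP)) => //; first exact: (good_frame gX XV).1.
by rewrite (good_frame gX XV).2 (good_frame gY YP).2.
Qed.

Lemma parent_uniq V P P' : X V -> Y P -> Y P' -> inside V P -> inside V P' -> P = P'.
Proof.
move=> XV YP YP' iP iP'; have [y cy] := co_ex V; have ty := tetra_tl (good_tetra gX XV) cy.
exact: (face_uniq gY ty (face_self gY YP) (face_self gY YP') (inside_co4 XV YP iP cy) (inside_co4 XV YP' iP' cy)).
Qed.

Lemma cell_at y : tl y -> exists2 V, X V & cc V y.
Proof.
move=> ty; have [F [_ [V XV FV]] cF] := carrier gX ty; exists V => //.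
exact: cc_sub FV (co_cc cF).
Qed.

Lemma inside_of V P y : X V -> Y P -> cc V y -> co P y -> inside V P.
Proof.
move=> XV YP cV cP; have [P' YP' iP'] := rXY XV.
have ty := tetra_tl (good_tetra gY YP) cP.
have s := cc_face_sub gY ty YP' (inside_cc iP' cV) (face_self gY YP) cP.
suff -> : P = P' by [].
by apply/eqP; rewrite eqEfcard s (good_frame gY YP).2 (good_frame gY YP').2.
Qed.

(** There are finitely many orbits, and equivalent cells inside P differ by an element stabilising
    P, which is trivial. *)
Lemma finite_inside P : Y P -> exists A : {fset simplex}, forall V, V \in A <-> X V /\ inside V P.
Proof.
move=> YP; pose S := [set V | X V /\ inside V P].
have fS : finite_set S.
  pose f o := xget fset0 [set V | S V /\ orb V = o].
  have fX : finite_set (orb @` X) by case: gX.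
  apply: (sub_finite_set _ (finite_image f fX)) => V SV; have [XV iV] := SV.
  exists (orb V); first by exists V.
  rewrite /f; case: xgetP => [U _ [[XU iU] /(orb_eq _ _ (good_balls gX XV))[g Dg e]]|/(_ V)]; last by case.
  have YgP := good_mv gY Dg YP.
  have i2 : inside U (mv g P).
    by rewrite e; apply: inside_mv => //; [exact: good_balls gX _ XV|exact: good_balls gY _ YP].
  have eP : mv g P = P by exact: parent_uniq XU YgP YP i2 iU.
  by rewrite e (tetra_stab Dg (good_tetra gY YP) eP) mv1.
have [A HA] := fset_of_finite fS; exists A => V; by rewrite -HA.
Qed.

Lemma inside_carrier V P G F y : X V -> Y P -> inside V P -> G `<=` V -> tl y -> co G y ->
  face Y F -> co F y -> F `<=` P /\ inside G F.
Proof.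
move=> XV YP iV GV ty cG fF cF.
have iG := inside_sub GV iV.
have FP := cc_face_sub gY ty YP (inside_cc iG (co_cc cG)) fF cF.
by split=> //; exact: inside_face (good_frame gY YP) iG FP cG cF.
Qed.

Section Star.
Variables (F : simplex) (p : point).
Hypotheses (fF : face Y F) (cF : (1 < #|` F|)%N).
Hypothesis injF : forall g P, D g -> Y P -> F `<=` P -> F `<=` mv g P -> g = 1%:M.
Hypotheses (Hp : H3 p) (cp : co F (homog p)).

Definition in_star V := X V /\ exists2 P, Y P /\ F `<=` P & inside V P.

Lemma in_star_finite : exists T, forall V, V \in T <-> in_star V.
Proof.
have [A HA] := star_finite gY fF cF.
pose f P := if pselect (Y P) is left YP then projT1 (cid (finite_inside YP)) else fset0.
pose B : {fset simplex} := \bigcup_(P <- A) f P.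
apply: (finite_pred (A := B)) => V [XV [P [YP FP] iV]].
apply/bigfcupP; exists P; first by rewrite andbT; apply/HA.
by rewrite /f; case: pselect => // YP'; apply/(projT2 (cid (finite_inside YP'))).
Qed.

Variable T : {fset simplex}.
Hypothesis HT : forall V, V \in T <-> in_star V.

(** Lexicographic order: the cells of [Y] around F are ordered by [star_acyc], and the cells of [X]
    inside one of them by [fine]. *)
Lemma in_star_acyc b : acyc b [set` T].
Proof.
move=> T0 T00 sT.
have iT V : V \in T0 -> in_star V by move=> /sT /= /HT.
pose par V := xget fset0 [set P | [/\ Y P, F `<=` P & inside V P]].
have parP V : V \in T0 -> [/\ Y (par V), F `<=` par V & inside V (par V)].
  by move=> /iT[XV [P [YP FP] iV]]; rewrite /par; case: xgetP => // /(_ P); case.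
pose Q := [fset par V | V in T0].
have [V0 V0T] := fset0Pn _ T00.
have Q0 : Q != fset0 by apply/fset0Pn; exists (par V0); apply/imfsetP; exists V0.
have HQ P : P \in Q -> [set P | Y P /\ F `<=` P] P.
  by move=> /imfsetP[V /= /parP[? ? _] ->].
have [P PQ HP] := star_acyc gY b fF cF Q0 HQ.
pose T1 := [fset V in T0 | par V == P].
have T10 : T1 != fset0.
  by move: PQ => /imfsetP[V /= VT e]; apply/fset0Pn; exists V; rewrite !inE VT e eqxx.
have [YP FP] : Y P /\ F `<=` P by move: PQ => /imfsetP[V /= /parP[? ? _] ->].
have [|V VT1 HV] := (let: And4 _ _ _ ac := fXY in ac) P YP b T1 T10.
  move=> V; rewrite !inE => /andP[VT /eqP e]; have [_ _ iV] := parP V VT.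
  by split; [case: (iT V VT)|rewrite -e].
move: VT1; rewrite !inE => /andP[VT /eqP eV]; exists V => // V' V'T nV bV.
have [YP' FP' iV'] := parP V' V'T; have [_ _ iV] := parP V VT.
have [e|ne] := pselect (par V' = P).
  by apply: (HV V' _ nV bV); rewrite !inE V'T e eqxx.
apply: (HP (par V') _ ne); first by apply/imfsetP; exists V'.
case: bV => y c1 c2; exists y.
  by apply: inside_co4 iV' c1 => //; case: (iT V' V'T).
by rewrite -eV; apply: inside_co4 iV c2; [case: (iT V VT)|rewrite eV].
Qed.

Lemma star_ready : evt (fun e => starable M X T (curve p e)).
Proof.
have TX V : V \in T -> X V by move=> /HT[].
have [A HA] := star_finite gY fF cF.
have tp : tl (homog p) by apply/H3E.
have E1 := curve_H3 Hp.
have E2 : evt (fun e => forall V, V \in T -> forall a, a \in V -> crd V (homog (curve p e)) a != 0).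
  by apply: evt_all => V VT; apply: evt_all => a aV; apply: curve_generic => //; exact: good_frame gX _ (TX V VT).
have E3 : evt (fun e => forall P, P \in A -> forall s, s \in F -> 0 < crd P (homog (curve p e)) s).
  apply: evt_all => P /HA[YP FP]; apply: evt_all => s sF.
  have fP := good_frame gY YP; apply: curve_pos => //; first exact: (fsubsetP FP).
  by have [H _] := (frame_cosub _ fP FP).1 cp; exact: H.
apply: evt_imp (evtI E1 (evtI E2 E3)) => e e0 [h1 [h2 h3]].
split=> //.
  have [F0 [P YP FP]] := fF; have [y cy] := co_ex P.
  have ty := tetra_tl (good_tetra gY YP) cy; have [V XV cV] := cell_at ty.
  apply/fset0Pn; exists V; apply/HT; split=> //; exists P => //.
  exact: inside_of XV YP cV cy.
split.
- move=> g V Dg /HT[XV [P [YP FP] iV]] /HT[XgV [P' [YP' FP'] iV']].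
  apply: (injF Dg YP FP).
  have -> : mv g P = P' ; last by [].
  apply: (parent_uniq XgV (good_mv gY Dg YP) YP' _ iV').
  by apply: inside_mv => //; [exact: good_balls gX _ XV|exact: good_balls gY _ YP].
- by move=> V a VT aV; exact: h2.
- exact: in_star_acyc.
move=> V a VT aV neg; have [XV [P [YP FP] iV]] := (HT V).1 VT.
have fV := good_frame gX XV; have fP := good_frame gY YP.
have [y cy] := co_ex (V `\ a).
have ty := wall_tl gX XV aV cy; have [G fG cG] := carrier gY ty.
have [GP iG] := inside_carrier XV YP iV (fsubD1set _ _) ty cy fG cG.
(* If the carrier of the wall contains F, the tetrahedron across the wall is again in the star.
   Otherwise the wall lies in the facet of P opposite to a vertex s of F. The starring point has a
   positive coordinate at s, so it cannot be on the far side. *)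
have [FG|] := boolP (F `<=` G).
  have [V' XV' [cV' HV']] := local_star gX (- homog a) ty.
  have fw : face X (V `\ a).
    split; last by exists V => //; exact: fsubD1set.
    by rewrite -cardfs_gt0 (wall_card fV aV).
  exists V'; split.
  - apply/HT; split=> //; have [P' YP' iV'] := rXY XV'; exists P' => //; split=> //.
    have sG := cc_face_sub gY ty YP' (inside_cc iV' cV') fG cG; exact: (fsubset_trans FG sG).
  - move=> eV; rewrite eV in HV'; have := HV' a aV.
    have [_ /(_ a aV)] := (frame_cosub _ fV (fsubD1set V a)).1 cy.
    rewrite !inE eqxx => /(_ isT) -> /(_ erefl).
    by rewrite crdN // crd_homog // eqxx oppr_ge0 ler10.
  - by have sw := cc_face_sub gX ty XV' cV' fw cy; exact: sw.
move=> /fsubsetPn[s sF sG]; exfalso.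
have sP := fsubsetP FP _ sF.
have w0 v : v \in V `\ a -> crd P (homog v) s = 0.
  by move=> /iG /(frame_ccsub _ fP GP)[_ H]; exact: H.
have qs := h3 P ((HA P).2 (conj YP FP)) s sF.
move: qs; rewrite -[homog (curve p e)](crdK _ fV) crd_sum // (big_fsetD1 a) //=.
rewrite [X in _ + X]big_seq [X in _ + X]big1 => [|v vw]; last by rewrite w0 // mulr0.
rewrite addr0 => qs; have := (frame_cc _ fP).1 (iV a aV) s sP => s0.
by move: qs; rewrite ltNge mulr_le0_ge0 // ltW.
Qed.

(** The boundary of the star of F consists of the facets opposite to vertices of F, and the free
    walls are the walls of [X] that subdivide them. *)
Lemma star_cone e : starable M X T (curve p e) -> forall U, cone (curve p e) T U <->
  exists V a P s, [/\ X V, a \in V, Y P, F `<=` P &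
    [/\ s \in F, inside V P, inside (V `\ a) (P `\ s) & U = curve p e |` (V `\ a)]].
Proof.
move=> st U; split.
  move=> [V [a [VT aV uV eU]]]; have [XV [P [YP FP] iV]] := (HT V).1 VT.
  have fV := good_frame gX XV; have fP := good_frame gY YP.
  have [y cy] := co_ex (V `\ a).
  have ty := wall_tl gX XV aV cy; have [G fG cG] := carrier gY ty.
  have [GP iG] := inside_carrier XV YP iV (fsubD1set _ _) ty cy fG cG.
  have [FG|] := boolP (F `<=` G).
    exfalso; have [V' XV' [cV' HV']] := local_star gX (- homog a) ty.
    have fw : face X (V `\ a).
      split; last by exists V => //; exact: fsubD1set.
      by rewrite -cardfs_gt0 (wall_card fV aV).
    have V'T : V' \in T.
      apply/HT; split=> //; have [P' YP' iV'] := rXY XV'; exists P' => //; split=> //.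
      have sG := cc_face_sub gY ty YP' (inside_cc iV' cV') fG cG; exact: (fsubset_trans FG sG).
    have eV := uV V' V'T (cc_face_sub gX ty XV' cV' fw cy).
    rewrite eV in HV'; have := HV' a aV.
    have [_ /(_ a aV)] := (frame_cosub _ fV (fsubD1set V a)).1 cy.
    rewrite !inE eqxx => /(_ isT) -> /(_ erefl).
    by rewrite crdN // crd_homog // eqxx oppr_ge0 ler10.
  move=> /fsubsetPn[s sF sG]; exists V, a, P, s; split=> //; split=> //.
  move=> v /iG; apply: cc_sub; apply/fsubsetP => u uG; rewrite !inE (fsubsetP GP _ uG) andbT.
  by apply: contraNneq sG => <-.
move=> [V [a [P [s [XV aV YP FP [sF iV iw eU]]]]]].
have VT : V \in T by apply/HT; split=> //; exists P.
exists V, a; split=> // V' V'T wV'; apply: contrapT => nV.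
have [XV' [P' [YP' FP'] iV']] := (HT V').1 V'T.
have fV := good_frame gX XV; have fP := good_frame gY YP; have fV' := good_frame gX XV'.
have sP := fsubsetP FP _ sF.
have [y cy] := co_ex (V `\ a); have ty := wall_tl gX XV aV cy.
have cPs : co (P `\ s) y.
  apply: (inside_co fP (fsubD1set _ _) _ _ iw cy); first exact: indep_sub (fsubD1set _ _) fV.1.
  by rewrite (wall_card fV aV) (wall_card fP sP).
have fPs : face Y (P `\ s).
  split; last by exists P => //; exact: fsubD1set.
  by rewrite -cardfs_gt0 (wall_card fP sP).
have cV' : cc V' y by apply: cc_sub wV' (co_cc cy).
have PP' := cc_face_sub gY ty YP' (inside_cc iV' cV') fPs cPs.
have eP : P' = P.
  apply/esym/eqP; rewrite eqEfcard fP.2 (good_frame gY YP').2 leqnn andbT -(fsetD1K sP).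
  by rewrite fsubUset fsub1set PP' andbT (fsubsetP FP').
rewrite eP in iV'.
have [a' [a'V' e' _]] := wall_other fV fV' aV wV' (fun e => nV (esym e)).
have h1 := wall_opp gX XV XV' (fun e => nV (esym e)) aV a'V' e'.
have := (frame_cc _ fP).1 (iV' a' a'V') s sP.
rewrite -[homog a'](crdK _ fV) crd_sum // (big_fsetD1 a) //=.
rewrite [X in _ + X]big_seq [X in _ + X]big1 => [|v vw]; last first.
  have [_ H] := (frame_ccsub _ fP (fsubD1set P s)).1 (iw v vw).
  by rewrite H ?mulr0 // !inE eqxx.
rewrite addr0 nmulr_rge0 // => h2.
have h0 := (frame_cc _ fP).1 (iV a aV) s sP.
have z : crd P (homog a) s = 0 by apply/eqP; rewrite eq_le h2 h0.
have := crd_homog fP sP sP; rewrite -[homog s](crdK _ fV) crd_sum // (big_fsetD1 a) //=.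
rewrite [X in _ + X]big_seq [X in _ + X]big1 => [|v vw]; last first.
  have [_ H] := (frame_ccsub _ fP (fsubD1set P s)).1 (iw v vw).
  by rewrite H ?mulr0 // !inE eqxx.
by rewrite z mulr0 addr0 eqxx => /eqP; rewrite eq_sym oner_eq0.
Qed.

End Star.
End Fine.
End Refine.

(** * A fine refinement is connected to what it refines *)

Section PairStar.
Variables (R : realType) (M : hyperbolic_manifold R).
Local Notation point := 'rV[R]_3.
Local Notation vec := 'rV[R]_(1 + 3).
Local Notation simplex := {fset 'rV[R]_3}.
Local Notation D := (deck M).
Local Notation orb := (simplex_orbit M).
Local Notation good := (good M).
Local Notation repl := (repl M).
Local Notation sat := (sat M).
Local Notation conn := (conn M).
Local Notation fine := (fine M).
Implicit Types (F G V W U P Q w : simplex) (x y z b : vec) (u v a t s p q : point).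
Implicit Types (g h k : 'M[R]_(1 + 3)) (L X Y : set simplex) (T : {fset simplex}).

Lemma parent_eq X Y V P P' : good X -> good Y -> X V -> Y P -> Y P' ->
  inside V P -> inside V P' -> P = P'.
Proof.
move=> gX gY XV YP YP' iP iP'; have [y cy] := co_ex V.
have ty := tetra_tl (good_tetra gX XV) cy; have [iV cV] := good_frame gX XV.
have up Q : Y Q -> inside V Q -> co Q y.
  move=> YQ iQ; apply: (inside_co (good_frame gY YQ) (fsubset_refl Q) iV _ iQ cy).
  by rewrite cV (good_frame gY YQ).2.
exact: (face_uniq gY ty (face_self gY YP) (face_self gY YP') (up P YP iP) (up P' YP' iP')).
Qed.

Lemma behind_mv g b V V' : D g -> balls V -> balls V' -> behind b V V' ->
  behind (b *m g) (mv g V) (mv g V').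
Proof.
move=> Dg bV bV' [y c1 c2]; exists (y *m g); first exact/(co_mv _ Dg bV).
by rewrite -mulmxBl; apply/(co_mv _ Dg bV').
Qed.

Lemma acyc_mv X P g b : good X -> balls P -> D g ->
  acyc (b *m invmx g) [set V | X V /\ inside V P] -> acyc b [set V | X V /\ inside V (mv g P)].
Proof.
move=> gX bP Dg ac T0 /fset0Pn[V0 V0T] HT.
have Dg' := deckV Dg; have bb V : V \in T0 -> balls V by move=> /HT[XV _]; exact: (good_balls gX XV).
pose T1 := [fset mv (invmx g) V | V in T0].
have [||W /imfsetP[V /= VT eW] HW] := ac T1.
- by apply/fset0Pn; exists (mv (invmx g) V0); apply/imfsetP; exists V0.
- move=> W /imfsetP[V /= VT ->]; have [XV iV] := HT V VT.
  split; first exact: (good_mv gX).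
  by rewrite -(mvK Dg bP); exact: (inside_mv Dg' (bb V VT) (balls_mv Dg bP) iV).
exists V => // V' V'T nV bV; apply: (HW (mv (invmx g) V')).
- by apply/imfsetP; exists V'.
- by rewrite eW => /(mv_inj Dg' (bb _ V'T) (bb _ VT)).
by rewrite eW; exact: (behind_mv Dg' (bb V' V'T) (bb V VT) bV).
Qed.

(* A relation between walls seen from [b] pushes into the tetrahedra behind
   these walls, all lying on the same side of their common plane. *)
Lemma acyc_wall X Y P s b (S : set simplex) : fine X Y -> Y P -> s \in P ->
  (forall w, S w -> exists V a, [/\ X V, a \in V, w = V `\ a, inside V P & inside w (P `\ s)]) ->
  acyc b S.
Proof.
move=> fXY YP sP HS T0 T00 HT.
have [gX gY _ ac] := fXY; have fP := good_frame gY YP.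
pose par w := xget fset0 [set V | exists a, [/\ X V, a \in V, w = V `\ a, inside V P & inside w (P `\ s)]].
have parP w : w \in T0 -> exists a, [/\ X (par w), a \in par w, w = par w `\ a, inside (par w) P & inside w (P `\ s)].
  move=> /HT/HS[V [a Ha]]; rewrite /par; case: xgetP => [V' _ //|/(_ V)]; case.
  by exists a.
have up w y : w \in T0 -> co w y -> evt (fun e => co (par w) (y + e *: homog s)).
  move=> wT cy; have [a [XV aV ew iV iw]] := parP w wT.
  have fV := good_frame gX XV.
  have sw : w `<=` par w by rewrite {1}ew; exact: fsubD1set.
  have [y1 y2] := (frame_cosub y fV sw).1 cy.
  have pos : 0 < crd (par w) (homog s) a.
    have e1 : crd P (homog s) s = crd (par w) (homog s) a * crd P (homog a) s.
      rewrite -[homog s in LHS](crdK _ fV) crd_sum // (big_fsetD1 a) //=.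
      rewrite [X in _ + X]big_seq [X in _ + X]big1 ?addr0 // => v; rewrite -ew => vw.
      have [_ H] := (frame_ccsub _ fP (fsubD1set P s)).1 (iw v vw).
      by rewrite H ?mulr0 // !inE eqxx.
    have a0 := (frame_cc _ fP).1 (iV a aV) s sP.
    have : 0 < crd (par w) (homog s) a * crd P (homog a) s by rewrite -e1 crd_homog // eqxx.
    move=> h; have nz : crd P (homog a) s != 0 by apply: contraTneq h => ->; rewrite mulr0 ltxx.
    by rewrite pmulr_lgt0 // lt_neqAle eq_sym nz in h.
  have := cc_pert (z := homog s) fV (cc_sub sw (co_cc cy)).
  have -> : [fset v in par w | (0 < crd (par w) y v) || (0 < crd (par w) (homog s) v)] = par w.
    apply/fsetP => v; rewrite !inE; case: (boolP (v \in par w)) => //= vV.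
    case: (eqVneq v a) => [->|va]; first by rewrite pos orbT.
    by rewrite y1 // ew !inE va.
  apply=> v vV yv; case: (eqVneq v a) => [->|va]; first exact: ltW.
  by have := y1 v; rewrite {1}ew !inE va vV yv ltxx => /(_ isT).
pose T1 := [fset par w | w in T0].
have [w0 w0T] := fset0Pn _ T00.
have [||V /imfsetP[w /= wT eV] HV] := ac P YP b T1.
- by apply/fset0Pn; exists (par w0); apply/imfsetP; exists w0.
- by move=> V /imfsetP[w /= /parP[a [XV _ _ iV _]] ->].
exists w => // w' w'T nw [y c1 c2]; apply: (HV (par w')).
- by apply/imfsetP; exists w'.
- rewrite eV => e; apply: nw.
  have [a [XV aV ew iV iw]] := parP w wT; have [a' [XV' aV' ew' iV' iw']] := parP w' w'T.
  have fV := good_frame gX XV.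
  case: (eqVneq a a') => [ea|na]; first by rewrite ew' ew e ea.
  exfalso; have : (#|` par w| <= #|` P `\ s|)%N.
    apply: indep_card fV.1 _ => v vV.
    have [f _ ef] : cc (P `\ s) (homog v).
      case: (eqVneq v a) => [->|va]; last by apply: iw; rewrite ew !inE va.
      by apply: iw'; rewrite ew' e !inE na.
    by exists f.
  by rewrite fV.2 (wall_card fP sP).
have [e e0 [h1 h2]] := evt_ex (evtI (up _ _ w'T c1) (up _ _ wT c2)).
by exists (y + e *: homog s) => //; rewrite eV addrAC.
Qed.

(** Projecting along [homog q] to the span of Q turns visibility between cones with apex q into
    visibility between their bases, in the projected direction. *)
Lemma acyc_cone q Q b (S S' : set simplex) : q \notin Q -> frame (q |` Q) ->
  (forall U, S U -> exists2 w, S' w & U = q |` w) -> (forall w, S' w -> inside w Q) ->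
  (forall w, S' w -> q \notin w) ->
  acyc (b - crd (q |` Q) b q *: homog q) S' -> acyc b S.
Proof.
move=> qQ fQ HS HQ HqS ac T0 /fset0Pn[U0 U0T] HT.
have wE U : U \in T0 -> exists2 w, S' w & U = q |` w by move=> /HT/HS.
have wE' U : U \in T0 -> S' (U `\ q) /\ U = q |` (U `\ q).
  by move=> /wE[w Sw ->]; rewrite fsetU1K ?HqS.
pose T1 := [fset U `\ q | U in T0].
have [||w /imfsetP[U /= UT ew] Hw] := ac T1.
- by apply/fset0Pn; exists (U0 `\ q); apply/imfsetP; exists U0.
- by move=> w /imfsetP[U /= /wE'[Sw _] ->].
exists U => // U' U'T nU [y c1 c2]; apply: (Hw (U' `\ q)).
- by apply/imfsetP; exists U'.
- by rewrite ew => e; apply: nU; rewrite (wE' _ UT).2 (wE' _ U'T).2 e.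
have dec U1 z : U1 \in T0 -> co U1 z -> exists2 r, co (U1 `\ q) (z - r *: homog q) & r = crd (q |` Q) z q.
  move=> /wE'[Sw e]; rewrite {1}e => -[f f0 ez].
  have qU : q \in q |` (U1 `\ q) by rewrite !inE eqxx.
  have qn : q \notin U1 `\ q by rewrite !inE eqxx.
  move: ez; rewrite (combD1 _ qU) fsetU1K // => ez.
  exists (f q).
    rewrite ez addrAC subrr add0r; exists f => // v vw; apply: f0.
    by move: vw; rewrite !inE => /andP[vq vU]; rewrite vq vU orbT.
  have qq : q \in q |` Q by rewrite !inE eqxx.
  rewrite ez crdD // crdZ // crd_homog // eqxx mulr1.
  rewrite crd_sum // big_seq big1 ?addr0 // => v vw.
  have [_ H] := (frame_ccsub _ fQ (fsubsetU1 q Q)).1 (HQ _ Sw v vw).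
  by rewrite H ?mulr0 // !inE eqxx.
have [r cr er] := dec _ _ U'T c1; have [r' cr' er'] := dec _ _ UT c2.
exists (y - r *: homog q) => //; rewrite ew; move: cr'.
have qq : q \in q |` Q by rewrite !inE eqxx.
rewrite er' er (crdB _ _ fQ qq).
set c := crd _ y q; set d := crd _ b q.
suff -> : y - b - (c - d) *: homog q = y - c *: homog q - (b - d *: homog q) by [].
rewrite scalerBl !opprB -!addrA; congr (_ + _).
by rewrite addrCA [RHS]addrCA; congr (_ + _); rewrite addrC.
Qed.

Definition old (O : point -> Prop) P : simplex := [fset v in P | `[< O v >]].

(* The situation before the stars of the faces of [Y] of size [n] are starred in both
   triangulations; [O] is the set of the vertices that [Y] had in the beginning. *)
Definition inv (O : point -> Prop) X Y (n : nat) : Prop :=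
  [/\ fine X Y, forall g v, D g -> ball v -> O (act g v) <-> O v,
      forall v, O v -> exists2 P, Y P & v \in P,
      forall P V, Y P -> X V -> inside V P ->
        P `\` old O P `<=` V /\ inside (V `\` (P `\` old O P)) (old O P) &
   [/\ forall P v g, Y P -> v \in P -> ~ O v -> D g -> act g v \in P -> act g v = v
     & forall P, Y P -> (#|` old O P| <= n)%N]].

Lemma old_mv (O : point -> Prop) g P :
  (forall g v, D g -> ball v -> O (act g v) <-> O v) -> D g -> balls P ->
  old O (mv g P) = mv g (old O P).
Proof.
move=> HO Dg bP; apply/fsetP => v; rewrite !inE; apply/andP/imfsetP => /=.
  move=> [/imfsetP[u /= uP ->] /asboolP Ov]; exists u => //; rewrite !inE uP /=.
  by apply/asboolP; exact: (HO g u Dg (bP _ uP)).1 Ov.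
move=> [u]; rewrite !inE => /andP[uP /asboolP Ou] ->; split; first by apply/imfsetP; exists u.
have bu : ball u by exact: bP.
have h2 := (HO g u Dg bu).2 Ou.
exact h2.
Qed.

(** * Starring the star of one face in both triangulations from the same point *)

Section Pair.
Variables (X Y : set simplex) (F : simplex) (T TY : {fset simplex}) (p q : point) (e : R).
Hypotheses (fXY : fine X Y) (fF : face Y F) (cF : (1 < #|` F|)%N).
Hypothesis injF : forall g P, D g -> Y P -> F `<=` P -> F `<=` mv g P -> g = 1%:M.
Hypotheses (Hp : H3 p) (cp : co F (homog p)) (eq : q = curve p e).
Hypothesis HT : forall V, V \in T <-> in_star X Y F V.
Hypothesis HTY : forall V, V \in TY <-> in_star Y Y F V.
Hypotheses (sX : starable M X T q) (sY : starable M Y TY q).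

Local Notation X' := (repl X [set` T] (cone q T)).
Local Notation Y' := (repl Y [set` TY] (cone q TY)).

Let gX : good X. Proof. by case: fXY. Qed.
Let gY : good Y. Proof. by case: fXY. Qed.
Let fYY : fine Y Y := fine_refl gY.
Let Hq : H3 q. Proof. by case: sX. Qed.
Let nX : not_vertex X q := starable_nv sX.
Let nY : not_vertex Y q := starable_nv sY.

Lemma pair_connX : conn X X'. Proof. exact: star_conn. Qed.
Lemma pair_connY : conn Y Y'. Proof. exact: star_conn. Qed.
Let gX' : good X' := conn_good gX pair_connX.
Let gY' : good Y' := conn_good gY pair_connY.

Lemma coneX U : cone q T U <-> exists V a P s, [/\ X V, a \in V, Y P, F `<=` P &
    [/\ s \in F, inside V P, inside (V `\ a) (P `\ s) & U = q |` (V `\ a)]].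
Proof.
have sX' : starable M X T (curve p e) by rewrite -eq.
by have := star_cone fXY HT sX' U; rewrite -eq.
Qed.

Lemma memTY P : P \in TY <-> Y P /\ F `<=` P.
Proof.
split=> [/HTY[YP [P' [YP' FP'] iP]]|[YP FP]].
  by rewrite (parent_eq gY gY YP YP YP' (@inside_self _ P) iP).
by apply/HTY; split=> //; exists P => //; exact: inside_self.
Qed.

Lemma coneY U : cone q TY U <-> exists P s, [/\ Y P, F `<=` P, s \in F & U = q |` (P `\ s)].
Proof.
have sY' : starable M Y TY (curve p e) by rewrite -eq.
have := star_cone fYY HTY sY' U; rewrite -eq => ->; split; last first.
  move=> [P [s [YP FP sF ->]]]; exists P, s, P, s; split=> //; first exact: (fsubsetP FP).
  by split=> //; exact: inside_self.
move=> [V [a [P [s [YV aV YP FP [sF iV iw eU]]]]]].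
have eV := parent_eq gY gY YV YV YP (@inside_self _ V) iV.
have fP := good_frame gY YP; have sP := fsubsetP FP _ sF.
exists P, s; split=> //; rewrite eU eV; congr (_ |` _); congr (_ `\ _).
apply: contrapT => as_; have sV : s \in V `\ a by rewrite !inE eV sP andbT; apply/eqP => /esym.
have [_ H] := (frame_ccsub _ fP (fsubD1set P s)).1 (iw s sV).
by have := H s sP; rewrite !inE eqxx crd_homog // eqxx => /(_ isT)/eqP; rewrite oner_eq0.
Qed.

Lemma pairYP P' : Y' P' -> (Y P' /\ ~ sat [set` TY]%classic P') \/
  exists h P s, [/\ D h, Y P, F `<=` P, s \in F & P' = mv h (q |` (P `\ s))].
Proof.
case=> [[? ?]|[h [U [Dh /coneY[P [s [YP FP sF ->]]] ->]]]]; [by left|right].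
by exists h, P, s.
Qed.

Lemma pairYcone P s : Y P -> F `<=` P -> s \in F -> Y' (q |` (P `\ s)).
Proof. by move=> YP FP sF; right; apply: sat_self; apply/coneY; exists P, s. Qed.

Let nq P : Y P -> q \notin P. Proof. exact: nY. Qed.

Let nYcone h w : D h -> ~ Y (mv h (q |` w)).
Proof.
move=> Dh YU; have Dh' := deckV Dh; have bU := good_balls gY YU.
have := nY (good_mv gY Dh' YU); set U := mv h _ in YU bU *.
have : act h q \in U by apply/imfsetP; exists q; rewrite ?inE ?eqxx.
rewrite -{2}(actK Dh (or_introl Hq)) (mem_mv Dh' bU); first by move=> k1; rewrite k1.
by apply: act_ball; [exact: deck_iso Dh|left].
Qed.

Lemma insideU1 w Q : inside w Q -> inside (q |` w) (q |` Q).
Proof.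
move=> H v; rewrite !inE => /orP[/eqP ->|/H]; first by apply: cc_homog; rewrite !inE eqxx.
by apply: cc_sub; exact: fsubsetU1.
Qed.

Lemma pair_refines : refines X' Y'.
Proof.
have [_ _ rXY _] := fXY.
move=> V [[XV nV]|[g [U [Dg /coneX[V0 [a [P [s [XV0 aV0 YP FP [sF iV iw ->]]]]]] ->]]]].
  have [P YP iV] := rXY V XV; exists P => //; left; split=> //.
  move=> [g [P0 [Dg /= /memTY[YP0 FP0] eP]]]; apply: nV; exists g, (mv (invmx g) V).
  split=> //; last by rewrite (mvKV Dg (good_balls gX XV)).
  apply/HT; split; first by apply: (good_mv gX) XV; exact: deckV.
  exists P0 => //; apply: (inside_mvE Dg); rewrite ?(mvKV Dg (good_balls gX XV)) -?eP //.
    exact: balls_mv (deckV Dg) (good_balls gX XV).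
  exact: (good_balls gY YP0).
have YU := pairYcone YP FP sF.
exists (mv g (q |` (P `\ s))); first exact: (good_mv gY').
have XU : X' (q |` (V0 `\ a)).
  by right; apply: sat_self; apply/coneX; exists V0, a, P, s.
exact: (inside_mv Dg (good_balls gX' XU) (good_balls gY' YU) (insideU1 iw)).
Qed.

(** Parents are unique, so it suffices to exhibit one: the cone over a wall inside a facet of P lies
    in the cone over that facet. *)
Lemma pair_cases V P' : X' V -> Y' P' -> inside V P' ->
  [/\ X V, Y P' & ~ sat [set` TY]%classic P'] \/
  exists h P s V1 a, [/\ D h, Y P, F `<=` P, s \in F & P' = mv h (q |` (P `\ s))] /\
    [/\ X V1, a \in V1, inside V1 P, inside (V1 `\ a) (P `\ s) & V = mv h (q |` (V1 `\ a))].
Proof.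
move=> XV YP' iV; have [_ _ rXY _] := fXY.
case: (XV) => [[XV0 nV]|[g [U [Dg /coneX[V0 [a [P [s [XV0 aV0 YP FP [sF iV0 iw eU]]]]]] eV]]]].
  left; have [P YP iP] := rXY V XV0.
  have YP2 : Y' P.
    left; split=> // -[g [P0 [Dg /= /memTY[YP0 FP0] eP]]]; apply: nV; exists g, (mv (invmx g) V).
    split=> //; last by rewrite (mvKV Dg (good_balls gX XV0)).
    apply/HT; split; first by apply: (good_mv gX) XV0; exact: deckV.
    exists P0 => //; apply: (inside_mvE Dg); rewrite ?(mvKV Dg (good_balls gX XV0)) -?eP //.
      exact: balls_mv (deckV Dg) (good_balls gX XV0).
    exact: (good_balls gY YP0).
  have eP := parent_eq gX' gY' XV YP' YP2 iV iP.
  rewrite eP; case: YP2 => [[? ?]|[h [U [Dh /coneY[P1 [s [YP1 FP1 sF ->]]] e1]]]] //.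
  by exfalso; apply: (@nYcone h (P1 `\ s) Dh); rewrite -e1.
right; exists g, P, s, V0, a; rewrite eV eU; split=> //; split=> //.
have YU := pairYcone YP FP sF; have YgU := good_mv gY' Dg YU.
apply: (parent_eq gX' gY' XV YP' YgU iV); rewrite eV eU.
have XU : X' (q |` (V0 `\ a)).
  by right; apply: sat_self; apply/coneX; exists V0, a, P, s.
exact: (inside_mv Dg (good_balls gX' XU) (good_balls gY' YU) (insideU1 iw)).
Qed.

Lemma pair_fine : fine X' Y'.
Proof.
split=> //; first exact: pair_refines.
have [_ _ _ ac] := fXY.
move=> P' YP' b; case: (pairYP YP') => [[YP nP]|[h [P [s [Dh YP FP sF eP']]]]].
  apply: acyc_sub (ac P' YP b) => V [XV iV].
  case: (pair_cases XV YP' iV) => [[? _ _]//|[h [P [s [V1 [a [[Dh _ _ _ eP] _]]]]]]].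
  by exfalso; apply: (@nYcone h (P `\ s) Dh); rewrite -eP.
have YU := pairYcone YP FP sF; have sP := fsubsetP FP _ sF.
rewrite eP'; apply: acyc_mv => //; first exact: (good_balls gY').
set b1 := b *m _.
pose S' := [set w | exists V a, [/\ X V, a \in V, w = V `\ a, inside V P & inside w (P `\ s)]].
have qP : q \notin P `\ s by rewrite !inE (negbTE (nq YP)) andbF.
apply: (acyc_cone (q := q) (Q := P `\ s) (S' := S')) => //.
- exact: (good_frame gY').
- move=> V [XV iV].
  case: (pair_cases XV YU iV) => [[_ YU' _]|].
    by case: (@nYcone 1%:M (P `\ s) (deck1 M)); rewrite mv1.
  move=> [k [P1 [s1 [V1 [a [[Dk YP1 FP1 sF1 e1] [XV1 aV1 iV1 iw1 eV]]]]]]].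
  have vP : forall v, v \in P `\ s -> exists2 V0, Y V0 & v \in V0.
    by move=> v; rewrite !inE => /andP[_ vP]; exists P.
  have k1 : k = 1%:M by exact: (cone_stab gY Hq nY Dk vP (esym e1)).
  rewrite k1 mv1 in e1; rewrite k1 mv1 in eV.
  have qP1 : q \notin P1 `\ s1 by rewrite !inE (negbTE (nq YP1)) andbF.
  have e2 : P1 `\ s1 = P `\ s by rewrite -(fsetU1K qP1) -e1 fsetU1K.
  have es : s1 = s.
    apply/eqP/contraT => ns; have : s \in P1 `\ s1 by rewrite !inE eq_sym ns (fsubsetP FP1).
    by rewrite e2 !inE eqxx.
  have eP : P1 = P by rewrite -(fsetD1K (fsubsetP FP1 _ sF1)) e2 es fsetD1K.
  exists (V1 `\ a); last exact: eV.
  by exists V1, a; split=> //; [rewrite -eP|rewrite -e2].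
- by move=> w [V [a [_ _ _ _]]].
- move=> w [V [a [XV _ -> _ _]]]; by rewrite !inE (negbTE (nX XV)) andbF.
by apply: (acyc_wall _ fXY YP sP) => w.
Qed.

Section Invariant.
Variable O : point -> Prop.

Hypothesis iv : inv O X Y #|` F|.
Hypothesis FO : forall v, v \in F -> O v.

Let HO : forall g v, D g -> ball v -> O (act g v) <-> O v. Proof. by case: iv. Qed.
Let I1 : forall v, O v -> exists2 P, Y P & v \in P. Proof. by case: iv. Qed.
Let I2 : forall P V, Y P -> X V -> inside V P ->
  P `\` old O P `<=` V /\ inside (V `\` (P `\` old O P)) (old O P).
Proof. by case: iv. Qed.
Let I3 : forall P v g, Y P -> v \in P -> ~ O v -> D g -> act g v \in P -> act g v = v.
Proof. by case: iv => _ _ _ _ []. Qed.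
Let I4 : forall P, Y P -> (#|` old O P| <= #|` F|)%N. Proof. by case: iv => _ _ _ _ []. Qed.

Let oldF P : Y P -> F `<=` P -> old O P = F.
Proof.
move=> YP FP; apply/esym/eqP; rewrite eqEfcard I4 // andbT.
by apply/fsubsetP => v vF; rewrite !inE (fsubsetP FP) //=; apply/asboolP/FO.
Qed.

Let nOq : ~ O q.
Proof. by move=> /I1[P YP qP]; have := nY YP; rewrite qP. Qed.

Let oldcone P s : Y P -> F `<=` P -> s \in F -> old O (q |` (P `\ s)) = F `\ s.
Proof.
move=> YP FP sF; rewrite -(oldF YP FP); apply/fsetP => v; rewrite !inE.
case: (eqVneq v q) => [->|vq] /=.
  rewrite (negbTE (nY YP)) andbF; apply/negbTE/negP => /asboolP; exact: nOq.
by rewrite andbA.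
Qed.

Let bcone P s : Y P -> F `<=` P -> s \in F -> balls (q |` (P `\ s)).
Proof. by move=> YP FP sF; exact: (good_balls gY' (pairYcone YP FP sF)). Qed.

(** A new cell has lost a vertex of F and gained q, which is not old, so its old part is smaller
    than F. *)
Lemma pair_decrease P' : Y' P' -> #|` old O P'| = #|` F| -> Y P' /\ ~ sat [set` TY]%classic P'.
Proof.
move=> /pairYP[//|[h [P [s [Dh YP FP sF ->]]]]].
have bc := bcone YP FP sF; rewrite (old_mv HO Dh bc) oldcone // (card_mv Dh); last first.
  apply: balls_sub bc; rewrite -(oldF YP FP).
  by apply/fsubsetP => v; rewrite !inE => /and3P[-> -> _]; rewrite orbT.
by rewrite (cardfsD1 s F) sF add1n => /n_Sn.
Qed.

Lemma cc_meet P s y : frame P -> F `<=` P -> s \in P -> cc F y -> cc (P `\ s) y -> cc (F `\ s) y.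
Proof.
move=> fP FP sP c1 c2; have sub : F `\ s `<=` P by apply: fsubset_trans FP; exact: fsubD1set.
have [h1 h2] := (frame_ccsub _ fP FP).1 c1.
have [k1 k2] := (frame_ccsub _ fP (fsubD1set P s)).1 c2.
apply/(frame_ccsub _ fP sub); split; first by move=> v; rewrite !inE => /andP[_ /h1].
move=> v vP; rewrite !inE negb_and negbK => /orP[/eqP ->|vF]; last exact: h2.
by apply: k2 => //; rewrite !inE eqxx.
Qed.

Lemma pair_inv : inv O X' Y' #|` F|.
Proof.
split=> //; first exact: pair_fine.
- move=> v Ov; have [P YP vP] := I1 Ov.
  have [[g [P0 [Dg /= /memTY[YP0 FP0] eP]]]|nS] := pselect (sat [set` TY]%classic P); last first.
    by exists P => //; left.
  (* F has at least two vertices, so one of them is not carried to v; the cone that omits it still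
     has v as a vertex. *)
  have [s sF sv] : exists2 s, s \in F & act g s <> v.
    apply: contrapT => H; have all s : s \in F -> act g s = v.
      by move=> sF; apply: contrapT => n; apply: H; exists s.
    move: cF; case: (fset_0Vmem F) => [->|[s1 s1F]]; first by rewrite cardfs0.
    case: (fset_0Vmem (F `\ s1)) => [e0|[s2]]; first by rewrite (cardfsD1 s1) s1F e0 cardfs0.
    rewrite !inE => /andP[s21 s2F] _; move/eqP: s21; apply.
    have bF := face_balls gY fF.
    by apply: (act_inj Dg (bF _ s2F) (bF _ s1F)); rewrite !all.
  exists (mv g (q |` (P0 `\ s))); first exact: (good_mv gY' Dg (pairYcone YP0 FP0 sF)).
  move: vP; rewrite eP => /imfsetP[u /= uP ev]; apply/imfsetP; exists u => //=.
  by rewrite !inE uP andbT; apply/orP; right; apply/eqP => us; apply: sv; rewrite -us.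
- move=> P' V YP' XV iV; case: (pair_cases XV YP' iV) => [[XV0 YP0 nS]|].
    exact: I2.
  move=> [h [P [s [V1 [a [[Dh YP FP sF eP'] [XV1 aV1 iV1 iw eV]]]]]]].
  have [J1 J2] := I2 YP XV1 iV1; rewrite (oldF YP FP) in J1 J2.
  have fP := good_frame gY YP; have fV := good_frame gX XV1; have sP := fsubsetP FP _ sF.
  have bc := bcone YP FP sF.
  have eo : old O P' = mv h (F `\ s) by rewrite eP' (old_mv HO Dh bc) oldcone.
  have bFs : balls (F `\ s) by apply: balls_sub (face_balls gY fF); exact: fsubD1set.
  (* The vertex left out by the wall belongs to the part subdividing F. Otherwise that whole part
     would lie in the facet of F opposite to s, which has too small a dimension. *)
  have aPF : a \notin P `\` F.
    apply/negP => aPF.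
    have : (#|` V1 `\` (P `\` F)| <= #|` F `\ s|)%N.
      apply: indep_card; first by apply: indep_sub fV.1; exact: fsubsetDl.
      move=> v vV; have c1 := J2 v vV.
      have vw : v \in V1 `\ a.
        move: vV; rewrite inE => /andP[vn vV]; rewrite !inE vV andbT.
        by apply: contraNneq vn => ->.
      by have [f _ ef] := cc_meet fP FP sP c1 (iw v vw); exists f.
    rewrite cardfsDS // fV.2 cardfsDS // fP.2 subKn; last first.
      by rewrite -fP.2; exact: fsubset_leq_card.
    by rewrite (cardfsD1 s F) sF add1n ltnn.
  have XU : X' (q |` (V1 `\ a)).
    by right; apply: sat_self; apply/coneX; exists V1, a, P, s.
  have bU := good_balls gX' XU.
  have P'E : P' `\` old O P' = mv h (q |` (P `\` F)).
    rewrite eP' (old_mv HO Dh bc) oldcone //.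
    apply/fsetP => v; rewrite inE; apply/andP/imfsetP => /=.
      move=> [nv /imfsetP[u /= uP ev]]; exists u => //.
      move: uP; rewrite !inE => /orP[->//|/andP[us uP]].
      rewrite uP andbT; apply/orP; right; apply: contra nv => uF.
      by rewrite ev; apply/imfsetP; exists u => //=; rewrite !inE us.
    move=> [u uq ev]; rewrite ev.
    have bu : ball u.
      by move: uq; rewrite !inE => /orP[/eqP ->|/andP[_ /(good_balls gY YP)//]]; left.
    rewrite (mem_mv Dh bFs bu); split.
      move: uq; rewrite !inE => /orP[/eqP ->|/andP[uF _]]; last by rewrite (negbTE uF) andbF.
      by rewrite negb_and; apply/orP; right; apply/negP => /(fsubsetP FP); rewrite (negbTE (nY YP)).
    apply/imfsetP; exists u => //=; move: uq; rewrite !inE => /orP[->//|/andP[uF ->]].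
    by rewrite andbT; apply/orP; right; apply: contraNneq uF => ->.
  split.
    rewrite P'E eV; apply: mv_sub; apply/fsubsetP => v; rewrite !inE.
    move=> /orP[->//|/andP[vF vP]]; apply/orP; right.
    have vPF : v \in P `\` F by rewrite inE vF.
    by rewrite (fsubsetP J1 _ vPF) andbT; apply: contraNneq aPF => <-.
  rewrite P'E eV eo => v; rewrite inE => /andP[nv /imfsetP[u /= uU ev]].
  have bu : ball u := bU _ uU.
  have [c c0 ec] := homog_act (deck_iso Dh) bu.
  have -> : homog v = c^-1 *: (homog u *m h) by rewrite ev ec scalerA mulVf ?scale1r // gt_eqF.
  apply: ccZ; first by rewrite invr_ge0 ltW.
  apply/(cc_mv _ Dh bFs).
  have un : u \notin q |` (P `\` F).
    by apply: contra nv => un; rewrite ev; apply/imfsetP; exists u.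
  have uw : u \in V1 `\ a.
    by move: uU un; rewrite !inE => /orP[/eqP ->|//]; rewrite eqxx.
  apply: (cc_meet fP FP sP) (iw u uw); apply: J2.
  by move: un uw; rewrite !inE !negb_or => /andP[_ ->] /andP[_ ->].
split; last first.
  move=> P' YP'; case: (pairYP YP') => [[YP _]|[h [P [s [Dh YP FP sF ->]]]]]; first exact: I4.
  rewrite (old_mv HO Dh (bcone YP FP sF)) oldcone // (card_mv Dh).
    by apply: fsubset_leq_card; exact: fsubD1set.
  by apply: balls_sub (face_balls gY fF); exact: fsubD1set.
have key P s v g : Y P -> F `<=` P -> s \in F -> v \in q |` (P `\ s) -> ~ O v -> D g ->
    act g v \in q |` (P `\ s) -> act g v = v.
  move=> YP FP sF; rewrite !inE => /orP[/eqP ->|/andP[vs vP]] nOv Dg.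
    move=> /orP[/eqP//|/andP[_ gqP]]; exfalso.
    have Dg' := deckV Dg; have := nY (good_mv gY Dg' YP).
    rewrite -{1}(actK Dg (or_introl Hq)) (mem_mv Dg' (good_balls gY YP)) ?gqP //.
    by apply: act_ball; [exact: deck_iso Dg|left].
  move=> /orP[/eqP eqv|/andP[_ gvP]]; last exact: (I3 YP vP nOv Dg gvP).
  exfalso; have := nY (good_mv gY Dg YP).
  by rewrite -eqv (mem_mv Dg (good_balls gY YP) (good_balls gY YP vP)) vP.
move=> P' v g YP' vP' nOv Dg gvP'.
case: (pairYP YP') => [[YP _]|[h [P [s [Dh YP FP sF eP']]]]]; first exact: (I3 YP vP' nOv Dg gvP').
have bc := bcone YP FP sF.
move: vP' gvP'; rewrite eP' => /imfsetP[v0 /= v0P ev] /imfsetP[v1 /= v1P ev1].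
have b0 := bc _ v0P; have b1 := bc _ v1P.
have Dh' := deckV Dh.
have bhv0 : ball (act h v0) by apply: act_ball => //; exact: deck_iso Dh.
have e1 : act (h *m g *m invmx h) v0 = v1.
  rewrite (act_mul _ (deck_iso (deckM Dh Dg)) b0) (act_mul _ (deck_iso Dh) b0) -ev ev1.
  by rewrite (actK Dh b1).
have nO0 : ~ O v0.
  move=> Ov0; apply: nOv; rewrite ev; have h2 := (HO Dh b0).2 Ov0; exact h2.
have Dk : D (h *m g *m invmx h) by apply: deckM => //; exact: deckM.
have := key P s v0 _ YP FP sF v0P nO0 Dk; rewrite e1 => /(_ v1P) e2.
by rewrite ev1 e2 -ev.
Qed.

End Invariant.

End Pair.

(** Since n is maximal, every cell containing F has old part exactly F. So if F lies in both P and
    [mv g P], then g stabilises F and is trivial, and the star of F can be starred in the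
    quotient. *)
Lemma inv_step O X Y n P0 : inv O X Y n -> (1 < n)%N -> Y P0 -> #|` old O P0| = n ->
  exists X' Y', [/\ inv O X' Y' n, conn X X', conn Y Y' &
    forall P', Y' P' -> #|` old O P'| = n -> Y P' /\ orb P' <> orb P0].
Proof.
move=> iv n1 YP0 eF; set F := old O P0 in eF.
have [fXY HO _ _ [_ I4]] := iv; have [gX gY _ _] := fXY.
have FP0 : F `<=` P0 by apply/fsubsetP => v; rewrite !inE => /andP[].
have cF : (1 < #|` F|)%N by rewrite eF.
have fF : face Y F by split; [rewrite -cardfs_gt0 ltnW|exists P0].
have FO v : v \in F -> O v by rewrite !inE => /andP[_ /asboolP].
have oldF P : Y P -> F `<=` P -> old O P = F.
  move=> YP FP; apply/esym/eqP; rewrite eqEfcard eF I4 // andbT.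
  by apply/fsubsetP => v vF; rewrite !inE (fsubsetP FP) //=; apply/asboolP/FO.
have injF g P : D g -> Y P -> F `<=` P -> F `<=` mv g P -> g = 1%:M.
  move=> Dg YP FP FgP; apply: (face_stab gY Dg fF cF).
  by rewrite -{1}(oldF P YP FP) -(old_mv HO Dg (good_balls gY YP)) oldF //; exact: (good_mv gY).
have [y cy] := co_ex F; have ty := co_tl (face_balls gY fF) (face_indep gY fF) cF cy.
have [Hp ep] := tl_pt ty.
have cp : co F (homog (pt y)) by rewrite ep; apply: coZ => //; rewrite invr_gt0 ty.1.
have [T HT] := in_star_finite fXY fF cF.
have [TY HTY] := in_star_finite (fine_refl gY) fF cF.
have [e e0 [sX sY]] := evt_ex (evtI (star_ready fXY fF cF injF Hp cp HT)
  (star_ready (fine_refl gY) fF cF injF Hp cp HTY)).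
rewrite -eF in iv.
exists (repl X [set` T]%classic (cone (curve (pt y) e) T)), (repl Y [set` TY]%classic (cone (curve (pt y) e) TY)).
split.
- by rewrite -eF; exact: (pair_inv fXY fF cF erefl HT HTY sX sY iv FO).
- exact: star_conn.
- exact: star_conn.
move=> P'; rewrite -eF => YP' oP'.
have [YP nS] := pair_decrease fXY erefl HTY sY iv FO YP' oP'; split=> //.
move=> /(orb_eq _ _ (good_balls gY YP0))[g Dg e1]; apply: nS; exists g, P0; split=> //=.
by apply/(memTY fXY HTY).
Qed.

Definition nodup (L : set simplex) : Prop := forall P v g, L P -> v \in P -> D g ->
  act g v \in P -> act g v = v.

(** Induction on the number of orbits of cells whose old part has the maximal size: each step
    removes one orbit and adds none. Stars of single vertices are left alone, as these may be
    ideal. *)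
Lemma inv_down O X Y n : inv O X Y n.+1 -> (0 < n)%N ->
  exists X' Y', [/\ inv O X' Y' n, conn X X' & conn Y Y'].
Proof.
move=> iv n0.
pose S (Z : set simplex) : set (set simplex) := (orb @` [set P : simplex | Z P /\ #|` old O P| = n.+1])%classic.
have [A HA] : exists A : {fset set simplex}, forall o, S Y o -> o \in A.
  have [[_ gY _ _] _ _ _ _] := iv; case: gY => _ _ fY _ _.
  have [A HA] := fset_of_finite fY; exists A => o [P [YP _] <-]; apply/HA; by exists P.
have := leqnn #|` A|; move: {2}(#|` A|) => m; elim: m A X Y iv HA => [|m IH] A X Y iv HA cA.
  exists X, Y; split; [|exact: conn_refl|exact: conn_refl].
  have [f HO I1 I2 [I3 I4]] := iv; split=> //; split=> // P YP.
  have := I4 P YP; rewrite leq_eqVlt => /orP[/eqP e|//].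
  have /HA : S Y (orb P) by exists P.
  by move: cA; rewrite leqn0 cardfs_eq0 => /eqP ->.
have [[P0 [YP0 e0]]|H] := pselect (exists P0, Y P0 /\ #|` old O P0| = n.+1); last first.
  exists X, Y; split; [|exact: conn_refl|exact: conn_refl].
  have [f HO I1 I2 [I3 I4]] := iv; split=> //; split=> // P YP.
  have := I4 P YP; rewrite leq_eqVlt => /orP[/eqP e|//].
  by case: H; exists P.
have [X1 [Y1 [iv1 c1 c2 H1]]] := inv_step iv (n0 : (1 < n.+1)%N) YP0 e0.
have o0 : orb P0 \in A by apply: HA; exists P0.
have [|| X2 [Y2 [iv2 c3 c4]]] := IH (A `\ orb P0) X1 Y1 iv1.
- move=> o [P' [YP' oP'] <-]; have [YP nP] := H1 P' YP' oP'.
  by rewrite !inE; apply/andP; split; [exact/eqP|apply: HA; exists P'].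
- by move: cA; rewrite (cardfsD1 (orb P0)) o0 add1n.
by exists X2, Y2; split=> //; [exact: conn_trans c1 c3|exact: conn_trans c2 c4].
Qed.

Theorem refine_conn X Y : fine X Y -> exists Z, [/\ good Z, nodup Z, conn X Z & conn Y Z].
Proof.
move=> fXY; have [gX gY rXY _] := fXY.
pose O v := exists2 P, Y P & v \in P.
have oldE P : Y P -> old O P = P.
  by move=> YP; apply/fsetP => v; rewrite !inE; case: (boolP (v \in P)) => //= vP; apply/asboolP; exists P.
have iv : inv O X Y 4.
  split=> //.
  - move=> g v Dg bv; split=> -[P YP vP].
      exists (mv (invmx g) P); first by apply: (good_mv gY) YP; exact: deckV.
      by rewrite -(actK Dg bv); apply/imfsetP; exists (act g v).
    by exists (mv g P); [exact: (good_mv gY)|apply/imfsetP; exists v].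
  - move=> P V YP XV iV; rewrite oldE // fsetDv; split; first exact: fsub0set.
    by rewrite fsetD0.
  - split; first by move=> P v g YP vP nO; case: nO; exists P.
    by move=> P YP; rewrite oldE // (good_frame gY YP).2.
have [X1 [Y1 [iv1 c1 d1]]] := inv_down iv isT.
have [X2 [Y2 [iv2 c2 d2]]] := inv_down iv1 isT.
have [X3 [Y3 [iv3 c3 d3]]] := inv_down iv2 isT.
have [f3 HO I1 I2 [I3 I4]] := iv3; have [gX3 gY3 r3 _] := f3.
(* At most one vertex of P is old, and a vertex cannot be subdivided: V contains the new vertices of
   P, and its remaining vertex lies on the ray over the old one. *)
have e V P : X3 V -> Y3 P -> inside V P -> V = P.
  move=> XV YP iV; have [J1 J2] := I2 P V YP XV iV.
  have fV := good_frame gX3 XV; have fP := good_frame gY3 YP.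
  suff PV : P `<=` V by apply/esym/eqP; rewrite eqEfcard PV fV.2 fP.2.
  have oP : old O P `<=` P by apply/fsubsetP => v; rewrite !inE => /andP[].
  have [e0|[r0 rin]] := fset_0Vmem (old O P); first by rewrite e0 fsetD0 in J1.
  have e1 : old O P = [fset r0].
    by apply/esym/eqP; rewrite eqEfcard fsub1set rin cardfs1 I4.
  rewrite e1 in J1 J2 oP; have oP' : r0 \in P by rewrite -fsub1set.
  have : #|` V `\` (P `\` [fset r0])| = 1%N.
    rewrite cardfsDS // fV.2 cardfsDS // fP.2 cardfs1 //.
  move=> /eqP/cardfs1P[u eu].
  have uV : u \in V `\` (P `\` [fset r0]) by rewrite eu inE.
  have [w _] := J2 u uV; rewrite comb_set1 => /homog_scale e2.
  rewrite -(fsetD1K oP') fsubUset J1 andbT fsub1set -e2.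
  by move: uV; rewrite inE => /andP[].
exists X3; split=> //.
(* New vertices are handled by the invariant; translates of old vertices are old, and a cell has at
   most one of these. *)
- move=> P v g XP vP Dg gvP; have [Q YQ iQ] := r3 P XP.
  have eP := e P Q XP YQ iQ; rewrite -eP in YQ.
  have [Ov|nO] := pselect (O v); last exact: (I3 P).
  have bv := good_balls gX3 XP vP.
  have Ogv : O (act g v) by apply/(HO g v Dg bv).
  have [v1 v2] : v \in old O P /\ act g v \in old O P.
    by split; rewrite !inE ?vP ?gvP; apply/asboolP.
  have := I4 P YQ; rewrite (cardfsD1 v) v1 add1n ltnS leqn0 cardfs_eq0 => /eqP e0.
  apply/eqP/contraT => n; have : act g v \in old O P `\ v by rewrite !inE in v2 *; rewrite n.
  by rewrite e0 inE.
- exact: conn_trans c1 (conn_trans c2 c3).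
suff -> : X3 = Y3 by exact: conn_trans d1 (conn_trans d2 d3).
apply/seteqP; split=> P.
  by move=> XP; have [Q YQ iQ] := r3 P XP; rewrite (e P Q).
move=> YP; have [y cy] := co_ex P; have ty := tetra_tl (good_tetra gY3 YP) cy.
have [V XV cV] := cell_at f3 ty; have iV := inside_of f3 XV YP cV cy.
by rewrite -(e V P).
Qed.

End PairStar.

(** * Cutting along planes *)

Section Cut.
Variables (R : realType) (M : hyperbolic_manifold R).
Local Notation point := 'rV[R]_3.
Local Notation vec := 'rV[R]_(1 + 3).
Local Notation simplex := {fset 'rV[R]_3}.
Local Notation D := (deck M).
Local Notation good := (good M).
Local Notation repl := (repl M).
Local Notation sat := (sat M).
Local Notation fine := (fine M).
Local Notation nodup := (nodup M).
Implicit Types (F G V W U P Q w : simplex) (x y z b : vec) (u v a c t s p q : point).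
Implicit Types (g h k : 'M[R]_(1 + 3)) (L X Y : set simplex) (T : {fset simplex}).

(** Lexicographic order: first by the cells [par V], then inside one of them. *)
Lemma acyc_fiber b (S S' : set simplex) (par : simplex -> simplex) :
  (forall V, S V -> S' (par V)) -> (forall V y, S V -> co V y -> co (par V) y) ->
  acyc b S' -> (forall P, S' P -> acyc b [set V | S V /\ par V = P]) -> acyc b S.
Proof.
move=> H1 H2 ac acP T0 /fset0Pn[V0 V0T] HT.
have [||P PQ HP] := ac [fset par V | V in T0].
- by apply/fset0Pn; exists (par V0); apply/imfsetP; exists V0.
- by move=> P /imfsetP[V /= VT ->]; apply/H1/HT.
have [V1 /= V1T eP] := imfsetP _ _ _ _ PQ.
have [|||V VT HV] := acP P _ [fset V in T0 | par V == P].
- by rewrite eP; apply/H1/HT.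
- by apply/fset0Pn; exists V1; rewrite !inE V1T eP eqxx.
- by move=> V; rewrite !inE => /andP[VT /eqP e]; split=> //; exact: HT.
move: VT; rewrite !inE => /andP[VT /eqP eV]; exists V => // V' V'T nV bV.
have [e|ne] := pselect (par V' = P).
  by apply: (HV V' _ nV bV); rewrite !inE V'T e eqxx.
apply: (HP (par V') _ ne); first by apply/imfsetP; exists V'.
have [y c1 c2] := bV; exists y; first exact: H2 (HT _ V'T) c1.
by rewrite -eV; exact: H2 (HT _ VT) c2.
Qed.

Lemma acyc_one b (S : set simplex) V : (forall U, S U -> U = V) -> acyc b S.
Proof.
move=> H T0 /fset0Pn[U UT] HT; exists U => // U' U'T; case.
by rewrite (H U (HT _ UT)) (H U' (HT _ U'T)).
Qed.

Lemma acyc_two b (S : set simplex) U1 U2 : (forall U, S U -> U = U1 \/ U = U2) ->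
  ~ (behind b U1 U2 /\ behind b U2 U1) -> acyc b S.
Proof.
move=> H nb T0 /fset0Pn[U UT] HT.
have [[h1 h2]|h] := pselect (U1 \in T0 /\ ~ behind b U2 U1).
  by exists U1 => // V' V'T nV; case: (H V' (HT _ V'T)) => // ->.
have [h2|h2] := boolP (U2 \in T0).
  exists U2 => // V' V'T nV bV; case: (H V' (HT _ V'T)) => // e.
  rewrite e in V'T bV; apply: nb; split=> //; apply: contrapT => n; apply: h; by split.
exists U => // V' V'T nV _; case: (H V' (HT _ V'T)) => e; last by rewrite -e V'T in h2.
by case: (H U (HT _ UT)) => e'; [apply: nV; rewrite e e'|rewrite -e' UT in h2].
Qed.

Lemma fine_trans X' X Y : fine X' X -> fine X Y -> fine X' Y.
Proof.
move=> [gX' gX r1 a1] [_ gY r2 a2]; split=> //.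
  move=> U /r1[V XV iV]; have [P YP iP] := r2 V XV; exists P => // u /iV; exact: cc_trans.
move=> P YP b; pose par U := xget fset0 [set V : simplex | X V /\ inside U V].
have parP U : X' U -> X (par U) /\ inside U (par U).
  by move=> /r1[V XV iV]; rewrite /par; case: xgetP => [V' _ //|/(_ V)]; case.
apply: (acyc_fiber (S' := [set V : simplex | X V /\ inside V P]) (par := par)) => //.
- move=> U [XU iU]; have [XV iV] := parP U XU; split=> //.
  have [P' YP' iP'] := r2 _ XV.
  by rewrite (parent_eq gX' gY XU YP YP' iU) // => u /iV; exact: cc_trans.
- move=> U y [XU iU]; have [XV iV] := parP U XU.
  apply: (inside_co (good_frame gX XV)) => //; first exact: (good_frame gX' XU).1.
  by rewrite (good_frame gX' XU).2 (good_frame gX XV).2.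
- exact: a2.
move=> V [XV _]; apply: acyc_sub (a1 V XV b) => U [[XU _] <-].
by split=> //; have [] := parP U XU.
Qed.

(** The carrier of y and its translate are both faces of P, so by [nodup] g fixes every vertex of
    the carrier. It then stabilises a face with several vertices or fixes the timelike vector y up
    to scaling. *)
Lemma nodup_stab L P y g : good L -> nodup L -> L P -> tl y -> D g -> cc P y -> cc P (y *m g) ->
  g = 1%:M.
Proof.
move=> gL nL LP ty Dg c1 c2; have [F fF cF] := carrier gL ty.
have bF := face_balls gL fF.
have tyg : tl (y *m g) by apply: iso_tl ty; exact: deck_iso Dg.
have FP := cc_face_sub gL ty LP c1 fF cF.
have cgF : co (mv g F) (y *m g) by apply/(co_mv _ Dg bF).
have gFP := cc_face_sub gL tyg LP c2 (face_mv gL Dg fF) cgF.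
have fx r : r \in F -> act g r = r.
  move=> rF; apply: (nL P r g LP (fsubsetP FP _ rF) Dg).
  by apply: (fsubsetP gFP); apply/imfsetP; exists r.
have eF : mv g F = F.
  apply/fsetP => r; apply/imfsetP/idP => /= [[u uF ->]|rF]; first by rewrite fx.
  by exists r => //; rewrite fx.
have [c1F|] := boolP (1 < #|` F|)%N; first by have s := face_stab gL Dg fF c1F eF.
rewrite -leqNgt => cF1; have [F0 _] := fF; have [r rF] := fset0Pn _ F0.
have e1 : F = [fset r].
  by apply/esym/eqP; rewrite eqEfcard fsub1set rF cardfs1.
move: cF; rewrite {1}e1 => -[w _]; rewrite comb_set1 => ey.
have [m _ em] := homog_act (deck_iso Dg) (bF r rF); rewrite fx // in em.
by apply: (fix_tl (k := m) Dg ty); rewrite ey -scalemxAl em scalerA mulrC -scalerA.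
Qed.

Lemma frame_swap V a p : frame V -> a \in V -> crd V (homog p) a != 0 -> frame (p |` (V `\ a)).
Proof.
move=> fV aV na; have pV : p \notin V `\ a.
  apply: contra na; rewrite !inE => /andP[pa pV].
  by rewrite crd_homog // [a == p]eq_sym (negbTE pa).
split; last by rewrite cardfsU1 pV (wall_card fV aV).
move=> w; have pW : p \in p |` (V `\ a) by rewrite !inE eqxx.
rewrite (combD1 _ pW) fsetU1K // => e.
have w0 : w p = 0.
  have : crd V (w p *: homog p + comb (V `\ a) w) a = 0.
    by rewrite e -(scale0r 0) crdZ // mul0r.
  rewrite crdD // crdZ // crd_sum // big_seq big1 ?addr0 => [|v].
    by move/eqP; rewrite mulf_eq0 (negbTE na) orbF => /eqP.
  by rewrite !inE => /andP[va vV]; rewrite crd_homog // eq_sym (negbTE va) mulr0.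
rewrite w0 scale0r add0r in e => v; rewrite !inE => /orP[/eqP -> //|vw].
by apply: (indep_sub (fsubD1set V a) fV.1 e); rewrite !inE.
Qed.

(** * Splitting an edge at an interior point *)

Section SplitEdge.
Variables (a c p : point) (m n : R).
Hypotheses (ac : a != c) (m0 : 0 < m) (n0 : 0 < n) (ep : homog p = m *: homog a + n *: homog c).

Lemma split_crd V v : frame V -> a \in V -> c \in V -> v \in V ->
  crd V (homog p) v = m *+ (v == a) + n *+ (v == c).
Proof.
by move=> fV aV cV vV; rewrite ep crdD // !crdZ // !crd_homog // !mulr_natr.
Qed.

Lemma split_crda V : frame V -> a \in V -> c \in V -> crd V (homog p) a = m.
Proof. by move=> fV aV cV; rewrite split_crd // eqxx (negbTE ac) addr0. Qed.

Lemma split_crdc V : frame V -> a \in V -> c \in V -> crd V (homog p) c = n.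
Proof. by move=> fV aV cV; rewrite split_crd // eqxx eq_sym (negbTE ac) add0r. Qed.

Lemma split_frame V : frame V -> a \in V -> c \in V -> frame (p |` (V `\ a)).
Proof. by move=> fV aV cV; apply: frame_swap => //; rewrite split_crda // gt_eqF. Qed.

Lemma split_notin V : frame V -> a \in V -> c \in V -> p \notin V.
Proof.
move=> fV aV cV; apply/negP => pV.
have := split_crda fV aV cV; have := split_crdc fV aV cV; rewrite !crd_homog //.
case: eqVneq => [e1 _|_ e]; last by move: n0; rewrite -e ltxx.
case: eqVneq => [e2 _|_ e]; last by move: m0; rewrite -e ltxx.
by move: ac; rewrite e1 e2 eqxx.
Qed.

(** The left hand side is the equation of the cutting plane, spanned by p and the vertices of V
    other than a and c, evaluated in the half of V without a. *)
Lemma split_phi V f : frame V -> a \in V -> c \in V ->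
  crd V (comb (p |` (V `\ a)) f) a * n - crd V (comb (p |` (V `\ a)) f) c * m = - (m * f c).
Proof.
move=> fV aV cV; have pW : p \in p |` (V `\ a) by rewrite !inE eqxx.
have pn : p \notin V `\ a by rewrite !inE (negbTE (split_notin fV aV cV)) andbF.
have cw : c \in V `\ a by rewrite !inE eq_sym ac.
rewrite (combD1 _ pW) fsetU1K // (combD1 _ cw) !crdD // !crdZ // split_crda // split_crdc //.
rewrite !crd_homog // eqxx (negbTE ac).
have H u : u = a \/ u = c -> u \in V -> crd V (comb (V `\ a `\ c) f) u = 0.
  move=> uac uV; rewrite crd_sum // big_seq big1 // => v; rewrite !inE => /and3P[vc va vV].
  rewrite crd_homog //; case: eqVneq => [e|_]; last by rewrite mulr0.
  by case: uac => e'; move: va vc; rewrite -e e' eqxx.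
rewrite (H a (or_introl erefl) aV) (H c (or_intror erefl) cV) /=; ring.
Qed.

Lemma split_cc V y : frame V -> a \in V -> c \in V -> cc V y -> crd V y a * n <= crd V y c * m ->
  cc (p |` (V `\ a)) y.
Proof.
move=> fV aV cV /(frame_cc _ fV) H le; set W := p |` _.
have pW : p \in W by rewrite !inE eqxx.
have pn : p \notin V `\ a by rewrite !inE (negbTE (split_notin fV aV cV)) andbF.
have cw : c \in V `\ a by rewrite !inE eq_sym ac.
pose f v := if v == p then crd V y a / m else if v == c then crd V y c - n * (crd V y a / m) else crd V y v.
exists f => [v|].
  rewrite /f; case: eqP => [_ _|/eqP vp]; first by rewrite divr_ge0 ?H // ltW.
  case: eqP => [_ _|_]; last by rewrite !inE (negbTE vp) => /andP[_ /H].
  by rewrite subr_ge0 mulrA ler_pdivrMr // mulrC.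
rewrite (combD1 _ pW) fsetU1K // (combD1 _ cw) -{1}[y](crdK _ fV) (combD1 _ aV) (combD1 _ cw).
have -> : comb (V `\ a `\ c) f = comb (V `\ a `\ c) (crd V y).
  apply: eq_comb => v; rewrite !inE => /and3P[vc va vV]; rewrite /f (negbTE vc).
  by case: eqP => // e; move: pn; rewrite !inE -e va vV.
rewrite /f eqxx; case: (eqVneq c p) => [e|_]; first by move: pn; rewrite -e cw.
rewrite eqxx !addrA; congr (_ + _); rewrite ep scalerDr !scalerA divfK ?gt_eqF // -addrA; congr (_ + _).
by rewrite -scalerDl; congr (_ *: _); rewrite mulrC addrC subrK.
Qed.

Lemma split_carrier F y : p \in F -> co F y -> co ([fset a; c] `|` (F `\ p)) y.
Proof.
move=> pF [f f0 ->]; rewrite (combD1 _ pF); apply: coD; last first.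
  by exists f => // v; rewrite !inE => /andP[_ /f0].
apply: coZ; first exact: f0.
exists (fun v => if v == a then m else n) => [v _|]; first by case: ifP.
have aA : a \in [fset a; c] by rewrite !inE eqxx.
rewrite (combD1 _ aA) eqxx ep; congr (_ + _).
have -> : [fset a; c] `\ a = [fset c].
  by apply/fsetP => v; rewrite !inE; case: eqVneq => //= ->; rewrite (negbTE ac).
by rewrite comb_set1 eq_sym (negbTE ac).
Qed.

Lemma split_inside V : a \in V -> c \in V -> inside (p |` (V `\ a)) V.
Proof.
move=> aV cV v; rewrite !inE => /orP[/eqP ->|/andP[_ vV]]; last exact: cc_homog.
by rewrite ep; apply: ccD; apply: ccZ; rewrite ?(ltW m0) ?(ltW n0) //; exact: cc_homog.
Qed.

End SplitEdge.

Section Split.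
Variables (X L : set simplex) (a c p : point) (m n : R) (T : {fset simplex}).
Hypotheses (fXL : fine X L) (nL : nodup L).
Hypotheses (ac : a != c) (m0 : 0 < m) (n0 : 0 < n) (ep : homog p = m *: homog a + n *: homog c).
Hypothesis HT : forall V, V \in T <-> [/\ X V, a \in V & c \in V].
Variables (V0 : simplex) (V0T : V0 \in T).

Let gX : good X. Proof. by case: fXL. Qed.
Let gL : good L. Proof. by case: fXL. Qed.
Let ca : c != a. Proof. by rewrite eq_sym. Qed.
Let ep' : homog p = n *: homog c + m *: homog a. Proof. by rewrite addrC. Qed.
Let fr V : V \in T -> [/\ frame V, a \in V & c \in V].
Proof. by move=> /HT[/(good_frame gX)]. Qed.

Let frp V : V \in T -> frame (p |` (V `\ a)) /\ frame (p |` (V `\ c)).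
Proof.
move=> /fr[fV aV cV]; split; first exact: (split_frame ac m0 ep).
exact: (split_frame ca n0 ep').
Qed.

Let co_e : co [fset a; c] (homog p).
Proof.
have := split_carrier ac m0 n0 ep (F := [fset p]) (y := homog p).
rewrite inE eqxx => /(_ isT); have -> : [fset p] `\ p = fset0 :> simplex.
  by apply/fsetP => v; rewrite !inE andNb.
by rewrite fsetU0; apply; exists (fun=> 1) => //; rewrite comb_set1 scale1r.
Qed.

Let sub_e V : a \in V -> c \in V -> [fset a; c] `<=` V.
Proof. by move=> aV cV; apply/fsubsetP => v; rewrite !inE => /orP[/eqP->|/eqP->]. Qed.

Let tp : tl (homog p).
Proof.
have [XV aV cV] := (HT V0).1 V0T; apply: co_tl co_e.
- by apply: balls_sub (good_balls gX XV); exact: sub_e.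
- by apply: indep_sub (good_frame gX XV).1; exact: sub_e.
- by rewrite cardfs2 ac.
Qed.

Let bp : ball p. Proof. by left; apply/H3E. Qed.

Let inj g V : D g -> V \in T -> mv g V \in T -> g = 1%:M.
Proof.
move=> Dg VT gVT; have [XV _ _] := (HT V).1 VT.
have Dg' := deckV Dg; have bV := good_balls gX XV.
have [_ _ rXL _] := fXL; have [P LP iV] := rXL V XV.
have cV U : U \in T -> cc U (homog p).
  by move=> /HT[_ aU cU]; apply: cc_sub (co_cc co_e); exact: sub_e.
have e : invmx g = 1%:M.
  apply: (nodup_stab gL nL LP tp Dg'); apply: (inside_cc iV); first exact: cV.
  by rewrite -{1}(mvK Dg bV); apply/(cc_mv _ Dg' (balls_mv Dg bV)); exact: cV.
by rewrite -[LHS]mulmx1 -e mulmxV // (deck_unit Dg).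
Qed.

Definition split_tets : {fset simplex} :=
  [fset p |` (V `\ a) | V in T] `|` [fset p |` (V `\ c) | V in T].
Local Notation T' := split_tets.
Local Notation X' := (repl X [set` T]%classic [set` T']%classic).

Let memT' U : U \in T' <-> exists2 V, V \in T & U = p |` (V `\ a) \/ U = p |` (V `\ c).
Proof.
rewrite inE; split.
  by move=> /orP[/imfsetP[V /= VT ->]|/imfsetP[V /= VT ->]]; exists V; auto.
move=> [V VT [->|->]]; apply/orP; [left|right]; apply/imfsetP; by exists V.
Qed.

Let T'in U : U \in T' -> exists2 V, V \in T & inside U V /\ U `<=` p |` V.
Proof.
move=> /memT'[V VT h]; exists V => //; have [_ aV cV] := fr VT.
case: h => ->; split; try by apply: fsetUS; exact: fsubD1set.
  exact: (split_inside m0 n0 ep).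
exact: (split_inside n0 m0 ep').
Qed.

Let facep F V y : tl y -> V \in T -> F `<=` p |` V -> p \in F -> co F y ->
  face X ([fset a; c] `|` (F `\ p)) /\ co ([fset a; c] `|` (F `\ p)) y.
Proof.
move=> ty VT FV pF cF; have [XV aV cV] := (HT V).1 VT; split; last exact: (split_carrier ac m0 n0 ep).
split; first by apply/fset0Pn; exists a; rewrite !inE eqxx.
exists V => //; rewrite fsubUset sub_e //=; apply/fsubsetP => v; rewrite !inE => /andP[vp vF].
by have := fsubsetP FV _ vF; rewrite !inE (negbTE vp).
Qed.

Let facen F U y : U \in T' -> F != fset0 -> F `<=` U -> p \notin F ->
  face X F /\ exists2 d, d \in [fset a; c] & d \notin F.
Proof.
move=> /memT'[V VT h] F0 FU pF; have [XV aV cV] := (HT V).1 VT.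
have H d : F `<=` p |` (V `\ d) -> F `<=` V `\ d.
  move=> FU'; apply/fsubsetP => v vF; have := fsubsetP FU' _ vF; rewrite in_fset1U.
  by case: eqP => // e; move: pF; rewrite -e vF.
have H2 d : F `<=` V `\ d -> face X F /\ d \notin F.
  move=> Fd; split; first by split=> //; exists V => //; apply: fsubset_trans Fd (fsubD1set _ _).
  by apply/negP => /(fsubsetP Fd); rewrite !inE eqxx.
case: h => e; rewrite e in FU; have [f nd] := H2 _ (H _ FU); split=> //.
  by exists a; rewrite // !inE eqxx.
by exists c; rewrite // !inE eqxx orbT.
Qed.

Let uniqA d d' F G V y : V \in T -> F `<=` p |` (V `\ d) -> G `<=` p |` (V `\ d') ->
  d = a \/ d = c -> d' = a \/ d' = c -> co F y -> co G y -> F = G.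
Proof.
move=> VT FV GV hd hd' cF cG; have [fV aV cV] := fr VT; have [f1 f2] := frp VT.
wlog : d d' F G FV GV hd hd' cF cG / d = a.
  move=> W; case: (hd) => e; first exact: (W d d' F G).
  case: (hd') => e'; first by apply/esym; exact: (W d' d G F).
  rewrite e in FV; rewrite e' in GV; exact: (co_sub_uniq f2 FV GV cF cG).
move=> e; rewrite e in FV; case: hd' => e'; rewrite e' in GV.
  exact: (co_sub_uniq f1 FV GV cF cG).
have cF' := cF; have cG' := cG.
move: cF' cG' => /(frame_cosub _ f1 FV)[h1 h2] /(frame_cosub _ f2 GV)[k1 k2].
(* The equations of the cutting plane from the two halves have opposite signs, so y lies on the
   plane, and its carrier belongs to both halves. *)
have := split_phi ac m0 n0 ep (crd (p |` (V `\ a)) y) fV aV cV.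
have := split_phi ca n0 m0 ep' (crd (p |` (V `\ c)) y) fV cV aV.
rewrite (crdK _ f1) (crdK _ f2) => E1 E2.
have cW : c \in p |` (V `\ a) by rewrite !inE ca cV orbT.
have aW : a \in p |` (V `\ c) by rewrite !inE ac aV orbT.
have [p1 p2] : 0 <= crd (p |` (V `\ a)) y c /\ 0 <= crd (p |` (V `\ c)) y a.
  by split; [exact: (frame_cc y f1).1 (cc_sub FV (co_cc cF)) _ cW|exact: (frame_cc y f2).1 (cc_sub GV (co_cc cG)) _ aW].
have z1 : crd (p |` (V `\ a)) y c = 0.
  have : m * crd (p |` (V `\ a)) y c + n * crd (p |` (V `\ c)) y a = 0 by lra.
  move=> /eqP; rewrite paddr_eq0 ?mulr_ge0 ?(ltW m0) ?(ltW n0) // mulf_eq0 (gt_eqF m0) /=.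
  by move=> /andP[/eqP].
have z2 : crd (p |` (V `\ c)) y a = 0.
  have : m * crd (p |` (V `\ a)) y c + n * crd (p |` (V `\ c)) y a = 0 by lra.
  by rewrite z1 mulr0 add0r => /eqP; rewrite mulf_eq0 (gt_eqF n0) /= => /eqP.
apply: (co_sub_uniq f1 FV _ cF cG); apply/fsubsetP => v vG.
have := fsubsetP GV _ vG; rewrite !inE => /orP[->//|/andP[_ ->]].
case: (eqVneq v a) => [ea|_]; last by rewrite orbT.
by move: (k1 v vG); rewrite ea z2 ltxx.
Qed.

(** The whole star of the edge is replaced at once rather than by Pachner moves; the moves are
    supplied later by [refine_conn]. *)
Lemma split_good : good X'.
Proof.
apply: repl_good => //.
- by move=> V /HT[].
- move=> U /memT'[V VT h]; have [XV aV cV] := (HT V).1 VT; have [f1 f2] := frp VT.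
  have bV := good_balls gX XV.
  by split; [case: h => ->|move=> v; case: h => ->; rewrite !inE => /orP[/eqP ->//|/andP[_ /bV]]].
- move=> F y ty [F0 [V /= VT FV]] cF; have [fV aV cV] := fr VT; have [f1 f2] := frp VT.
  have cy := cc_sub FV (co_cc cF).
  have [U UT cU] : exists2 U, U \in T' & cc U y.
    case: (leP (crd V y a * n) (crd V y c * m)) => h.
      exists (p |` (V `\ a)); first by apply/memT'; exists V; auto.
      exact: (split_cc ac m0 n0 ep).
    exists (p |` (V `\ c)); first by apply/memT'; exists V; auto.
    by apply: (split_cc ca n0 m0 ep') => //; exact: ltW.
  have fU : frame U by move: UT => /memT'[V1 V1T h]; have [] := frp V1T; case: h => ->.
  exists (supp U y); last exact: co_supp.
  split; last by exists U => //; exact: supp_sub.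
  apply/eqP => e; have := co_supp fU cU; rewrite e => -[w _].
  by rewrite /comb big_nil => ey; move: ty.1; rewrite ey mxE ltxx.
- move=> F y ty [F0 [U /= /T'in[V VT [iU _]] FU]] cF; have [fV aV cV] := fr VT.
  have cy := inside_cc iU (cc_sub FU (co_cc cF)).
  exists (supp V y); last exact: co_supp.
  split; last by exists V => //; exact: supp_sub.
  apply/eqP => e; have := co_supp fV cy; rewrite e => -[w _].
  by rewrite /comb big_nil => ey; move: ty.1; rewrite ey mxE ltxx.
- move=> F G y ty [F0 [U UT FU]] [G0 [W WT GW]] cF cG /=.
  have [V VT [_ UV]] := T'in UT; have [V1 V1T [_ WV]] := T'in WT.
  have mix F1 G1 U1 W1 V2 : U1 \in T' -> W1 \in T' -> V2 \in T -> F1 `<=` U1 -> G1 `<=` W1 -> U1 `<=` p |` V2 ->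
      G1 != fset0 -> co F1 y -> co G1 y -> p \in F1 -> p \notin G1 -> False.
    move=> UT1 WT1 VT2 FU1 GW1 UV1 G10 cF1 cG1 p1 p2.
    have [fK cK] := facep ty VT2 (fsubset_trans FU1 UV1) p1 cF1.
    have [fG [d dA dG]] := facen y WT1 G10 GW1 p2.
    by move: dG; rewrite -(face_uniq gX ty fK fG cK cG1) inE dA.
  have [pF|pF] := boolP (p \in F); have [pG|pG] := boolP (p \in G).
  + have dec U1 F1 : U1 \in T' -> F1 `<=` U1 -> exists V2 d,
        [/\ V2 \in T, F1 `<=` p |` (V2 `\ d), F1 `<=` p |` V2 & d = a \/ d = c].
      move=> /memT'[V2 VT2 h2] FU1.
      have sD d : p |` (V2 `\ d) `<=` p |` V2 by apply: fsetUS; exact: fsubD1set.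
      by case: h2 => e; rewrite e in FU1; [exists V2, a|exists V2, c]; split; auto; exact: (fsubset_trans FU1 (sD _)).
    have [Va [d [VaT Fd FVa hd]]] := dec U F UT FU.
    have [Vb [d' [VbT Gd GVb hd']]] := dec W G WT GW.
    have [fK cK] := facep ty VaT FVa pF cF.
    have [fK' cK'] := facep ty VbT GVb pG cG.
    have eK := face_uniq gX ty fK fK' cK cK'.
    apply: (uniqA VaT Fd _ hd hd' cF cG).
    apply/fsubsetP => v vG; have := fsubsetP Gd v vG; rewrite !inE.
    case: (eqVneq v p) => //= vp /andP[-> _] /=.
    have : v \in [fset a; c] `|` (F `\ p) by rewrite eK !inE vp vG orbT.
    have [_ aV cV] := fr VaT; rewrite !inE => /orP[/orP[/eqP->|/eqP->]|/andP[_ vF]] //.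
    by have := fsubsetP FVa _ vF; rewrite !inE (negbTE vp).
  + by exfalso; apply: (mix F G U W V).
  + by exfalso; apply: (mix G F W U V1).
  + have [fF _] := facen y UT F0 FU pF; have [fG _] := facen y WT G0 GW pG.
    exact: (face_uniq gX ty fF fG cF cG).
move=> F F' y ty [F0 [V /= VT FV]] [F'0 [U /= UT FU]] cF cF'.
have [XV aV cV] := (HT V).1 VT; have fF : face X F by split=> //; exists V.
have [pF|pF] := boolP (p \in F'); last first.
  by left; have [fF' _] := facen y UT F'0 FU pF; exact: (face_uniq gX ty fF fF' cF cF').
right=> W XW FW; have [V1 VT1 [_ UV]] := T'in UT.
have [fK cK] := facep ty VT1 (fsubset_trans FU UV) pF cF'.
have eF := face_uniq gX ty fF fK cF cK.
by apply/HT; split=> //; apply: (fsubsetP FW); rewrite eF !inE eqxx ?orbT.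
Qed.

Lemma split_cases U : X' U -> (X U /\ ~ sat [set` T]%classic U) \/
  exists h V d, [/\ D h, V \in T, d = a \/ d = c & U = mv h (p |` (V `\ d))].
Proof.
case=> [[? ?]|[h [U0 [Dh /= /memT'[V VT hU] ->]]]]; [by left|right].
by case: hU => ->; [exists h, V, a|exists h, V, c]; split; auto.
Qed.

Let split_in V d : V \in T -> d = a \/ d = c -> [/\ p |` (V `\ d) \in T', inside (p |` (V `\ d)) V & balls (p |` (V `\ d))].
Proof.
move=> VT hd; have [XV aV cV] := (HT V).1 VT; have bV := good_balls gX XV; split.
- by apply/memT'; exists V => //; case: hd => ->; auto.
- by case: hd => ->; [exact: (split_inside m0 n0 ep)|exact: (split_inside n0 m0 ep')].
by move=> v; rewrite !inE => /orP[/eqP ->//|/andP[_ /bV]].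
Qed.

(** The cutting plane separates the two halves of a tetrahedron, so in a given direction at most one
    of them hides the other. *)
Lemma split_fine : fine X' X.
Proof.
have gX' := split_good.
have rX : refines X' X.
  move=> U /split_cases[[XU _]|[h [V [d [Dh VT hd ->]]]]]; first by exists U => //; exact: inside_self.
  have [XV _ _] := (HT V).1 VT; have [_ iU bU] := split_in VT hd.
  by exists (mv h V); [exact: (good_mv gX)|exact: inside_mv Dh bU (good_balls gX XV) iU].
split=> // V XV b.
have [sV|nV] := pselect (sat [set` T]%classic V); last first.
  suff H U : X' U /\ inside U V -> U = V by exact: acyc_one H.
  move=> [XU iU]; case: (split_cases XU) => [[XU' _]|].
    exact: (parent_eq gX gX XU' XU' XV (@inside_self _ U) iU).
  move=> [h [V1 [d [Dh VT1 hd eU]]]]; have [XV1 _ _] := (HT V1).1 VT1; have [_ iU1 bU] := split_in VT1 hd.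
  case: nV; exists h, V1; split=> //.
  apply: (parent_eq gX' gX XU XV (good_mv gX Dh XV1) iU).
  by rewrite eU; exact: inside_mv Dh bU (good_balls gX XV1) iU1.
have [h [V1 [Dh /= VT1 eV]]] := sV; have [XV1 aV1 cV1] := (HT V1).1 VT1.
have bV1 := good_balls gX XV1; rewrite eV; apply: (acyc_mv gX' bV1 Dh); set b1 := b *m _.
apply: (acyc_two (U1 := p |` (V1 `\ a)) (U2 := p |` (V1 `\ c))).
  move=> U [XU iU]; case: (split_cases XU) => [[XU' nU]|].
    case: nU; rewrite (parent_eq gX gX XU' XU' XV1 (@inside_self _ U) iU); exact: sat_self.
  move=> [k [V2 [d [Dk VT2 hd eU]]]]; have [XV2 _ _] := (HT V2).1 VT2; have [_ iU2 bU] := split_in VT2 hd.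
  have bV2 := good_balls gX XV2.
  have e1 : mv k V2 = V1.
    apply: (parent_eq gX' gX XU (good_mv gX Dk XV2) XV1 _ iU).
    by rewrite eU; exact: inside_mv Dk bU bV2 iU2.
  have k1 : k = 1%:M by apply: (inj Dk VT2); rewrite e1.
  have e2 : V2 = V1 by rewrite -e1 k1 mv1.
  by rewrite eU k1 mv1 e2; case: hd => ->; [left|right].
have [fV _ _] := fr VT1.
pose phi y := crd V1 y a * n - crd V1 y c * m.
have phiB y z : phi (y - z) = phi y - phi z by rewrite /phi !crdB //; ring.
have pa y : co (p |` (V1 `\ a)) y -> phi y < 0.
  move=> [f f0 ->]; rewrite /phi (split_phi ac m0 n0 ep) // oppr_lt0 mulr_gt0 // f0 //.
  by rewrite !inE ca cV1 orbT.
have pc y : co (p |` (V1 `\ c)) y -> 0 < phi y.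
  move=> [f f0 ->]; rewrite /phi -opprB (split_phi ca n0 m0 ep') // opprK mulr_gt0 // f0 //.
  by rewrite !inE ac aV1 orbT.
move=> [[y c1 c2] [z c3 c4]].
by have := pa _ c1; have := pc _ c2; have := pc _ c3; have := pa _ c4; rewrite !phiB; lra.
Qed.

(* A translate of [p] inside the tetrahedron [P] that contains [p] is [p]
   itself, so the edges at [p] do not cross the plane through [p]. *)
Lemma split_edges P U u v (l : vec -> R) : L P -> cc P (homog p) -> l (homog p) = 0 ->
  X' U -> inside U P -> u \in U -> v \in U -> l (homog u) < 0 -> 0 < l (homog v) ->
  exists V, [/\ X V, inside V P, u \in V, v \in V & (u, v) != (a, c)].
Proof.
move=> LP cP lp XU iU uU vU lu lv; have gX' := split_good.
case: (split_cases XU) => [[XU' nU]|[h [V [d [Dh VT hd eU]]]]].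
  exists U; split=> //; apply/negP => /eqP[e1 e2]; apply: nU; apply: sat_self.
  by apply/HT; rewrite -e1 -e2.
have [XV aV cV] := (HT V).1 VT; have [_ iUV bU] := split_in VT hd.
have bV := good_balls gX XV; have XV' := good_mv gX Dh XV.
have iU' : inside U (mv h V) by rewrite eU; exact: inside_mv Dh bU bV iUV.
have nhp t : t \in U -> l (homog t) != 0 -> t \in mv h (V `\ d).
  move=> tU lt; move: tU; rewrite eU => /imfsetP[t0 /= t0U et].
  apply/imfsetP; exists t0 => //=; move: t0U; rewrite in_fset1U => /orP[/eqP e|//].
  exfalso; rewrite e in et; have [k k0 ek] := homog_act (deck_iso Dh) bp.
  have h1 : h = 1%:M.
    apply: (nodup_stab gL nL LP tp Dh cP); rewrite ek -et; apply: ccZ; first exact: ltW.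
    by apply: iU; rewrite et eU; apply/imfsetP; exists p; rewrite // !inE eqxx.
  by move: lt; rewrite et h1 act1' lp eqxx.
have uw := nhp u uU (ltr0_neq0 lu); have vw := nhp v vU (lt0r_neq0 lv).
have sw : mv h (V `\ d) `<=` mv h V by apply: mv_sub; exact: fsubD1set.
exists (mv h V); split=> //; try exact: (fsubsetP sw).
  have [_ _ rXL _] := fXL; have [P' LP' iP'] := rXL _ XV'.
  by rewrite (parent_eq gX' gL XU LP LP' iU) // => t /iU'; exact: cc_trans.
apply/negP => /eqP[e1 e2].
have h1 : h = 1%:M.
  by apply: (inj Dh VT); apply/HT; split=> //; [rewrite -e1|rewrite -e2]; exact: (fsubsetP sw).
move: uw vw; rewrite h1 mv1 e1 e2 !inE => /andP[k1 _] /andP[k2 _].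
by case: hd => e; move: k1 k2; rewrite e ?eqxx.
Qed.

End Split.

Definition cut X P (l : vec -> R) : Prop := forall V, X V -> inside V P ->
  (forall v, v \in V -> 0 <= l (homog v)) \/ (forall v, v \in V -> l (homog v) <= 0).

(** Induction on a finite set containing the edges inside P that cross the plane. Splitting such an
    edge where it meets the plane removes it and, by [split_edges], creates no new one. *)
Lemma cut_step X L P (l : vec -> R) : fine X L -> nodup L -> L P ->
  (forall m n y z, l (m *: y + n *: z) = m * l y + n * l z) ->
  exists2 X', fine X' X & cut X' P l.
Proof.
move=> fXL nL LP lin.
pose E X (e : point * point) := exists V,
  [/\ X V, inside V P, e.1 \in V, e.2 \in V & l (homog e.1) < 0 /\ 0 < l (homog e.2)].
have [A HA] : exists A : {fset point * point}, forall e, E X e -> e \in A.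
  have [B HB] := finite_inside fXL LP.
  exists (\bigcup_(V <- B) (V `*` V))%fset => -[u v] [V [XV iV uV vV _]].
  by apply/bigfcupP; exists V; [rewrite andbT; apply/HB|rewrite in_fsetM; apply/andP].
have := leqnn #|` A|; move: {2}(#|` A|) => k; elim: k A X fXL HA => [|k IH] A X fXL HA cA.
  exists X; first by apply: fine_refl; case: fXL.
  move=> V XV iV; have [h|h] := pselect (forall v, v \in V -> 0 <= l (homog v)); [by left|right].
  move=> v vV; rewrite leNgt; apply/negP => lv; apply: h => u uV; rewrite leNgt; apply/negP => lu.
  have : (u, v) \in A by apply: HA; exists V.
  by move: cA; rewrite leqn0 cardfs_eq0 => /eqP ->.
have [[[a c] eac]|h] := pselect (exists e, E X e); last first.
  apply: (IH fset0 X fXL); last by rewrite cardfs0.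
  by move=> e Ee; case: h; exists e.
have [V0 [XV0 iV0 /= aV0 cV0 [la lc]]] := eac.
have [gX gL rXL _] := fXL.
have ac : a != c by apply: contraTneq la => ->; rewrite -leNgt ltW.
have q0 : 0 < l (homog c) - l (homog a) by lra.
(* The weights m and n are determined by m + n = 1 and by the vanishing of l at p. *)
pose m := l (homog c) / (l (homog c) - l (homog a)).
pose n := - l (homog a) / (l (homog c) - l (homog a)).
have m0 : 0 < m by rewrite divr_gt0.
have n0 : 0 < n by rewrite divr_gt0 // oppr_gt0.
have mn1 : (m *: homog a + n *: homog c) 0 0 = 1.
  by rewrite [LHS]mxE ![(_ *: homog _) _ _]mxE !homog00 !mulr1 /m /n -mulrDl mulfV // gt_eqF.
pose p := pt (m *: homog a + n *: homog c).
have ep : homog p = m *: homog a + n *: homog c.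
  by rewrite homog_pt mn1 ?oner_neq0 // invr1 scale1r.
have lp : l (homog p) = 0.
  by rewrite ep lin /m /n; field; rewrite gt_eqF.
have fe : face X [fset a; c].
  split; first by apply/fset0Pn; exists a; rewrite !inE eqxx.
  by exists V0 => //; apply/fsubsetP => v; rewrite !inE => /orP[/eqP->|/eqP->].
have c2 : (1 < #|` [fset a; c]|)%N by rewrite cardfs2 ac.
have [T HT0] := star_finite gX fe c2.
have HT V : V \in T <-> [/\ X V, a \in V & c \in V].
  rewrite HT0; split=> [[XV /fsubsetP s]|[XV aV cV]].
    by split=> //; apply: s; rewrite !inE eqxx ?orbT.
  by split=> //; apply/fsubsetP => v; rewrite !inE => /orP[/eqP->|/eqP->].
have V0T : V0 \in T by apply/HT.
have cP : cc P (homog p).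
  by rewrite ep; apply: ccD; apply: ccZ; rewrite ?(ltW m0) ?(ltW n0) //; exact: iV0.
have fX' := split_fine fXL nL ac m0 n0 ep HT V0T.
have [||X'' fX'' cX''] := IH (A `\ (a, c)) _ (fine_trans fX' fXL).
- move=> [u v] [U [XU iU uU vU [/= lu lv]]].
  have [V [XV iV uV vV ne]] := split_edges fXL nL ac m0 n0 ep HT V0T LP cP lp XU iU uU vU lu lv.
  by rewrite in_fsetD1 ne; apply: HA; exists V.
- by move: cA; rewrite (cardfsD1 (a, c)) HA.
by exists X'' => //; exact: fine_trans fX'' fX'.
Qed.

Lemma cut_sub X X' L P (l : vec -> R) : fine X' X -> fine X L -> L P ->
  (forall m n y z, l (m *: y + n *: z) = m * l y + n * l z) -> cut X P l -> cut X' P l.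
Proof.
move=> [gX' gX r1 _] [_ gL r2 _] LP lin cX U XU iU.
have [V XV iV] := r1 U XU; have [P' LP' iP'] := r2 V XV.
have eP : P' = P by apply: (parent_eq gX' gL XU LP' LP) => // u /iV; exact: cc_trans.
rewrite eP in iP'.
have l0 : l 0 = 0 by rewrite -[0 in LHS]addr0 -{1}(scale0r 0) -[X in _ + X](scale0r 0) lin !mul0r addr0.
have lc (w : point -> R) : l (comb V w) = \sum_(v <- V) w v * l (homog v).
  rewrite /comb; elim/big_rec2: _ => [//|v y z _ <-].
  by have := lin (w v) 1 (homog v) z; rewrite scale1r mul1r.
case: (cX V XV iP') => h; [left|right] => u /iV[w w0 ->]; rewrite lc big_seq.
  by apply: sumr_ge0 => v vV; rewrite mulr_ge0 ?w0 ?h.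
by rewrite -oppr_ge0 -sumrN; apply: sumr_ge0 => v vV; rewrite -mulrN mulr_ge0 ?w0 // oppr_ge0 h.
Qed.

Lemma crd_lin Q q m n y z : frame Q -> q \in Q ->
  crd Q (m *: y + n *: z) q = m * crd Q y q + n * crd Q z q.
Proof. by move=> fQ qQ; rewrite crdD // !crdZ. Qed.

Lemma cut_all L (A : {fset simplex * simplex}) : good L -> nodup L ->
  (forall i, i \in A -> L i.1 /\ frame i.2) ->
  exists2 X, fine X L & forall i q, i \in A -> q \in i.2 -> cut X i.1 (fun y => crd i.2 y q).
Proof.
move=> gL nL.
have one P Q (B : seq point) X : L P -> frame Q -> fine X L -> {subset B <= Q} ->
    exists2 X', fine X' X & forall q, q \in B -> cut X' P (fun y => crd Q y q).
  move=> LP fQ; elim: B X => [|q B IH] X fX sB; first by exists X => //; apply: fine_refl; case: fX.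
  have qQ : q \in Q by apply: sB; rewrite inE eqxx.
  have [X1 f1 c1] := cut_step (l := fun y => crd Q y q) fX nL LP (fun m n y z => crd_lin m n y z fQ qQ).
  have [|X2 f2 c2] := IH X1 (fine_trans f1 fX).
    by move=> r rB; apply: sB; rewrite inE rB orbT.
  exists X2; first exact: fine_trans f2 f1.
  move=> r; rewrite inE => /orP[/eqP ->|/c2//].
  exact: cut_sub f2 (fine_trans f1 fX) LP (fun m n y z => crd_lin m n y z fQ qQ) c1.
elim/finSet_rect: A => A IH HA; have [->|[i iA]] := fset_0Vmem A.
  by exists L => //; exact: fine_refl.
have [|j|X1 f1 c1] := IH (A `\ i); first by rewrite fproperD1.
  by rewrite !inE => /andP[_ /HA].
have [Li fi] := HA i iA.
have [//|X2 f2 c2] := one i.1 i.2 i.2 X1 Li fi f1.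
exists X2; first exact: fine_trans f2 f1.
move=> j q jA qj; case: (eqVneq j i) => [e|ne]; first by rewrite e; apply: c2; rewrite -e.
have jA' : j \in A `\ i by rewrite !inE ne.
have [Lj fj] := HA j jA.
exact: cut_sub f2 f1 Lj (fun m n y z => crd_lin m n y z fj qj) (c1 j q jA' qj).
Qed.

End Cut.

(** * Common refinements *)

Section Overlap.
Variables (R : realType) (M : hyperbolic_manifold R).
Local Notation point := 'rV[R]_3.
Local Notation vec := 'rV[R]_(1 + 3).
Local Notation simplex := {fset 'rV[R]_3}.
Local Notation D := (deck M).
Local Notation orb := (simplex_orbit M).
Local Notation good := (good M).
Local Notation conn := (conn M).
Local Notation fine := (fine M).
Local Notation nodup := (nodup M).
Implicit Types (F G V W U P Q : simplex) (x y z b : vec) (u v a c t s p q : point).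
Implicit Types (g h k : 'M[R]_(1 + 3)) (L X Y A B C : set simplex).

Definition meets V W : Prop := exists2 y, co V y & co W y.

Definition overlap_finite A B : Prop := forall V, A V -> exists S : {fset simplex},
  forall W, B W -> meets V W -> W \in S.

Lemma meets_sym V W : meets V W -> meets W V.
Proof. by move=> [y c1 c2]; exists y. Qed.

Lemma meets_mv g V W : D g -> balls V -> balls W -> meets V W -> meets (mv g V) (mv g W).
Proof. by move=> Dg bV bW [y c1 c2]; exists (y *m g); [exact/(co_mv _ Dg bV)|exact/(co_mv _ Dg bW)]. Qed.

(** The carrier of y in B may have low dimension; moving y slightly into a tetrahedron of B keeps it
    in the two open cones. *)
Lemma meets_common B V W y : good B -> tl y -> frame V -> frame W -> co V y -> co W y ->
  exists U z, [/\ B U, tl z, co U z, co V z & co W z].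
Proof.
move=> gB ty fV fW cV cW; have [F [_ [U BU FU]] cF] := carrier gB ty.
have [z cz] := co_ex U; have tz := tetra_tl (good_tetra gB BU) cz.
have [e e0 [h1 h2]] := evt_ex (evtI (co_pert z fV cV) (co_pert z fW cW)).
exists U, (y + e *: z); split=> //; last exact: co_sub_pert FU e0 cF cz.
by apply: tlD => //; apply/tl_causal/tlZ.
Qed.

Lemma meets_eq A V W y : good A -> A V -> A W -> tl y -> cc V y -> co W y -> V = W.
Proof.
move=> gA AV AW ty cV cW; have s := cc_face_sub gA ty AV cV (face_self gA AW) cW.
by apply/esym/eqP; rewrite eqEfcard s (good_frame gA AV).2 (good_frame gA AW).2.
Qed.

Lemma overlap_cov A A' : good A -> good A' -> cov A A' -> overlap_finite A' A.
Proof.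
move=> gA gA' cA V' AV'; have [B [BA cB]] := cA V' AV'; exists B => W AW [y c1 c2].
have ty := tetra_tl (good_tetra gA AW) c2.
by have [V VB cV] := cB y (co_cc c1); rewrite -(meets_eq gA (BA V VB) AW ty cV c2).
Qed.

Lemma overlap_refl A : good A -> overlap_finite A A.
Proof.
move=> gA V AV; exists [fset V] => W AW [y c1 c2].
by rewrite inE (meets_eq gA AV AW (tetra_tl (good_tetra gA AV) c1) (co_cc c1) c2).
Qed.

Lemma overlap_trans A B C : good A -> good B -> good C ->
  overlap_finite A B -> overlap_finite B C -> overlap_finite A C.
Proof.
move=> gA gB gC fAB fBC V AV; have [S HS] := fAB V AV.
pose f U := if pselect (B U) is left BU then projT1 (cid (fBC U BU)) else fset0.
exists (\bigcup_(U <- S) f U)%fset => W CW [y c1 c2].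
have ty := tetra_tl (good_tetra gA AV) c1.
have [U [z [BU tz k1 k2 k3]]] := meets_common gB ty (good_frame gA AV) (good_frame gC CW) c1 c2.
apply/bigfcupP; exists U; first by rewrite andbT; apply: HS => //; exists z.
by rewrite /f; case: pselect => // BU'; apply: (projT2 (cid (fBC U BU'))) => //; exists z.
Qed.

Lemma overlap_conn A A' : good A -> conn A A' -> overlap_finite A A' /\ overlap_finite A' A.
Proof.
move=> gA; elim=> [|K K' cK [h1 h2] [gK gK' _ c1] [_ _ _ c2]].
  by split; exact: overlap_refl.
split; first exact: (overlap_trans gA gK gK' h1 (overlap_cov gK' gK c2)).
exact: (overlap_trans gK' gK gA (overlap_cov gK gK' c1) h2).
Qed.

Lemma orbit_reps L : good L -> exists2 S : {fset simplex}, forall P, P \in S -> L P &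
  forall P, L P -> exists g P0, [/\ D g, P0 \in S & P = mv g P0].
Proof.
move=> gL; have [_ _ fL _ _] := gL; have [A HA] := fset_of_finite fL.
pose r o := xget fset0 [set P : simplex | L P /\ orb P = o].
have rP o : o \in A -> L (r o) /\ orb (r o) = o.
  by move=> /HA[P LP e]; rewrite /r; case: xgetP => [P' _ //|/(_ P)]; case.
exists [fset r o | o in A].
  by move=> P /imfsetP[j /= /rP[LP _] ->].
move=> P LP.
have oA : orb P \in A by apply/HA; exists P.
have [Lr /esym/(orb_eq _ _ (good_balls gL Lr))[g Dg e]] := rP _ oA.
by exists g, (r (orb P)); split=> //; apply/imfsetP; exists (orb P).
Qed.

Lemma crd_mv g Q q : D g -> frame Q -> balls Q -> q \in Q ->
  exists2 m, 0 < m & forall y, crd (mv g Q) (y *m g) (act g q) = m * crd Q y q.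
Proof.
move=> Dg fQ bQ qQ; exists ((homog q *m g) 0 0).
  by apply: (iso_gt0 (deck_iso Dg)); apply/ballE/bQ.
move=> y; have fgQ : frame (mv g Q) by split; [exact: (indep_mv Dg bQ fQ.1)|rewrite (card_mv Dg bQ) fQ.2].
have e := comb_mv (crd Q y) Dg bQ; rewrite (crdK y fQ) in e.
rewrite (crd_comb fgQ _ e); last by apply/imfsetP; exists q.
by rewrite (actK Dg (bQ _ qQ)) mulrC.
Qed.

Lemma cut_mv X P Q q g : good X -> balls P -> frame Q -> balls Q -> q \in Q -> D g ->
  cut X P (fun y => crd Q y q) -> cut X (mv g P) (fun y => crd (mv g Q) y (act g q)).
Proof.
move=> gX bP fQ bQ qQ Dg cX V XV iV; have Dg' := deckV Dg; have bV := good_balls gX XV.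
have iV' : inside (mv (invmx g) V) P.
  by rewrite -(mvK Dg bP); exact: inside_mv Dg' bV (balls_mv Dg bP) iV.
have [m m0 em] := crd_mv Dg fQ bQ qQ.
have key v : v \in V -> exists2 d, 0 < d &
    crd (mv g Q) (homog v) (act g q) = d * crd Q (homog (act (invmx g) v)) q.
  move=> vV; have [d d0 ed] := homog_act (deck_iso Dg') (bV v vV).
  exists (m * d); first exact: mulr_gt0.
  have -> : homog v = (d *: homog (act (invmx g) v)) *m g.
    by rewrite -ed -mulmxA mulVmx ?mulmx1 // (deck_unit Dg).
  by rewrite em crdZ // mulrA.
have mem v : v \in V -> act (invmx g) v \in mv (invmx g) V by move=> vV; apply/imfsetP; exists v.
case: (cX _ (good_mv gX Dg' XV) iV') => H; [left|right] => v vV; have [d d0 ->] := key v vV.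
  by rewrite pmulr_rge0 // H // mem.
by rewrite pmulr_rle0 // H // mem.
Qed.

Lemma cut_sign V Q q : frame V -> frame Q -> q \in Q ->
  (forall v, v \in V -> 0 <= crd Q (homog v) q) \/ (forall v, v \in V -> crd Q (homog v) q <= 0) ->
  (forall y, co V y -> 0 < crd Q y q) \/ (forall y, co V y -> crd Q y q < 0).
Proof.
move=> fV fQ qQ H.
have [v vV nz] : exists2 v, v \in V & crd Q (homog v) q != 0.
  apply: contrapT => h; have [w ew] := frame_span (homog q) fV.
  have := crd_homog fQ qQ qQ; rewrite ew crd_sum // big_seq big1 ?eqxx => [/eqP|v vV].
    by rewrite eq_sym oner_eq0.
  by apply/eqP; rewrite mulf_eq0; apply/orP; right; apply: contrapT => /negP n; apply: h; exists v.
case: H => H; [left|right] => y [w w0 ->]; rewrite crd_sum // (big_fsetD1 v) //=.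
  rewrite ltr_pwDl //; first by rewrite mulr_gt0 ?w0 // lt_neqAle eq_sym nz H.
  by rewrite big_seq; apply: sumr_ge0 => u; rewrite !inE => /andP[_ uV]; rewrite mulr_ge0 ?H // ltW // w0.
rewrite -oppr_gt0 opprD ltr_pwDl //; first by rewrite -mulrN mulr_gt0 ?w0 // oppr_gt0 lt_neqAle nz H.
rewrite -sumrN big_seq; apply: sumr_ge0 => u; rewrite !inE => /andP[_ uV].
by rewrite -mulrN mulr_ge0 ?oppr_ge0 ?H // ltW // w0.
Qed.

Lemma sg_sub (r d : R) : Num.sg d * Num.sg (r - d) <= Num.sg d * Num.sg r /\
  (Num.sg (r - d) <> Num.sg r -> Num.sg d * Num.sg (r - d) < Num.sg d * Num.sg r).
Proof.
by case: (sgrP d); case: (sgrP (r - d)); case: (sgrP r); split; try (move=> ?); lra.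
Qed.

(** * A common fine refinement of two triangulations with finite overlaps *)

Section Common.
Variables (L Y : set simplex).
Hypotheses (gL : good L) (nL : nodup L) (gY : good Y).
Hypotheses (fLY : overlap_finite L Y) (fYL : overlap_finite Y L).

(** The cells whose planes cut P. The second kind makes the cells of [L] that meet one cell of [Y]
    share all their planes, so that they can be compared. *)
Let near P Q := (Y Q /\ meets P Q) \/ (L Q /\ exists2 W, Y W & meets P W /\ meets W Q).

Let near_frame P Q : near P Q -> frame Q /\ balls Q.
Proof.
by case=> [[YQ _]|[LQ _]]; [split; [exact: good_frame gY _ YQ|exact: good_balls gY _ YQ]
  |split; [exact: good_frame gL _ LQ|exact: good_balls gL _ LQ]].
Qed.

Let near_finite P : L P -> exists S : {fset simplex}, forall Q, near P Q -> Q \in S.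
Proof.
move=> LP; have [S HS] := fLY LP.
pose f U := if pselect (Y U) is left YU then projT1 (cid (fYL YU)) else fset0.
exists (S `|` \bigcup_(U <- S) f U)%fset => Q [[YQ mQ]|[LQ [W YW [m1 m2]]]]; rewrite inE.
  by rewrite HS.
apply/orP; right; apply/bigfcupP; exists W; first by rewrite andbT HS.
by rewrite /f; case: pselect => // YW'; exact: (projT2 (cid (fYL YW'))).
Qed.

Let near_mv g P Q : D g -> balls P -> near P Q -> near (mv g P) (mv g Q).
Proof.
move=> Dg bP [[YQ m1]|[LQ [W YW [m1 m2]]]]; [left|right].
  by split; [exact: (good_mv gY)|exact: meets_mv Dg bP (good_balls gY YQ) m1].
split; first exact: (good_mv gL); exists (mv g W); first exact: (good_mv gY).
have bW := good_balls gY YW.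
by split; [exact: meets_mv|exact: meets_mv Dg bW (good_balls gL LQ) m2].
Qed.

Lemma cut_exists : exists2 X, fine X L & forall P Q q, L P -> near P Q -> q \in Q ->
  cut X P (fun y => crd Q y q).
Proof.
have [S SL HS] := orbit_reps gL.
pose f U := if pselect (L U) is left LU then projT1 (cid (near_finite LU)) else fset0.
have [A HA] : exists A : {fset simplex * simplex}, forall i, i \in A <-> i.1 \in S /\ near i.1 i.2.
  apply: (finite_pred (A := (\bigcup_(P <- S) ([fset P] `*` f P))%fset)) => -[P Q] [/= PS nPQ].
  apply/bigfcupP; exists P; first by rewrite PS.
  rewrite in_fsetM /= inE eqxx /f; case: pselect => [LP|]; last by case; exact: SL.
  exact: (projT2 (cid (near_finite LP))).
have [i|X fX cX] := cut_all gL nL (A := A).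
  by move=> /HA[iS ni]; split; [exact: SL|exact: (near_frame ni).1].
exists X => // P Q q LP nPQ qQ; have [gX _ _ _] := fX.
have [g [P0 [Dg P0S eP]]] := HS P LP; have Dg' := deckV Dg.
have bP := good_balls gL LP; have LP0 := SL _ P0S; have bP0 := good_balls gL LP0.
have [fQ bQ] := near_frame nPQ.
have n0 : near P0 (mv (invmx g) Q).
  by have := near_mv Dg' bP nPQ; rewrite eP (mvK Dg bP0).
have [fQ0 bQ0] := near_frame n0.
have q0 : act (invmx g) q \in mv (invmx g) Q by apply/imfsetP; exists q.
have i0 : (P0, mv (invmx g) Q) \in A by apply/HA.
have := cut_mv gX bP0 fQ0 bQ0 q0 Dg (cX _ _ i0 q0).
by rewrite -eP (mvKV Dg bQ) (actKV Dg (bQ _ qQ)).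
Qed.

(* Both triangulations are cut along the planes of the other one, so that the
   order in which the cells of [X] inside a cell of [Y] are met in a direction [b]
   can be read off first from the planes of [L] that separate them and then,
   inside a cell of [L], from [fine X L]. *)
Theorem common_refinement : exists X, fine X L /\ fine X Y.
Proof.
have [X fX cX] := cut_exists; exists X; split=> //; have [gX _ rXL aXL] := fX.
have sgn V P Q q : X V -> L P -> inside V P -> near P Q -> q \in Q ->
    (forall y, co V y -> 0 < crd Q y q) \/ (forall y, co V y -> crd Q y q < 0).
  move=> XV LP iV nPQ qQ; apply: cut_sign => //; first exact: good_frame gX _ XV.
    exact: (near_frame nPQ).1.
  exact: cX LP nPQ qQ V XV iV.
have coP V P y : X V -> L P -> inside V P -> co V y -> co P y.
  by move=> XV LP iV; exact: (inside_co4 fX).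
have inY V P Q : X V -> L P -> inside V P -> near P Q -> (forall q, q \in Q -> exists2 y, co V y & 0 < crd Q y q) ->
    inside V Q.
  move=> XV LP iV nPQ H v vV; apply/(frame_cc _ (near_frame nPQ).1) => q qQ.
  case: (cX P Q q LP nPQ qQ V XV iV) => [->//|h]; exfalso.
  have [y [w w0 ->]] := H q qQ; rewrite crd_sum //; last exact: (near_frame nPQ).1.
  apply/negP; rewrite -leNgt -oppr_ge0 -sumrN big_seq; apply: sumr_ge0 => u uV.
  by rewrite -mulrN mulr_ge0 ?oppr_ge0 ?h // ltW // w0.
have meetX V P W : X V -> L P -> inside V P -> meets V W -> meets P W.
  by move=> XV LP iV [y c1 c2]; exists y => //; exact: coP iV c1.
split=> //.
  move=> V XV; have [P LP iV] := rXL V XV; have [y cy] := co_ex V.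
  have ty := tetra_tl (good_tetra gX XV) cy; have fV := good_frame gX XV.
  have [W [z [YW tz cW cV _]]] := meets_common gY ty fV fV cy cy.
  have n : near P W by left; split=> //; apply: (meetX V) => //; exists z.
  exists W => //; apply: (inY V P W XV LP iV n) => q qW; exists z => //.
  exact: (frame_co _ (good_frame gY YW)).1.
move=> W YW b T0 T00 HT; have [S HS] := fYL YW.
have [S' HS'] : exists S' : {fset simplex}, forall Q, Q \in S' <-> L Q /\ meets W Q.
  by apply: (finite_pred (A := S)) => Q [LQ mQ]; exact: HS.
pose par V := xget fset0 [set P : simplex | L P /\ inside V P].
have parP V : X V -> L (par V) /\ inside V (par V).
  by move=> /rXL[P LP iP]; rewrite /par; case: xgetP => [P' _ //|/(_ P)]; case.
have coW V y : V \in T0 -> co V y -> co W y.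
  move=> /HT[XV iV]; apply: (inside_co (good_frame gY YW) (fsubset_refl W) (good_frame gX XV).1 _ iV).
  by rewrite (good_frame gX XV).2 (good_frame gY YW).2.
have parW V : V \in T0 -> meets (par V) W.
  move=> VT; have [XV _] := HT V VT; have [LP iP] := parP V XV; have [y cy] := co_ex V.
  by exists y; [exact: coP iP cy|exact: coW cy].
have nr V Q : V \in T0 -> Q \in S' -> near (par V) Q.
  by move=> VT /HS'[LQ mQ]; right; split=> //; exists W => //; split=> //; exact: parW.
pose cen V := comb V (fun=> 1) : vec.
have cenP V : co V (cen V) by exists (fun=> 1).
have sg V Q q y : V \in T0 -> Q \in S' -> q \in Q -> co V y ->
    Num.sg (crd Q y q) = Num.sg (crd Q (cen V) q).
  move=> VT QS qQ cy; have [XV _] := HT V VT; have [LP iP] := parP V XV.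
  case: (sgn V _ Q q XV LP iP (nr V Q VT QS) qQ) => h; first by rewrite !gtr0_sg ?h.
  by rewrite !ltr0_sg ?h.
(* The function h measures how many planes of [L] have been crossed in direction b: it does not
   decrease towards what lies in front, and it grows whenever a plane is crossed. *)
pose h V := \sum_(Q <- S') \sum_(q <- Q) Num.sg (crd Q b q) * Num.sg (crd Q (cen V) q).
have fS Q : Q \in S' -> frame Q by move=> /HS'[LQ _]; exact: (good_frame gL LQ).
have mono V V' Q q : V \in T0 -> V' \in T0 -> behind b V' V -> Q \in S' -> q \in Q ->
    Num.sg (crd Q b q) * Num.sg (crd Q (cen V) q) <= Num.sg (crd Q b q) * Num.sg (crd Q (cen V') q) /\
    (Num.sg (crd Q (cen V) q) <> Num.sg (crd Q (cen V') q) ->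
    Num.sg (crd Q b q) * Num.sg (crd Q (cen V) q) < Num.sg (crd Q b q) * Num.sg (crd Q (cen V') q)).
  move=> VT VT' [y c1 c2] QS qQ; rewrite -(sg V Q q _ VT QS qQ c2) -(sg V' Q q _ VT' QS qQ c1).
  rewrite crdB //; last exact: fS.
  exact: sg_sub.
have hle V V' : V \in T0 -> V' \in T0 -> behind b V' V -> h V <= h V'.
  move=> VT VT' bV; rewrite /h !big_seq; apply: ler_sum => Q QS; rewrite !big_seq.
  by apply: ler_sum => q qQ; exact: (mono V V' Q q VT VT' bV QS qQ).1.
have hlt V V' Q q : V \in T0 -> V' \in T0 -> behind b V' V -> Q \in S' -> q \in Q ->
    Num.sg (crd Q (cen V) q) <> Num.sg (crd Q (cen V') q) -> h V < h V'.
  move=> VT VT' bV QS qQ ne; rewrite /h (big_fsetD1 Q) //= [X in _ < X](big_fsetD1 Q) //=.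
  apply: ltr_leD.
    rewrite (big_fsetD1 q) //= [X in _ < X](big_fsetD1 q) //=; apply: ltr_leD.
      exact: (mono V V' Q q VT VT' bV QS qQ).2.
    rewrite !big_seq; apply: ler_sum => r; rewrite !inE => /andP[_ rQ].
    exact: (mono V V' Q r VT VT' bV QS rQ).1.
  rewrite !big_seq; apply: ler_sum => Q'; rewrite !inE => /andP[_ QS']; rewrite !big_seq.
  by apply: ler_sum => r rQ; exact: (mono V V' Q' r VT VT' bV QS' rQ).1.
have [Vm VmT Hm] := fset_argmin (fun V => - h V) T00.
pose T1 := [fset V in T0 | (par V == par Vm) && (h V == h Vm)].
have [XVm _] := HT _ VmT; have [LP0 iP0] := parP _ XVm.
have [||V VT1 HV] := aXL (par Vm) LP0 b T1.
- by apply/fset0Pn; exists Vm; rewrite !inE VmT !eqxx.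
- move=> V; rewrite !inE => /and3P[/HT[XV _] /eqP e _]; split=> //.
  by rewrite -e; have [] := parP V XV.
move: VT1; rewrite !inE => /and3P[VT /eqP eP /eqP eh]; exists V => // V' V'T nV bV.
apply: (HV V' _ nV bV); rewrite !inE V'T /=.
have h1 := hle V V' VT V'T bV; have h2 : h V' <= h V by rewrite eh -lerN2 Hm.
have -> /= : (h V' == h Vm) by rewrite -eh eq_le h1 h2.
rewrite andbT -eP; have [XV _] := HT V VT; have [LP iP] := parP V XV.
have [XV' _] := HT V' V'T; have [LP' iP'] := parP V' XV'.
have PS : par V \in S' by apply/HS'; split=> //; apply/meets_sym/parW.
(* As h is equal on V and [V'], no plane of [par V] separates them, so [V'] is inside the same cell
   of [L]. *)
apply/eqP; apply: (parent_eq gX gL XV' LP' LP iP').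
apply: (inY V' _ _ XV' LP' iP' (nr V' _ V'T PS)) => q qP; exists (cen V') => //.
have pos : 0 < crd (par V) (cen V) q.
  by apply: (frame_co _ (good_frame gL LP)).1 qP; exact: coP iP (cenP V).
rewrite -sgr_gt0; apply: contrapT => ng.
have : h V < h V'.
  apply: (hlt V V' _ q VT V'T bV PS qP) => e; apply: ng.
  by rewrite -e sgr_gt0.
by rewrite ltNge h2.
Qed.

End Common.

(** [refine_conn] for X over itself provides the preparation [nodup]; finite overlaps survive these
    moves because they satisfy [cov] in both directions. *)
Theorem overlap_connected X Y : good X -> good Y ->
  overlap_finite X Y -> overlap_finite Y X -> conn X Y.
Proof.
move=> g1 g2 o12 o21.
have [L [gL nL c1 c1']] := refine_conn (fine_refl g1).
have [h1 h2] := overlap_conn g1 c1.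
have [K [fXL fXY]] := common_refinement gL nL g2 (overlap_trans gL g1 g2 h2 o12) (overlap_trans g2 g1 gL o21 h1).
have [Z [gZ _ d1 d2]] := refine_conn fXL; have [Z' [gZ' _ d3 d4]] := refine_conn fXY.
apply: conn_trans c1 _; apply: conn_trans d2 _; apply: conn_trans (conn_sym d1) _.
exact: conn_trans d3 (conn_sym d4).
Qed.

End Overlap.

(** * Cusps *)

Section Lightlike.
Variables (R : realType).
Local Notation point := 'rV[R]_3.
Local Notation vec := 'rV[R]_(1 + 3).
Local Notation simplex := {fset 'rV[R]_3}.
Implicit Types (F G V W P Q : simplex) (x y z d : vec) (u v w p q : point).

Lemma lf0l y : lf 0 y = 0.
Proof. by rewrite -(scale0r 0) lfZl mul0r. Qed.

Lemma lf_zero x : x 0 0 = 0 -> lf x x <= 0 -> x = 0.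
Proof.
move=> e; rewrite lfE e => h.
have h' := sqr_ge0 (x 0 (rshift 1 0)); have h'' := sqr_ge0 (x 0 (rshift 1 1)).
have h3 := sqr_ge0 (x 0 (rshift 1 2%:R)); rewrite !expr2 in h' h'' h3.
have z (t : R) : 0 <= t * t -> t * t <= 0 -> t = 0.
  by move=> k1 k2; apply/eqP; rewrite -sqrf_eq0 expr2 eq_le k1 k2.
by apply: vecP; rewrite [RHS]mxE //; apply: z => //; lra.
Qed.

Lemma lf_future x y : lf x x <= 0 -> lf x y < 0 -> causal y -> causal x.
Proof.
move=> h1 h2 cy; split=> //; rewrite ltNge; apply/negP; rewrite le_eqVlt => /orP[/eqP e|n].
  have x0 := lf_zero e h1.
  by move: h2; rewrite x0 lf0l ltxx.
have : causal (- x) by split; [rewrite mxE oppr_gt0|rewrite lfNl lfNr opprK].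
by move=> /causal_lf/(_ cy); rewrite lfNl oppr_le0 leNgt h2.
Qed.

Lemma lf_future_tl x y : lf x x < 0 -> lf x y < 0 -> causal y -> tl x.
Proof. by move=> h1 h2 cy; split=> //; have [] := lf_future (ltW h1) h2 cy. Qed.

Lemma lf_null v : sphere_infty v -> lf (homog v) (homog v) = 0.
Proof. by move=> s; rewrite lf_homog (_ : sqnorm v = 1) ?subrr. Qed.

Lemma null_causal v : sphere_infty v -> causal (homog v).
Proof. by move=> s; apply/ballE; right. Qed.

Lemma lf_null_lt u v : sphere_infty u -> sphere_infty v -> u <> v -> lf (homog u) (homog v) < 0.
Proof.
move=> su sv ne; rewrite lt_neqAle causal_lf ?andbT; try exact: null_causal.
apply/eqP => /(causal_parallel (null_causal su) (null_causal sv)).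
by rewrite !homog00 !scale1r => /homog_inj.
Qed.

(** A timelike vector pairs nontrivially with every lightlike one. *)
Lemma lf_orth w d : sphere_infty w -> lf d (homog w) = 0 -> 0 <= lf d d.
Proof.
move=> sw e; rewrite leNgt; apply/negP => n; have cw := null_causal sw.
have d0 : d 0 0 != 0.
  apply/eqP => d0; move: n; rewrite lfE d0; set a := d _ _; set b := d _ _; set c := d _ _; nra.
case: (ltgtP (d 0 0) 0) => [h|h|h]; last by rewrite h eqxx in d0.
  have : tl (- d) by split; [rewrite mxE oppr_gt0|rewrite lfNl lfNr opprK].
  by move=> /tl_lf/(_ cw); rewrite lfNl e oppr0 ltxx.
by have := tl_lf (conj h n) cw; rewrite e ltxx.
Qed.

Lemma lf_comb F (f : point -> R) y : lf (comb F f) y = \sum_(v <- F) f v * lf (homog v) y.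
Proof.
rewrite /comb; elim/big_rec2: _ => [|v a x _ <-]; first exact: lf0l.
by rewrite lfDl lfZl.
Qed.

Lemma lf_cc F y z : balls F -> cc F y -> causal z -> lf y z <= 0.
Proof.
move=> bF [f f0 ->] cz; rewrite lf_comb -oppr_ge0 -sumrN big_seq; apply: sumr_ge0 => v vF.
by rewrite -mulrN mulr_ge0 ?f0 // oppr_ge0; apply: causal_lf => //; apply/ballE/bF.
Qed.

Lemma lf_cc_self F y : balls F -> cc F y -> lf y y <= 0.
Proof.
move=> bF cF; have [f f0 e] := cF; rewrite [X in lf X _]e lf_comb -oppr_ge0 -sumrN big_seq.
apply: sumr_ge0 => v vF; rewrite -mulrN mulr_ge0 ?f0 // oppr_ge0 lfC; apply: (lf_cc bF cF).
by apply/ballE/bF.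
Qed.

Lemma lf_ray w x (s : R) : sphere_infty w ->
  lf (x + s *: homog w) (x + s *: homog w) = lf x x + 2 * s * lf x (homog w).
Proof. by move=> sw; rewrite lfDl !lfDr !lfZl !lfZr lf_null // (lfC (homog w)); ring. Qed.

(** A bound on the displacement in terms of the causal order: the pairing with any future causal
    vector grows at most threefold. The square of [k *: x - (x + d)] is (k - 1)^2 times that of x
    plus k times that of d, and 3 is the least integer k with k <= (k - 1)^2. *)
Lemma small_move x d : tl x -> lf (x + d) (x + d) = lf x x -> `|lf d d| <= - lf x x ->
  causal (3 *: x - (x + d)).
Proof.
move=> tx; set c := lf d d => e; have tN := tx.2.
have ed : lf x d = - c / 2 by move: e; rewrite lfDl !lfDr (lfC d x) -/c; lra.
have := ler_norm (- c); have := ler_norm c; rewrite normrN => c1 c2 c3.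
have e1 : lf (3 *: x - (x + d)) (3 *: x - (x + d)) = 4 * lf x x + 3 * c.
  by rewrite !(lfDl, lfDr, lfZl, lfZr, lfNl, lfNr) (lfC d x) ed -/c; field.
have e2 : lf (3 *: x - (x + d)) x = 2 * lf x x + c / 2.
  by rewrite !(lfDl, lfZl, lfNl) (lfC d x) ed; field.
by apply: (lf_future _ _ (tl_causal tx)); rewrite ?e1 ?e2; lra.
Qed.

(** The inequality bounds the square of the hyperbolic cosine of the distance by m. It is a closed
    condition that fails on the sphere at infinity, where [lf y y] vanishes and [lf y z] does
    not. *)
Lemma compact_hball z m : tl z -> exists K : set point, [/\ compact K, (K `<=` @H3 R)%classic &
  forall y, tl y -> lf y z ^+ 2 <= m * (lf y y * lf z z) -> K (pt y)].
Proof.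
move=> tz.
have lz p : lf (homog p) z = - z 0 0 + (p 0 0 * z 0 (rshift 1 0) + p 0 1 * z 0 (rshift 1 1)
    + p 0 2%:R * z 0 (rshift 1 2%:R)).
  by rewrite lfE homog00 !row_mxEr mul1r.
have ll p : lf (homog p) (homog p) = p 0 0 * p 0 0 + p 0 1 * p 0 1 + p 0 2%:R * p 0 2%:R - 1.
  by rewrite lfE homog00 !row_mxEr; ring.
pose f (p : point) : R := m * (lf (homog p) (homog p) * lf z z) - lf (homog p) z * lf (homog p) z.
pose h (p : point) : R := - lf (homog p) (homog p).
have cC (k : R) : continuous (fun _ : point => k) by move=> p; exact: cst_continuous.
have cX i : continuous (fun p : point => p 0 i) by exact: coord_continuous.
have cM (k l : point -> R) : continuous k -> continuous l -> continuous (fun p => k p * l p).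
  by move=> ck cl p; exact: continuousM (ck p) (cl p).
have cD (k l : point -> R) : continuous k -> continuous l -> continuous (fun p => k p + l p).
  by move=> ck cl p; exact: continuousD (ck p) (cl p).
have cN (k : point -> R) : continuous k -> continuous (fun p => - k p).
  by move=> ck p; exact: continuousN (ck p).
have cz : continuous (fun p : point => lf (homog p) z).
  have -> : (fun p : point => lf (homog p) z) = (fun p : point => - z 0 0 + (p 0 0 * z 0 (rshift 1 0)
      + p 0 1 * z 0 (rshift 1 1) + p 0 2%:R * z 0 (rshift 1 2%:R))) by apply/funext => p; exact: lz.
  exact: (cD _ _ (cC _) (cD _ _ (cD _ _ (cM _ _ (cX 0) (cC _)) (cM _ _ (cX 1) (cC _))) (cM _ _ (cX 2%:R) (cC _)))).
have cl : continuous (fun p : point => lf (homog p) (homog p)).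
  have -> : (fun p : point => lf (homog p) (homog p)) = (fun p : point => p 0 0 * p 0 0
      + p 0 1 * p 0 1 + p 0 2%:R * p 0 2%:R + - 1) by apply/funext => p; exact: ll.
  exact: (cD _ _ (cD _ _ (cD _ _ (cM _ _ (cX 0) (cX 0)) (cM _ _ (cX 1) (cX 1))) (cM _ _ (cX 2%:R) (cX 2%:R))) (cC _)).
have cf : continuous f.
  exact: (cD _ _ (cM _ _ (cC _) (cM _ _ cl (cC _))) (cN _ (cM _ _ cz cz))).
have ch : continuous h by exact: (cN _ cl).
have clf (k : point -> R) : continuous k -> closed [set p | 0 <= k p]%classic.
  move=> ck; apply: (@closed_comp _ _ k [set x : R | 0 <= x]%classic); first by move=> p _; exact: ck.
  exact: closed_ge.
pose B : set point := [set p : point | forall i, `[-1, 1]%classic (p 0 i)]%classic.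
have cB : compact B by exact (@rV_compact R 3 (fun=> `[-1, 1]%classic) (fun _ => @segment_compact R (-1) 1)).
exists (B `&` ([set p | 0 <= h p] `&` [set p | 0 <= f p]))%classic; split.
- by apply: compact_closedI => //; apply: closedI; exact: clf.
- move=> p [_ [/= h0 f0]].
  have cp : causal (homog p) by split; [rewrite homog00|rewrite -oppr_ge0].
  apply/H3E; split; first by rewrite homog00.
  rewrite lt_neqAle -oppr_ge0 h0 andbT; apply/eqP => e.
  have := tl_lf tz cp; rewrite lfC => n.
  by move: f0; rewrite /f e mul0r mulr0 sub0r; nra.
move=> y ty H; have [hy ey] := tl_pt ty; have tp : tl (homog (pt y)) by apply/H3E.
have h0 : 0 <= h (pt y) by rewrite oppr_ge0 ltW // tp.2.
split; last split => //=.
  move=> i; rewrite /= in_itv /=; move: h0; rewrite /h ll.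
  case: i => [[|[|[|//]]] hi].
  - by rewrite (_ : Ordinal hi = 0); [move=> k; apply/andP; split; nra|exact: val_inj].
  - by rewrite (_ : Ordinal hi = 1); [move=> k; apply/andP; split; nra|exact: val_inj].
  - by rewrite (_ : Ordinal hi = 2%:R); [move=> k; apply/andP; split; nra|exact: val_inj].
rewrite /f ey !lfZl !lfZr.
have -> : m * ((y 0 0)^-1 * ((y 0 0)^-1 * lf y y) * lf z z) - (y 0 0)^-1 * lf y z * ((y 0 0)^-1 * lf y z)
  = (y 0 0)^-1 ^+ 2 * (m * (lf y y * lf z z) - lf y z ^+ 2) by ring.
by rewrite mulr_ge0 ?sqr_ge0 // subr_ge0.
Qed.

(* A matrix preserving the form has the same eigenvalues as its inverse. *)
Lemma null_eigen g w c : is_isometry g -> sphere_infty w -> homog w *m g = c *: homog w ->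
  0 < c -> c != 1 -> exists d, [/\ causal d, lf d d = 0, d *m g = c^-1 *: d & lf d (homog w) < 0].
Proof.
move=> ig sw eg c0 c1; have cw := null_causal sw; have cn : c != 0 by rewrite gt_eqF.
have [gJ _] := ig; pose J := lorentz R.
have JJ : J *m J = 1%:M.
  rewrite /J /lorentz mulmx_block !mulmx0 !mul0mx !addr0 !add0r mulmx1.
  by rewrite -scalar_mxM mulrNN mulr1 -scalar_mx_block.
have gJg : g^T *m J *m g = J.
  have : g *m (J *m g^T *m J) = 1%:M by rewrite !mulmxA gJ.
  move=> /mulmx1C e; have e2 : J *m (g^T *m J *m g) = 1%:M by rewrite !mulmxA.
  by rewrite -[LHS]mul1mx -JJ -mulmxA e2 mulmx1.
(* The transpose has the eigenvalue c as well, and J turns its eigenvector r into an eigenvector of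
   g for the inverse value. *)
have : \det (g^T - c%:M) = 0.
  rewrite -det_tr linearB /= trmxK tr_scalar_mx; apply/eqP/det0P; exists (homog w).
    by apply/eqP => e; move: cw.1; rewrite e mxE ltxx.
  by rewrite mulmxBr eg mul_mx_scalar subrr.
move=> /eqP/det0P[r r0 /eqP]; rewrite mulmxBr mul_mx_scalar subr_eq0 => /eqP er.
pose d := r *m J.
have dg : d *m g = c^-1 *: d.
  have : c *: (d *m g) = d by rewrite /d !scalemxAl -er -!mulmxA (mulmxA _ J g) gJg.
  by move=> e; rewrite -{2}e scalerA mulVf // scale1r.
have d0 : d <> 0.
  by move=> d0; move: r0; rewrite -[r]mulmx1 -JJ mulmxA -/d d0 mul0mx eqxx.
have c2 : c * c != 1.
  apply: contra c1 => /eqP e; have : (c - 1) * (c + 1) = 0 by lra.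
  by move=> /eqP; rewrite mulf_eq0 subr_eq0 => /orP[//|/eqP]; lra.
have dd : lf d d = 0.
  have := lf_iso d d ig; rewrite dg lfZl lfZr => e; apply: contrapT => /eqP n.
  have e3 : c * c * lf d d = lf d d by rewrite -{1}e; field.
  by move: c2; rewrite -(inj_eq (mulIf n)) mul1r e3 eqxx.
have cd : exists2 s : R, s != 0 & causal (s *: d).
  case: (ltgtP (d 0 0) 0) => [h|h|h].
  - exists (-1); first by rewrite oppr_eq0 oner_eq0.
    by split; [rewrite mxE mulN1r oppr_gt0|rewrite lfZl lfZr dd !mulr0].
  - by exists 1; rewrite ?oner_eq0 // scale1r; split; rewrite ?dd.
  by case: d0; apply: lf_zero => //; rewrite dd.
have [s s0 cs] := cd; exists (s *: d); split=> //.
- by rewrite lfZl lfZr dd !mulr0.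
- by rewrite -scalemxAl dg !scalerA mulrC.
rewrite lt_neqAle causal_lf // andbT; apply/eqP => /(causal_parallel cs cw).
rewrite homog00 scale1r; set t := (s *: d) 0 0 => e; have t0 : 0 < t by case: cs.
have : (s *: d) *m g = c^-1 *: (s *: d) by rewrite -scalemxAl dg !scalerA mulrC.
rewrite e -scalemxAl eg !scalerA => /(congr1 (fun A : vec => A 0 0)); rewrite [LHS]mxE [RHS]mxE homog00 !mulr1.
move=> e1; have e2 : c * c * t = t by rewrite -mulrA [c * t]mulrC e1 mulrA mulfV // mul1r.
by move: c2; rewrite -(inj_eq (mulIf (negbT (gt_eqF t0)))) mul1r e2 eqxx.
Qed.

End Lightlike.

(** * Deck transformations fixing an ideal vertex *)

Section Cusps.
Variables (R : realType) (M : hyperbolic_manifold R).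
Local Notation point := 'rV[R]_3.
Local Notation vec := 'rV[R]_(1 + 3).
Local Notation simplex := {fset 'rV[R]_3}.
Local Notation D := (deck M).
Local Notation good := (good M).
Implicit Types (F G V W U P Q : simplex) (x y z d : vec) (u v w p q : point).
Implicit Types (g h k : 'M[R]_(1 + 3)) (L Y : set simplex).

Lemma hball_finite L z m : good L -> tl z -> exists A : {fset simplex}, forall V y, L V -> tl y ->
  cc V y -> lf y z ^+ 2 <= m * (lf y y * lf z z) -> V \in A.
Proof.
move=> gL tz; have [K [cK KH HK]] := compact_hball m tz.
have [_ _ _ _ Ll] := gL; have [A HA] := fset_of_finite (Ll K cK KH).
exists A => V y LV ty cV le; apply/HA; split=> //.
exists (pt y); split; last exact: HK.
have [_ ey] := tl_pt ty; apply/hullE; rewrite ey; apply: ccZ => //.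
by rewrite invr_ge0 ltW // ty.1.
Qed.

Lemma gpD g m n : gp g (m + n) = gp g m *m gp g n.
Proof. by elim: n => [|n IH]; rewrite ?(addn0 m) ?mulmx1 // (addnS m n) /= IH mulmxA. Qed.

Lemma collision (T : choiceType) (A : {fset T}) (f : nat -> T) : (forall n, f n \in A) ->
  exists m n, (m < n)%N /\ f m = f n.
Proof.
move=> fA; apply: contrapT => H.
have : uniq [seq f i | i <- iota 0 (size A).+1].
  rewrite map_inj_in_uniq ?iota_uniq // => i j _ _ e.
  by case: (ltngtP i j) => // h; case: H; [exists i, j|exists j, i].
move=> /uniq_leq_size/(_ (_ : {subset _ <= A})); rewrite size_map size_iota ltnn.
by move=> /(_ _)-H1; suff: false by []; apply: H1 => t /mapP[i _ ->].
Qed.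

(** Points of the ray from p to w, pulled back by the powers of g, stay in one ball around a point
    of the axis of g. So two pulled back copies of P coincide, and g would have finite order. *)
Lemma no_loxodromic L P w g c : good L -> L P -> w \in P -> sphere_infty w -> D g ->
  homog w *m g = c *: homog w -> 1 < c -> False.
Proof.
move=> gL LP wP sw Dg eg c1; have c0 : 0 < c by apply: lt_trans c1.
have [d [cd dd dg dw]] := null_eigen (deck_iso Dg) sw eg c0 (negbT (gt_eqF c1)).
have cw := null_causal sw; have [p cp] := co_ex P; have tp := tetra_tl (good_tetra gL LP) cp.
have tz : tl (homog w + d).
  apply: (lf_future_tl _ _ (causalD cw cd)); rewrite !lfDl !lfDr (lf_null sw) dd (lfC (homog w)); lra.
pose a := - lf p (homog w); pose b := - lf p d; pose r := - lf d (homog w).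
have a0 : 0 < a by rewrite oppr_gt0; exact: tl_lf.
have b0 : 0 <= b by rewrite oppr_ge0; apply: causal_lf => //; exact: tl_causal.
have r0 : 0 < r by rewrite oppr_gt0.
have [A HA] := hball_finite ((a + b + r) ^+ 2 / (4 * a * r)) gL tz.
have wn n : homog w *m gp g n = c ^+ n *: homog w.
  elim: n => [|n IH] /=; first by rewrite mulmx1 scale1r.
  by rewrite mulmxA IH -scalemxAl eg scalerA exprSr.
have dn n : d *m gp g n = (c ^+ n)^-1 *: d.
  elim: n => [|n IH] /=; first by rewrite mulmx1 invr1 scale1r.
  by rewrite mulmxA IH -scalemxAl dg scalerA exprSr invfM.
have inA n : mv (invmx (gp g n)) P \in A.
  have Dn := gp_deck n Dg; have Dn' := deckV Dn.
  pose t := c ^+ n; have t1 : 1 <= t by apply: exprn_ege1; exact: ltW.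
  have t0 : 0 < t by apply: lt_le_trans t1.
  (* With the weight [t * t], the pairings of the pulled back point with w and with d are both of
     order t, and so is the square root of [- lf y y]; this bounds the distance. *)
  pose y := p + (t * t) *: homog w.
  have ty : tl y by apply: tlD => //; apply: causalZ => //; exact: mulr_gt0.
  have cy : cc P y by apply: ccD; [exact: co_cc|apply: ccZ; [rewrite mulr_ge0 // ltW|exact: cc_homog]].
  apply: (HA _ (y *m invmx (gp g n))).
  - exact: (good_mv gL).
  - by apply: iso_tl ty; exact: deck_iso Dn'.
  - by apply/(cc_mv _ Dn' (good_balls gL LP)).
  have e1 : lf (y *m invmx (gp g n)) (homog w + d) = - (t * (a + r) + t^-1 * b).
    rewrite -(lf_iso _ _ (deck_iso Dn)) -mulmxA mulVmx ?mulmx1 ?(deck_unit Dn) //.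
    rewrite mulmxDl wn dn -/t /y lfDl !lfDr !lfZl !lfZr (lf_null sw) (lfC (homog w) d).
    by rewrite /a /b /r; field; rewrite gt_eqF.
  rewrite e1 lf_iso; last exact: deck_iso Dn'.
  have e2 : lf y y = lf p p - 2 * (t * t) * a.
    by rewrite /y lfDl !lfDr !lfZl !lfZr (lf_null sw) (lfC (homog w) p) /a; ring.
  have e3 : lf (homog w + d) (homog w + d) = - (2 * r).
    by rewrite lfDl !lfDr (lf_null sw) dd (lfC (homog w) d) /r; ring.
  rewrite e2 e3 sqrrN.
  have h1 : t * (a + r) + t^-1 * b <= t * (a + b + r).
    have : t^-1 * b <= t * b by apply: ler_wpM2r => //; apply: (le_trans _ t1); rewrite invf_le1.
    by move=> ?; rewrite !mulrDr; lra.
  have h0 : 0 <= t * (a + r) + t^-1 * b.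
    by rewrite addr_ge0 // mulr_ge0 ?invr_ge0 ?(ltW t0) // addr_ge0 // ltW.
  have pp := tp.2.
  have h2 : (t * (a + r) + t^-1 * b) ^+ 2 <= (t * (a + b + r)) ^+ 2 by rewrite ler_sqr ?nnegrE // (le_trans h0).
  apply: (le_trans h2).
  have e4 : (t * (a + b + r)) ^+ 2 = (a + b + r) ^+ 2 / (4 * a * r) * (4 * a * r * (t * t)).
    by field; rewrite !gt_eqF.
  rewrite e4; apply: ler_wpM2l; first by rewrite divr_ge0 ?sqr_ge0 // !mulr_ge0 // ltW.
  have h3 : 0 < - lf p p * r by rewrite mulr_gt0 // oppr_gt0.
  by lra.
have [m [n [mn e]]] := collision inA.
have Dm := gp_deck m Dg; have Dn := gp_deck n Dg.
have e1 := mv_eq (deckV Dm) (deckV Dn) (good_tetra gL LP) e.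
have e2 : gp g m = gp g n by rewrite -[LHS]invmxK e1 invmxK.
have e3 : gp g (n - m) = 1%:M.
  move: e2; rewrite -(subnKC (ltnW mn)) gpD addKn => /(congr1 (mulmx (invmx (gp g m)))).
  by rewrite mulmxA mulVmx ?mul1mx // (deck_unit Dm).
have g1 : g = 1%:M by apply: (torsion Dg _ e3); rewrite subn_gt0.
move: eg; rewrite g1 mulmx1 => /(congr1 (fun B : vec => B 0 0)); rewrite [RHS]mxE homog00 mulr1 => e4.
by move: c1; rewrite -e4 ltxx.
Qed.

Lemma cusp_fixed L P w g : good L -> L P -> w \in P -> sphere_infty w -> D g -> act g w = w ->
  homog w *m g = homog w.
Proof.
move=> gL LP wP sw Dg e; have [c c0 ec] := homog_act (deck_iso Dg) (or_intror sw).
rewrite e in ec; rewrite ec; case: (ltgtP c 1) => [h|h|->]; last by rewrite scale1r.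
  exfalso; have Dg' := deckV Dg.
  apply: (no_loxodromic gL LP wP sw Dg' (c := c^-1)); last by rewrite invf_gt1.
  rewrite -[X in X *m _]scale1r -(mulVf (_ : c != 0)) ?gt_eqF // -scalerA -ec.
  by rewrite -scalemxAl -mulmxA mulmxV ?mulmx1 // (deck_unit Dg).
by case: (no_loxodromic gL LP wP sw Dg ec h).
Qed.

Lemma horo_mult L P u g h : good L -> L P -> u \in P -> sphere_infty u -> D g -> D h ->
  act g u = act h u -> homog u *m g = homog u *m h.
Proof.
move=> gL LP uP su Dg Dh e; have Dh' := deckV Dh.
have bu : ball u by right.
have ek : act (g *m invmx h) u = u by rewrite (act_mul _ (deck_iso Dg) bu) e (actK Dh bu).
have := cusp_fixed gL LP uP su (deckM Dg Dh') ek.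
move=> /(congr1 (mulmx^~ h)); rewrite -!mulmxA mulVmx ?mulmx1 //.
exact: (deck_unit Dh).
Qed.

(** The lifted tetrahedra are infinitely many, but a common bound exists because they form finitely
    many orbits. *)
Lemma orbit_evt L (Phi : simplex -> R -> Prop) : good L ->
  (forall P, L P -> evt (fun e => forall g, D g -> Phi (mv g P) e)) ->
  evt (fun e => forall P, L P -> Phi P e).
Proof.
move=> gL H; have [S SL HS] := orbit_reps gL.
have := evt_all (s := S) (Q := fun P e => forall g, D g -> Phi (mv g P) e) (fun P PS => H P (SL P PS)).
apply: evt_imp => e e0 K P /HS[g [P0 [Dg P0S ->]]]; exact: K.
Qed.

Lemma evt_le (a b : R) : 0 < a -> evt (fun e => e * b <= a).
Proof.
move=> a0; have := evt_lin (- b) a0; apply: evt_imp => e e0.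
by rewrite mulrN subr_gt0 => /ltW.
Qed.

(** * Horoballs at the vertices of an ideal triangulation *)

Section Ideal.
Variable L : set simplex.
Hypotheses (gL : good L) (idL : forall V v, L V -> v \in V -> sphere_infty v).

(* Below some depth the horoball at [w] avoids the faces opposite to [w]; this
   is uniform since elements mapping one vertex to another all scale the horoball alike. *)
Lemma face_depth P w : L P -> w \in P -> evt (fun e => forall Q z, L Q -> w \in Q ->
  cc (Q `\ w) z -> e * - lf z z <= lf z (homog w) ^+ 2).
Proof.
move=> LP wP; have sw := idL LP wP.
have one Q u : L Q -> u \in Q -> evt (fun e => forall z, cc (Q `\ u) z ->
    e * - lf z z <= lf z (homog u) ^+ 2).
  move=> LQ uQ; have su := idL LQ uQ.
  have [m m0 Hm] : exists2 m : R, 0 < m & forall v, v \in Q `\ u -> m <= - lf (homog v) (homog u).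
    apply: evt_ex; apply: evt_all => v; rewrite !inE => /andP[vu vQ].
    have h : 0 < - lf (homog v) (homog u).
      by rewrite oppr_gt0; apply: lf_null_lt => //; [exact: idL LQ vQ|exact/eqP].
    by apply: evt_imp (evt_lt h) => e _ /ltW.
  exists (m ^+ 2); first by rewrite exprn_gt0.
  move=> e e0 em z cz; have bQ : balls (Q `\ u) by apply: balls_sub (good_balls gL LQ); exact: fsubD1set.
  have [f f0 ez] := cz.
  have h1 : m * z 0 0 <= - lf z (homog u).
    rewrite ez lf_comb comb00 mulr_sumr -sumrN !big_seq; apply: ler_sum => v vQ.
    by rewrite mulrC -mulrN; apply: ler_wpM2l; [exact: f0|exact: Hm].
  have z0 : 0 <= z 0 0 by rewrite ez comb00 big_seq; apply: sumr_ge0.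
  have h2 : - lf z z <= z 0 0 ^+ 2.
    have := sqr_ge0 (z 0 (rshift 1 0)); have := sqr_ge0 (z 0 (rshift 1 1)).
    by have := sqr_ge0 (z 0 (rshift 1 2%:R)); rewrite lfE !expr2; lra.
  have h3 : 0 <= - lf z z by rewrite oppr_ge0; exact: lf_cc_self bQ cz.
  apply: (@le_trans _ _ (m ^+ 2 * z 0 0 ^+ 2)); first by apply: ler_pM => //; exact: ltW.
  by rewrite -exprMn -[X in _ <= X]sqrrN ler_sqr ?nnegrE ?mulr_ge0 ?(ltW m0) // (le_trans _ h1) // mulr_ge0 // ltW.
suff : evt (fun e => forall Q, L Q -> w \in Q -> forall z, cc (Q `\ w) z -> e * - lf z z <= lf z (homog w) ^+ 2).
  by apply: evt_imp => e e0 H Q z LQ wQ cz; exact: (H Q LQ wQ z cz).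
apply: (orbit_evt (Phi := fun Q e => w \in Q -> forall z, cc (Q `\ w) z -> e * - lf z z <= lf z (homog w) ^+ 2)) => // Q LQ.
have bQ := good_balls gL LQ.
suff : evt (fun e => forall u, u \in Q -> forall g, D g -> act g u = w -> forall z, cc (mv g Q `\ w) z ->
    e * - lf z z <= lf z (homog w) ^+ 2).
  apply: evt_imp => e e0 H g Dg /imfsetP[u /= uQ ew]; exact: (H u uQ g Dg).
apply: evt_all => u uQ; have su := idL LQ uQ.
have [[h [Dh eh]]|n] := pselect (exists h, D h /\ act h u = w); last first.
  by apply: evtT => e _ g Dg eg; case: n; exists g.
have [c c0 ec] := homog_act (deck_iso Dh) (bQ u uQ); rewrite eh in ec.
have [d d0 Hd] := one Q u LQ uQ.
exists (d / c ^+ 2); first by rewrite divr_gt0 // exprn_gt0.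
move=> e e0 ed g Dg eg z cz; have Dg' := deckV Dg.
have ew : homog u *m g = c *: homog w by rewrite -ec; apply: (horo_mult gL LQ uQ su Dg Dh); rewrite eg.
have cz' : cc (Q `\ u) (z *m invmx g).
  have bQu : balls (Q `\ u) by apply: balls_sub bQ; exact: fsubD1set.
  apply/(cc_mv _ Dg bQu); rewrite (mvD1 Dg bQ (bQ u uQ)) eg -mulmxA mulVmx ?mulmx1 //.
  exact: (deck_unit Dg).
have e1 : lf (z *m invmx g) (homog u) = c * lf z (homog w).
  rewrite -(lf_iso _ _ (deck_iso Dg)) -mulmxA mulVmx ?mulmx1 ?(deck_unit Dg) //.
  by rewrite ew lfZr.
have := Hd (e * c ^+ 2) _ _ _ cz'; rewrite e1 lf_iso ?exprMn; last exact: deck_iso Dg'.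
have c2 : 0 < c ^+ 2 by rewrite exprn_gt0.
move=> H3; rewrite -(ler_pM2l c2) mulrA (mulrC (c ^+ 2) e); apply: H3; first by rewrite mulr_gt0.
by rewrite -ler_pdivlMr.
Qed.

Lemma local_cell y d : tl y -> exists2 V, L V & cc V y /\ evt (fun e => cc V (y + e *: d)).
Proof.
move=> ty; have [V LV [cV H]] := local_star gL d ty; exists V => //; split=> //.
have := cc_pert (good_frame gL LV) cV H; apply: evt_imp => e e0 /co_cc; apply: cc_sub.
by apply/fsubsetP => v; rewrite !inE => /andP[].
Qed.

(** An open horoball at w, written invariantly under scaling of y; it shrinks with e. *)
Definition deep (e : R) w y : Prop := lf y (homog w) ^+ 2 < e * - lf y y.

Lemma deepZ (e k : R) w y : 0 < k -> deep e w y -> deep e w (k *: y).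
Proof.
rewrite /deep => k0 h; rewrite !lfZl lfZr.
have -> : e * - (k * (k * lf y y)) = k ^+ 2 * (e * - lf y y) by ring.
by rewrite exprMn ltr_pM2l // exprn_gt0.
Qed.

(** Convexity of horoballs. Where the pairing with w is -1, differences are orthogonal to w, hence
    not timelike, so [- lf y y] is concave. *)
Lemma deep_seg e w y z t : sphere_infty w -> 0 < e -> tl y -> tl z -> deep e w y -> deep e w z ->
  lf y (homog w) = -1 -> lf z (homog w) = -1 -> 0 <= t <= 1 ->
  tl (y + t *: (z - y)) /\ deep e w (y + t *: (z - y)).
Proof.
rewrite /deep => sw e0 ty tz; set q := y + _ => dy dz ey ez /andP[t0 t1].
have eq : lf q (homog w) = -1 by rewrite /q lfDl lfZl lfDl lfNl ey ez; ring.
have dd : 0 <= lf (z - y) (z - y) by apply: (lf_orth sw); rewrite lfDl lfNl ey ez subrr.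
have eqq : lf q q = (1 - t) * lf y y + t * lf z z - t * (1 - t) * lf (z - y) (z - y).
  by rewrite /q !(lfDl, lfDr, lfZl, lfZr, lfNl, lfNr) (lfC z y); ring.
have h : 1 < e * - lf q q.
  rewrite ey ez sqrrN expr1n in dy dz.
  have h1 : 0 <= t * (1 - t) * lf (z - y) (z - y) by rewrite !mulr_ge0 // subr_ge0.
  have h2 : 0 <= (1 - t) * (e * - lf y y - 1) by rewrite mulr_ge0 ?subr_ge0 // ltW.
  have h3 : 0 <= t * (e * - lf z z - 1) by rewrite mulr_ge0 ?subr_ge0 // ltW.
  have h4 : 0 < (1 - t) * (e * - lf y y - 1) + t * (e * - lf z z - 1).
    have [->|tn] := eqVneq t 0; first by rewrite subr0 mul1r mul0r addr0 subr_gt0.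
    by rewrite ltr_wpDl // mulr_gt0 ?subr_gt0 // lt_neqAle eq_sym tn.
  have h5 : 0 <= e * (t * (1 - t) * lf (z - y) (z - y)) by rewrite mulr_ge0 // ltW.
  by rewrite eqq; lra.
split; last by rewrite eq sqrrN expr1n.
apply: (lf_future_tl _ _ (null_causal sw)); last by rewrite eq oppr_lt0.
by rewrite -oppr_gt0 -(pmulr_rgt0 _ e0); lra.
Qed.

Definition cover e w : Prop :=
  (forall Q z, L Q -> w \in Q -> cc (Q `\ w) z -> e * - lf z z <= lf z (homog w) ^+ 2) /\
  forall y Q, tl y -> deep e w y -> L Q -> cc Q y -> w \in Q.

(** By [face_depth], carriers inside the horoball cannot drop the vertex w. So, along a segment in
    the horoball, being covered by tetrahedra with vertex w is an open and closed condition; the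
    segment starts at a point of P far along its ray to w. *)
Lemma horoball_cover P w : L P -> w \in P -> evt (fun e => cover e w).
Proof.
move=> LP wP; have sw := idL LP wP; have cw := null_causal sw.
apply: evt_imp (face_depth LP wP) => e e0 K; split=> //.
have H1 y Q Q' : tl y -> deep e w y -> L Q -> w \in Q -> cc Q y -> L Q' -> cc Q' y -> w \in Q'.
  move=> ty dy LQ wQ cQ LQ' cQ'; have [F fF cF] := carrier gL ty.
  have FQ := cc_face_sub gL ty LQ cQ fF cF; have FQ' := cc_face_sub gL ty LQ' cQ' fF cF.
  apply: (fsubsetP FQ'); apply: contraT => wF; exfalso.
  have := K Q y LQ wQ; move: dy; rewrite /deep ltNge => /negP n H; apply: n; apply: H.
  apply: cc_sub (co_cc cF); apply/fsubsetP => v vF; rewrite !inE (fsubsetP FQ _ vF) andbT.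
  by apply: contraNneq wF => <-.
move=> y0 Q ty0 dy0 LQ cQ.
have k0 : 0 < - lf y0 (homog w) by rewrite oppr_gt0; exact: tl_lf.
pose y := (- lf y0 (homog w))^-1 *: y0.
have ki : 0 < (- lf y0 (homog w))^-1 by rewrite invr_gt0.
have ty : tl y by exact: tlZ.
have dy : deep e w y by exact: deepZ.
have cy : cc Q y by apply: ccZ => //; exact: ltW.
have ey : lf y (homog w) = -1 by rewrite /y lfZl invrN mulNr mulVf // -oppr_eq0 gt_eqF.
have [p0 cp0] := co_ex P; have tp0 := tetra_tl (good_tetra gL LP) cp0.
have a0 : 0 < - lf p0 (homog w) by rewrite oppr_gt0; exact: tl_lf.
have ai : 0 < (- lf p0 (homog w))^-1 by rewrite invr_gt0.
pose p := (- lf p0 (homog w))^-1 *: p0.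
have tp : tl p by exact: tlZ.
have ep : lf p (homog w) = -1 by rewrite /p lfZl invrN mulNr mulVf // -oppr_eq0 gt_eqF.
have cp : cc P p by apply: ccZ; [exact: ltW|exact: co_cc].
clearbody p y; pose x := p + e^-1 *: homog w; have ei : 0 < e^-1 by rewrite invr_gt0.
have tx : tl x by apply: tlD => //; exact: causalZ.
have ex : lf x (homog w) = -1 by rewrite /x lfDl lfZl lf_null // mulr0 addr0.
have dx : deep e w x.
  rewrite /deep ex sqrrN expr1n /x lfDl !lfDr !lfZl !lfZr lf_null // (lfC (homog w)) ep.
  have -> : e * - (lf p p + e^-1 * -1 + (e^-1 * -1 + e^-1 * (e^-1 * 0))) = 2 + e * - lf p p.
    by field; rewrite gt_eqF.
  have : 0 < e * - lf p p by rewrite mulr_gt0 // oppr_gt0 tp.2.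
  by move: (e * - lf p p) => r; lra.
have cx : cc P x by apply: ccD => //; apply: ccZ; [exact: ltW|exact: cc_homog].
have seg t : 0 <= t <= 1 -> tl (x + t *: (y - x)) /\ deep e w (x + t *: (y - x)) by exact: deep_seg.
pose S := [set t : R | 0 <= t <= 1 /\ exists2 W, L W & w \in W /\ cc W (x + t *: (y - x))]%classic.
have S0 : S 0 by split; [rewrite lexx ler01|exists P => //; rewrite scale0r addr0].
have hS : has_sup S by split; [exists 0|exists 1 => t [/andP[]]].
pose t := sup S.
have t01 : 0 <= t <= 1.
  apply/andP; split; first exact: (sup_upper_bound hS S0).
  by apply: sup_le_ub; [exists 0|move=> r [/andP[]]].
have [tt dt] := seg t t01.
have [W LW [wW cW]] : exists2 W, L W & w \in W /\ cc W (x + t *: (y - x)).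
  have [W LW [cW [m m0 Hm]]] := local_cell (- (y - x)) tt; exists W => //; split=> //.
  have [r Sr lr] := sup_adherent m0 hS; have rt := sup_upper_bound hS Sr.
  have [r01 [U LU [wU cU]]] := Sr; have [tr dr] := seg r r01.
  apply: (H1 _ U W tr dr LU wU cU LW).
  have [<-|nr] := eqVneq t r; first exact: cW.
  have -> : x + r *: (y - x) = x + t *: (y - x) + (t - r) *: - (y - x).
    have e4 (d : vec) : r *: d = t *: d + (t - r) *: - d by rewrite scalerN -scalerBl subKr.
    by rewrite e4 addrA.
  apply: Hm; first by rewrite subr_gt0 lt_neqAle eq_sym nr.
  by rewrite lerBlDl -lerBlDr ltW.
have [t1|t1] := eqVneq t 1.
  apply: (H1 y W Q ty dy LW wW _ LQ cy).
  by move: cW; rewrite t1 scale1r addrC subrK.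
exfalso; have tlt : t < 1 by rewrite lt_neqAle t1; case/andP: t01.
have [U LU [cU HU]] := local_cell (y - x) tt.
have wU := H1 _ W U tt dt LW wW cW LU cU.
have t10 : 0 < 1 - t by rewrite subr_gt0.
have [m m0 [h1 h2]] := evt_ex (evtI HU (evt_lt t10)).
have : S (t + m).
  split; first by apply/andP; split; [rewrite addr_ge0 ?(ltW m0) //; case/andP: t01|rewrite -lerBrDl ltW].
  by exists U => //; split=> //; rewrite scalerDl addrA.
by move=> /(sup_upper_bound hS); rewrite -/t gerDl leNgt m0.
Qed.

(** If the stabiliser were trivial, each vertex of each representative would be carried to w in at
    most one way, so only finitely many tetrahedra would have the vertex w. The pairing with a
    direction d along the horosphere would then be bounded on them, but it is unbounded on the
    horoball, which they cover. *)
Lemma cusp_stab P w : L P -> w \in P -> exists g, [/\ D g, g <> 1%:M & act g w = w].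
Proof.
move=> LP wP; apply: contrapT => H.
have triv g : D g -> act g w = w -> g = 1%:M.
  by move=> Dg eg; apply: contrapT => n; apply: H; exists g.
have sw := idL LP wP; have cw := null_causal sw; have fP := good_frame gL LP.
have c3 := wall_card fP wP.
have [e0|[v1]] := fset_0Vmem (P `\ w); first by rewrite e0 cardfs0 in c3.
rewrite !inE => /andP[v1w v1P].
have [e0|[v2]] := fset_0Vmem (P `\ w `\ v1).
  by move: c3; rewrite (cardfsD1 v1) !inE v1w v1P e0 cardfs0.
rewrite !inE => /and3P[v21 v2w v2P].
have s1 := idL LP v1P; have s2 := idL LP v2P.
pose a1 := - lf (homog v1) (homog w); pose a2 := - lf (homog v2) (homog w).
have a10 : 0 < a1 by rewrite oppr_gt0; apply: lf_null_lt => //; exact/eqP.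
have a20 : 0 < a2 by rewrite oppr_gt0; apply: lf_null_lt => //; exact/eqP.
pose p := a1^-1 *: homog v1; pose d := p - a2^-1 *: homog v2.
have ep : lf p (homog w) = -1 by rewrite lfZl -[lf _ _]opprK -/a1 mulrN mulVf // gt_eqF.
have dw : lf d (homog w) = 0.
  by rewrite lfDl lfNl ep lfZl -[lf (homog v2) _]opprK -/a2 mulrN mulVf ?opprK ?addNr // gt_eqF.
have dd : 0 < lf d d.
  have -> : lf d d = 2 * (a1^-1 * a2^-1 * - lf (homog v1) (homog v2)).
    rewrite /d /p !(lfDl, lfDr, lfNl, lfNr, lfZl, lfZr) (lf_null s1) (lf_null s2).
    by rewrite (lfC (homog v2) (homog v1)); ring.
  rewrite !mulr_gt0 ?invr_gt0 // oppr_gt0; apply: lf_null_lt => // e1.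
  by move: v21; rewrite e1 eqxx.
clearbody d.
have one Q : L Q -> evt (fun e => forall x, cc Q x -> lf x (homog w) = -1 -> e * lf x d <= 1).
  move=> LQ; suff : evt (fun e => forall v, v \in Q -> e * lf (homog v) d <= - lf (homog v) (homog w)).
    apply: evt_imp => e e0 K x [f f0 ->]; rewrite lf_comb => ex; rewrite lf_comb mulr_sumr.
    have -> : 1 = \sum_(v <- Q) f v * - lf (homog v) (homog w).
      by rewrite (eq_bigr _ (fun v _ => mulrN (f v) _)) sumrN ex opprK.
    by rewrite !big_seq; apply: ler_sum => v vQ; rewrite mulrCA; apply: ler_wpM2l; [exact: f0|exact: K].
  apply: evt_all => v vQ; case: (eqVneq v w) => [->|/eqP vw].
    by apply: evtT => e _; rewrite (lfC _ d) dw mulr0 lf_null // oppr0.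
  by apply: evt_le; rewrite oppr_gt0; apply: lf_null_lt => //; exact: idL LQ vQ.
have bd : evt (fun e => forall Q, L Q -> w \in Q -> forall x, cc Q x -> lf x (homog w) = -1 -> e * lf x d <= 1).
  apply: (orbit_evt (Phi := fun Q e => w \in Q -> forall x, cc Q x -> lf x (homog w) = -1 -> e * lf x d <= 1)) => // Q LQ.
  have bQ := good_balls gL LQ.
  suff : evt (fun e => forall u, u \in Q -> forall g, D g -> act g u = w -> forall x, cc (mv g Q) x ->
      lf x (homog w) = -1 -> e * lf x d <= 1).
    apply: evt_imp => e e0 K g Dg /imfsetP[u /= uQ ew]; exact: (K u uQ g Dg).
  apply: evt_all => u uQ.
  have [[h [Dh eh]]|n] := pselect (exists h, D h /\ act h u = w); last first.
    by apply: evtT => e _ g Dg eg; case: n; exists g.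
  apply: evt_imp (one _ (good_mv gL Dh LQ)) => e e0 K g Dg eg x cx.
  have Dh' := deckV Dh; have bu := bQ u uQ.
  have e1 : invmx h *m g = 1%:M.
    apply: triv; first exact: deckM.
    have bw : ball w by right.
    by rewrite (act_mul _ (deck_iso Dh') bw) -eh (actK Dh bu) eg.
  have egh : g = h by rewrite -[LHS]mul1mx -(mulmxV (deck_unit Dh)) -mulmxA e1 mulmx1.
  by apply: K; rewrite -egh.
have [e e0 [[_ K1] K2]] := evt_ex (evtI (horoball_cover LP wP) bd).
(* The shift by t along d makes the pairing with d twice the allowed bound; the shift by s towards w
   then makes the point deep without changing that pairing. *)
pose t := (2 / e - lf p d) / lf d d.
pose x0 := p + t *: d; pose s := (`|lf x0 x0| + 2 / e) / 2.
pose x := x0 + s *: homog w.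
have s0 : 0 < s by rewrite divr_gt0 // ltr_wpDl // divr_gt0.
have e00 : lf x0 (homog w) = -1 by rewrite /x0 lfDl ep (lfZl t) dw mulr0 addr0.
have exw : lf x (homog w) = -1 by rewrite /x lfDl e00 (lfZl s) (lf_null sw) mulr0 addr0.
have exx : lf x x = lf x0 x0 - 2 * s.
  by rewrite /x lf_ray // e00; ring.
have lx : lf x x <= - (2 / e).
  rewrite exx /s; have := ler_norm (lf x0 x0); move: (lf x0 x0) `|_| (2 / e) => A B C; lra.
have ee : 0 < 2 / e by rewrite divr_gt0.
have tx : tl x by apply: (lf_future_tl _ _ cw); [lra|rewrite exw oppr_lt0].
have dx : deep e w x.
  rewrite /deep exw sqrrN expr1n; apply: (@lt_le_trans _ _ (e * (2 / e))).
    by rewrite mulrCA divff ?mulr1 ?gt_eqF // ltr1n.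
  by rewrite ler_pM2l // lerNr.
have [F [_ [Q LQ FQ]] cF] := carrier gL tx; have cQ := cc_sub FQ (co_cc cF).
have := K2 Q LQ (K1 x Q tx dx LQ cQ) x cQ exw.
have -> : lf x d = 2 / e.
  rewrite /x lfDl (lfZl s) (lfC (homog w) d) dw mulr0 addr0 /x0 lfDl (lfZl t) /t divfK ?gt_eqF //.
  by rewrite addrC subrK.
by rewrite mulrCA divff ?mulr1 ?gt_eqF // leNgt ltr1n.
Qed.

Lemma vertex_depth P w y : L P -> w \in P ->
  - lf y (homog w) = \sum_(v <- P `\ w) crd P y v * - lf (homog v) (homog w).
Proof.
move=> LP wP; rewrite -{1}(crdK y (good_frame gL LP)) lf_comb (big_fsetD1 w) //=.
rewrite lf_null ?mulr0 ?add0r; last exact: idL LP wP.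
by rewrite -sumrN; apply: eq_bigr => v _; rewrite mulrN.
Qed.

Lemma vertex_lf P w y : L P -> w \in P -> cc P y -> 2 * crd P y w * - lf y (homog w) <= - lf y y.
Proof.
move=> LP wP cy; have fP := good_frame gL LP; have sw := idL LP wP.
have y0 := (frame_cc _ fP).1 cy.
pose r := comb (P `\ w) (crd P y).
have ey : y = crd P y w *: homog w + r by rewrite -combD1 // crdK.
have cr : cc (P `\ w) r.
  by exists (crd P y) => // v; rewrite !inE => /andP[_ /y0].
have rr : lf r r <= 0.
  by apply: (lf_cc_self _ cr); apply: balls_sub (good_balls gL LP); exact: fsubD1set.
have e1 : lf y (homog w) = lf r (homog w) by rewrite {1}ey lfDl lfZl lf_null // mulr0 add0r.
have -> : lf y y = 2 * crd P y w * lf r (homog w) + lf r r.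
  rewrite {1 2}ey; move: (crd P y w) => c.
  by rewrite !(lfDl, lfDr, lfZl, lfZr) lf_null // (lfC (homog w) r); ring.
by rewrite e1; lra.
Qed.

Definition center P : vec := comb P (fun=> 1).

Lemma co_center P : co P (center P).
Proof. by exists (fun=> 1). Qed.

(** Let w carry the largest coordinate of y. Unless the other coordinates are small in comparison,
    [- lf y y] is at least of the order of its square, while the pairing with the center is at most
    of its order; so the distance to the center is bounded. *)
Lemma near_vertex P (e : R) : L P -> 0 < e -> exists2 m, 0 <= m & forall y, cc P y ->
  lf y (center P) ^+ 2 <= m * (lf y y * lf (center P) (center P)) \/
  exists2 w, w \in P & \sum_(v <- P `\ w) crd P y v <= e * crd P y w.
Proof.
move=> LP e0; have fP := good_frame gL LP; set z := center P.
have tz : tl z by apply: tetra_tl (good_tetra gL LP) _; exact: co_center.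
have [c c0 Hc] : exists2 c : R, 0 < c & forall w, w \in P -> forall v, v \in P `\ w -> c <= - lf (homog v) (homog w).
  apply: evt_ex; apply: evt_all => w wP; apply: evt_all => v; rewrite !inE => /andP[vw vP].
  have h : 0 < - lf (homog v) (homog w).
    by rewrite oppr_gt0; apply: lf_null_lt; [exact: idL LP vP|exact: idL LP wP|exact/eqP].
  by apply: evt_imp (evt_lt h) => a _ /ltW.
pose Z := - lf z z; have Z0 : 0 < Z by rewrite oppr_gt0; exact: tz.2.
have d0 : 0 < 2 * c * e by rewrite !mulr_gt0.
exists (Z / (2 * c * e)); first by rewrite divr_ge0 // ltW.
move=> y cy; have y0 := (frame_cc _ fP).1 cy.
have [w wP Hw] := fset_argmin (fun v => - crd P y v) (tetra_neq0 gL LP).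
have ym v : v \in P -> crd P y v <= crd P y w by move=> /Hw; rewrite lerN2.
set m := crd P y w in ym; have m0 : 0 <= m by exact: y0.
case: (leP (\sum_(v <- P `\ w) crd P y v) (e * m)) => h; [by right; exists w|left].
have h1 : c * (e * m) <= - lf y (homog w).
  rewrite (vertex_depth _ LP wP); apply: (@le_trans _ _ (c * \sum_(v <- P `\ w) crd P y v)).
    by rewrite ler_pM2l // ltW.
  rewrite mulr_sumr !big_seq; apply: ler_sum => v vP; rewrite mulrC; apply: ler_wpM2l; last exact: Hc.
  by apply: y0; move: vP; rewrite !inE => /andP[].
have h2 : - lf y z <= m * Z.
  rewrite -{1}(crdK y fP) /Z [X in _ <= _ * - X](_ : _ = \sum_(v <- P) lf (homog v) z); last first.
    by rewrite {1}/z /center lf_comb; apply: eq_bigr => v _; rewrite mul1r.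
  rewrite lf_comb -!sumrN mulr_sumr !big_seq; apply: ler_sum => v vP; rewrite -mulrN.
  apply: ler_wpM2r; last exact: ym.
  by rewrite oppr_ge0; apply: causal_lf; [apply/ballE/(good_balls gL LP)|exact: tl_causal].
have h3 : 0 <= - lf y z by rewrite oppr_ge0; exact: lf_cc (good_balls gL LP) cy (tl_causal tz).
have h4 := vertex_lf LP wP cy; rewrite -/m in h4.
have h5 : 2 * m * (c * (e * m)) <= - lf y y.
  by apply: le_trans h4; apply: ler_wpM2l => //; rewrite mulr_ge0.
rewrite -sqrrN; apply: (@le_trans _ _ ((m * Z) ^+ 2)).
  by rewrite ler_sqr ?nnegrE // mulr_ge0 // ltW.
have -> : (m * Z) ^+ 2 = Z / (2 * c * e) * (2 * m * (c * (e * m)) * Z).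
  by field; rewrite !gt_eqF.
rewrite [X in _ <= _ * X](_ : _ = - lf y y * Z); last by rewrite /Z mulrNN.
apply: ler_wpM2l; first by rewrite divr_ge0 // ltW.
by apply: ler_wpM2r => //; exact: ltW.
Qed.

(* Shimizu's lemma: deep inside a cusp, an element of small displacement fixes the cusp. *)
Lemma move_fixes P : L P -> evt (fun e => forall w, w \in P -> forall y k, cc P y -> tl y ->
  \sum_(v <- P `\ w) crd P y v <= e * crd P y w -> D k -> causal (3 *: y - y *m k) -> act k w = w).
Proof.
move=> LP; have fP := good_frame gL LP; have bP := good_balls gL LP.
apply: evt_all => w wP; have sw := idL LP wP; have cw := null_causal sw.
have [e e0 [_ He]] := evt_ex (horoball_cover LP wP).
have n0 v : v \in P -> 0 <= - lf (homog v) (homog w).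
  by move=> vP; rewrite oppr_ge0; apply: causal_lf => //; apply/ballE/bP.
pose C := \sum_(v <- P) - lf (homog v) (homog w).
have C1 v : v \in P -> - lf (homog v) (homog w) <= C.
  move=> vP; rewrite /C (big_fsetD1 v) //= lerDl big_seq; apply: sumr_ge0 => u.
  by rewrite !inE => /andP[_ /n0].
have C0 : 0 <= C by rewrite /C big_seq; apply: sumr_ge0.
have E1 := evt_le (9 * C) e0.
(* All elements carrying u to w scale [homog u] by the same m, so one bound for each vertex u covers
   all of them. *)
have E2 : evt (fun e => forall u, u \in P -> u <> w -> forall k, D k -> act k u = w ->
    exists2 m, 0 < m & homog u *m k = m *: homog w /\ e * (3 * m * C) <= - lf (homog w) (homog u) / 2).
  apply: evt_all => u uP; have su := idL LP uP.
  have [uw|uw] := pselect (u = w); first by apply: evtT.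
  have [[h [Dh eh]]|n] := pselect (exists h, D h /\ act h u = w); last first.
    by apply: evtT => d _ _ g Dg eg; case: n; exists g.
  have [m m0 em] := homog_act (deck_iso Dh) (bP u uP); rewrite eh in em.
  have h2 : 0 < - lf (homog w) (homog u) / 2.
    by rewrite divr_gt0 // oppr_gt0; apply: lf_null_lt => // e1; apply: uw.
  apply: evt_imp (evt_le (3 * m * C) h2) => d d0 le _ k Dk ek; exists m => //; split=> //.
  by rewrite -em; apply: (horo_mult gL LP uP su Dk Dh); rewrite ek.
apply: evt_imp (evtI E1 E2) => d d0 [K1 K2] y k cy ty ny Dk ck.
have y0 := (frame_cc _ fP).1 cy.
set m := crd P y w in ny; pose A := - lf y (homog w).
have A0 : 0 < A by rewrite oppr_gt0; exact: tl_lf.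
have A1 : A <= C * (d * m).
  rewrite /A (vertex_depth _ LP wP); apply: (@le_trans _ _ (C * \sum_(v <- P `\ w) crd P y v)).
    rewrite mulr_sumr !big_seq; apply: ler_sum => v; rewrite !inE => /andP[_ vP].
    by rewrite mulrC; apply: ler_wpM2r; [exact: y0|exact: C1].
  exact: ler_wpM2l.
have m0 : 0 < m.
  rewrite lt_neqAle y0 // andbT; apply/negP => /eqP e1; move: A1; rewrite -e1 !mulr0.
  by rewrite leNgt A0.
have tyk : tl (y *m k) by apply: iso_tl ty; exact: deck_iso Dk.
have A2 : - lf (y *m k) (homog w) <= 3 * A.
  by have := causal_lf ck cw; rewrite lfDl lfNl lfZl /A; lra.
have A3 : 0 <= - lf (y *m k) (homog w) by rewrite oppr_ge0; apply: causal_lf => //; exact: tl_causal.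
have dk : deep e w (y *m k).
  rewrite /deep lf_iso; last exact: deck_iso Dk.
  rewrite -sqrrN; apply: (@le_lt_trans _ _ ((3 * A) ^+ 2)).
    by rewrite ler_sqr ?nnegrE // mulr_ge0 // ltW.
  have h1 := vertex_lf LP wP cy; rewrite -/m -/A in h1.
  have h2 : 9 * A <= e * m.
    apply: (@le_trans _ _ (9 * (C * (d * m)))); first by rewrite ler_pM2l.
    have -> : 9 * (C * (d * m)) = d * (9 * C) * m by ring.
    by rewrite ler_pM2r.
  apply: (@lt_le_trans _ _ (e * (2 * m * A))); last by rewrite ler_pM2l.
  have -> : e * (2 * m * A) = 2 * (e * m) * A by ring.
  have -> : (3 * A) ^+ 2 = 9 * A * A by ring.
  by rewrite ltr_pM2r //; have : 0 < e * m by [rewrite mulr_gt0]; lra.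
have cyk : cc (mv k P) (y *m k) by apply/(cc_mv _ Dk bP).
have /imfsetP[u /= uP ew] := He _ _ tyk dk (good_mv gL Dk LP) cyk.
have [uw|uw] := pselect (u = w); first by rewrite -{1}uw -ew.
(* The point y is mostly [homog w], so its pairing with [homog u] is at least of order m. But that
   pairing is l times the one of [y *m k] with [homog w], which is much smaller. *)
exfalso; have [l l0 [el le]] := K2 u uP uw k Dk (esym ew).
have e1 : l * lf (y *m k) (homog w) = lf y (homog u).
  by rewrite -lfZr -el lf_iso //; exact: deck_iso Dk.
have c0 : 0 < - lf (homog w) (homog u).
  by rewrite oppr_gt0; apply: lf_null_lt => //; [exact: idL LP uP|move=> e2; apply: uw].
have h1 : m * - lf (homog w) (homog u) <= - lf y (homog u).
  rewrite (vertex_depth y LP uP) (big_fsetD1 w) /=; last first.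
    by rewrite !inE wP andbT; apply/eqP => e2; apply: uw.
  rewrite lerDl big_seq; apply: sumr_ge0 => v; rewrite !inE => /and3P[_ _ vP].
  by rewrite mulr_ge0 ?y0 // oppr_ge0; apply: causal_lf; apply/ballE/bP.
have h2 : l * - lf (y *m k) (homog w) <= m * (- lf (homog w) (homog u) / 2).
  apply: (@le_trans _ _ (l * (3 * A))); first by rewrite ler_pM2l.
  apply: (@le_trans _ _ (l * (3 * (C * (d * m))))); first by rewrite !ler_pM2l.
  have -> : l * (3 * (C * (d * m))) = m * (d * (3 * l * C)) by ring.
  by rewrite ler_pM2l.
have h3 : 0 < m * - lf (homog w) (homog u) by rewrite mulr_gt0.
by move: h1 h2 h3; rewrite -e1 mulrN; lra.
Qed.

End Ideal.

Lemma fset_collect (T : choiceType) (F : {fset T}) (Q : T -> simplex -> Prop) :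
  (forall i, i \in F -> exists A : {fset simplex}, forall W, Q i W -> W \in A) ->
  exists A : {fset simplex}, forall i W, i \in F -> Q i W -> W \in A.
Proof.
elim/finSet_rect: F => F IH HF; have [->|[i iF]] := fset_0Vmem F.
  by exists fset0 => i W; rewrite inE.
have [|j|A HA] := IH (F `\ i); first by rewrite fproperD1.
  by rewrite !inE => /andP[_ /HF].
have [B HB] := HF i iF; exists (A `|` B) => j W jF QW; rewrite inE.
have [e|n] := eqVneq j i; first by rewrite (HB W) ?orbT // -e.
by rewrite (HA j W) // !inE n.
Qed.

(** * Comparison of two ideal triangulations inside the cusps *)

Section TwoIdeal.
Variables L Y : set simplex.
Hypotheses (gL : good L) (idL : forall V v, L V -> v \in V -> sphere_infty v).
Hypotheses (gY : good Y) (idY : forall V v, Y V -> v \in V -> sphere_infty v).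

(* The ray from the interior of [V1] to [v] is moved less and less by a parabolic
   fixing [v] and leaves every compact subset of the quotient; deep in a cusp of [Y]
   this parabolic has to fix the cusp, which is therefore [v]. *)
Lemma vertex_transfer V1 v : L V1 -> v \in V1 -> exists2 Q, Y Q & v \in Q.
Proof.
move=> LV1 vV1; have sv := idL LV1 vV1; have cv := null_causal sv.
have [S SY HS] := orbit_reps gY.
have [e e0 He] := evt_ex (evt_all (s := S) (fun P PS => move_fixes gY idY (SY P PS))).
have [q [Dq q1 qv]] := cusp_stab gL idL LV1 vV1.
have vq := cusp_fixed gL LV1 vV1 sv Dq qv.
have cx := co_center V1; set x := center V1 in cx; have tx := tetra_tl (good_tetra gL LV1) cx.
pose d := x *m q - x; pose c := lf d d.
pose a := - lf x (homog v); have a0 : 0 < a by rewrite oppr_gt0; exact: tl_lf.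
pose N := - lf x x; have N0 : 0 < N by rewrite oppr_gt0; exact: tx.2.
pose X (r : R) : vec := x + r^-1 *: homog v.
have Xtl r : 0 < r -> tl (X r).
  by move=> r0; apply: tlD => //; apply: causalZ => //; rewrite invr_gt0.
have Xcc r : 0 < r -> cc V1 (X r).
  by move=> r0; apply: ccD; [exact: co_cc|apply: ccZ; [rewrite invr_ge0 ltW|exact: cc_homog]].
have XX r : - lf (X r) (X r) = N + 2 * a * r^-1.
  by rewrite /X lfDl !lfDr !lfZl !lfZr lf_null // (lfC (homog v)) /N /a; ring.
(* Only finitely many translates of [V1] meet a given ball around the center of P, and the ray in
   each of them finally leaves this ball. By [near_vertex] its points in P are then close to a
   vertex. *)
have far P : P \in S -> evt (fun r => forall g, D g -> cc P (X r *m invmx g) ->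
    exists2 w, w \in P & \sum_(u <- P `\ w) crd P (X r *m invmx g) u <= e * crd P (X r *m invmx g) w).
  move=> PS; have YP := SY P PS; set z := center P.
  have tz : tl z by apply: tetra_tl (good_tetra gY YP) _; exact: co_center.
  pose Z := - lf z z; have Z0 : 0 < Z by rewrite oppr_gt0; exact: tz.2.
  have [m m0 Hm] := near_vertex gY idY YP e0; rewrite -/z in Hm.
  have [A HA] := hball_finite m gL tz.
  suff : evt (fun r => forall W, W \in A -> forall g, D g -> mv (invmx g) V1 = W ->
      ~ lf (X r *m invmx g) z ^+ 2 <= m * (lf (X r *m invmx g) (X r *m invmx g) * lf z z)).
    apply: evt_imp => r r0 K g Dg cP; have Dg' := deckV Dg.
    have tXg : tl (X r *m invmx g) by apply: iso_tl (Xtl r r0); exact: deck_iso Dg'.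
    case: (Hm _ cP) => // le; exfalso; apply: (K (mv (invmx g) V1) _ g Dg erefl le).
    apply: (HA _ _ (good_mv gL Dg' LV1) tXg _ le).
    by apply/(cc_mv _ Dg' (good_balls gL LV1)); exact: Xcc.
  apply: evt_all => W WA.
  have [[h [Dh eh]]|n] := pselect (exists h, D h /\ mv (invmx h) V1 = W); last first.
    by apply: evtT => r _ g Dg eg; case: n; exists g.
  pose z' := z *m h; have tz' : tl z' by apply: iso_tl tz; exact: deck_iso Dh.
  pose b := - lf (homog v) z'; have b0 : 0 < b by rewrite oppr_gt0 lfC; exact: tl_lf.
  have b2 : 0 < b ^+ 2 / 2 by rewrite divr_gt0 // exprn_gt0.
  apply: evt_imp (evtI (evt_lt ltr01) (evt_le (m * Z * (N + 2 * a)) b2)) => r r0 [r1 le] g Dg eg.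
  have Dg' := deckV Dg; have Dh' := deckV Dh.
  have egh : invmx g = invmx h by apply: (mv_eq Dg' Dh' (good_tetra gL LV1)); rewrite eg eh.
  rewrite egh => {}eg; have ez : lf (X r *m invmx h) z = lf (X r) z'.
    by rewrite -(lf_iso _ _ (deck_iso Dh)) -mulmxA mulVmx ?mulmx1 // (deck_unit Dh).
  move: eg; rewrite ez lf_iso; last exact: deck_iso Dh'.
  rewrite -[lf (X r) (X r)]opprK XX -[lf z z]opprK -/Z mulrNN.
  have h1 : r^-1 * b <= - lf (X r) z'.
    rewrite /X lfDl lfZl /b; have : lf x z' <= 0 by apply: causal_lf; exact: tl_causal.
    by rewrite mulrN; lra.
  have ri : 0 < r^-1 by rewrite invr_gt0.
  have h2 : (r^-1 * b) ^+ 2 <= lf (X r) z' ^+ 2.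
    by rewrite -[X in _ <= X]sqrrN ler_sqr ?nnegrE ?(le_trans _ h1) // mulr_ge0 // ltW.
  move=> h3; have := le_trans h2 h3.
  rewrite -(ler_pM2l (_ : 0 < r ^+ 2)) ?exprn_gt0 //.
  have -> : r ^+ 2 * (r^-1 * b) ^+ 2 = b ^+ 2 by field; rewrite gt_eqF.
  have -> : r ^+ 2 * (m * ((N + 2 * a * r^-1) * Z)) = r * (m * Z * (N * r + 2 * a)) by field; rewrite gt_eqF.
  apply/negP; rewrite -ltNge.
  have h4 : r * (m * Z * (N * r + 2 * a)) <= r * (m * Z * (N + 2 * a)).
    rewrite ler_pM2l //; apply: ler_wpM2l; first by rewrite mulr_ge0 // ltW.
    by rewrite lerD2r ler_piMr // ltW.
  by apply: (le_lt_trans h4); apply: (le_lt_trans le); lra.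
have cl : evt (fun r => r * `|c| <= a) := evt_le _ a0.
have [r r0 [Hr cr]] := evt_ex (evtI (evt_all far) cl).
have ri : 0 < r^-1 by rewrite invr_gt0.
have tX := Xtl r r0.
have [F [_ [Q YQ FQ]] cF] := carrier gY tX; have cQ := cc_sub FQ (co_cc cF).
have [g [P [Dg PS eQ]]] := HS Q YQ; have YP := SY P PS; have Dg' := deckV Dg.
have bP := good_balls gY YP.
pose y := X r *m invmx g.
have cP : cc P y.
  by apply/(cc_mv _ Dg bP); rewrite -eQ /y -mulmxA mulVmx ?mulmx1 // (deck_unit Dg).
have ty : tl y by apply: iso_tl tX; exact: deck_iso Dg'.
have [w wP nw] := Hr P PS g Dg cP.
pose k := g *m q *m invmx g; have Dk : D k by apply: deckM => //; exact: deckM.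
have ck : causal (3 *: y - y *m k).
  have -> : 3 *: y - y *m k = (3 *: X r - X r *m q) *m invmx g.
    rewrite /y /k mulmxBl -scalemxAl; congr (_ - _).
    by rewrite -!mulmxA (mulmxA (invmx g) g) mulVmx ?mul1mx // (deck_unit Dg).
  apply: iso_causal; first exact: deck_iso Dg'.
  (* The parabolic q fixes [homog v], so it moves all points of the ray by the same vector d, while
     [- lf (X r) (X r)] grows as r tends to 0. *)
  have eXq : X r *m q = X r + d.
    by rewrite /X /d mulmxDl -scalemxAl vq [RHS]addrAC [x + _]addrC subrK.
  have Nc : `|c| <= - lf (X r) (X r).
    have : `|c| <= a * r^-1 by rewrite ler_pdivlMr // mulrC.
    have : 0 < a * r^-1 by rewrite mulr_gt0.
    by rewrite XX; lra.
  by rewrite eXq; apply: small_move tX _ Nc; rewrite -eXq lf_iso //; exact: deck_iso Dq.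
have kw := He P PS w wP y k cP ty nw Dk ck.
have bw := bP w wP; pose u := act g w.
have qu : act q u = u.
  have bqu : ball (act q u) by apply: act_ball (deck_iso Dq) _; apply: act_ball (deck_iso Dg) bw.
  have : act (invmx g) (act q u) = w.
    by rewrite -[RHS]kw /k (act_mul _ (deck_iso (deckM Dg Dq)) bw) (act_mul _ (deck_iso Dg) bw).
  by move=> /(congr1 (act g)); rewrite (actKV Dg bqu).
have uQ : u \in Q by rewrite eQ; apply/imfsetP; exists w.
have su := idY YQ uQ.
have uq := cusp_fixed gY YQ uQ su Dq qu.
exists Q => //; have [<-//|n] := pselect (u = v); exfalso; apply: q1.
have lt := lf_null_lt su sv n.
apply: (fix_tl (k := 1) (y := homog u + homog v) Dq); last by rewrite mulmxDl uq vq scale1r.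
apply: (lf_future_tl (y := homog v) _ _ cv).
  by rewrite lfDl !lfDr !lf_null // (lfC (homog v)); lra.
by rewrite lfDl (lf_null sv); lra.
Qed.

(* A point deep in the cusp [v] can be pushed back along the ray to [v] to a fixed
   depth without leaving any tetrahedron of [Y]. *)
Lemma deep_overlap V1 v e : L V1 -> v \in V1 -> 0 < e -> cover Y e v ->
  exists A : {fset simplex}, forall W, Y W /\ (exists y, [/\ co V1 y, co W y & deep e v y]) -> W \in A.
Proof.
move=> LV1 vV1 e0 [K1 K2]; have sv := idL LV1 vV1; have cv := null_causal sv.
have fV1 := good_frame gL LV1; have bV1 := good_balls gL LV1.
set z := center V1; have tz : tl z by apply: tetra_tl (good_tetra gL LV1) _; exact: co_center.
pose Z := - lf z z; have Z0 : 0 < Z by rewrite oppr_gt0; exact: tz.2.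
pose b u := - lf (homog u) z; pose c u := - lf (homog u) (homog v).
have b0 u : u \in V1 -> 0 <= b u.
  by move=> uV; rewrite oppr_ge0; apply: causal_lf; [apply/ballE/bV1|exact: tl_causal].
have c0 u : u \in V1 `\ v -> 0 < c u.
  by rewrite !inE => /andP[/eqP uv uV]; rewrite oppr_gt0; apply: lf_null_lt => //; exact: idL LV1 uV.
(* B bounds the pairing of the pushed back point with the center z: its coefficient at v is at most
   the inverse of e, and the one at u is at most the inverse of [c u], as the pairing with v is
   -1. *)
pose B := e^-1 * b v + \sum_(u <- V1 `\ v) b u / c u.
have [A HA] := hball_finite (e * B ^+ 2 / Z) gY tz.
have ei : 0 < e^-1 by rewrite invr_gt0.
exists A => W [YW [y0 [cV cW dy]]]; have ty0 := tetra_tl (good_tetra gL LV1) cV.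
have fW := good_frame gY YW.
have vW : v \in W := K2 y0 W ty0 dy YW (co_cc cW).
have a0 : 0 < - lf y0 (homog v) by rewrite oppr_gt0; exact: tl_lf.
have ai : 0 < (- lf y0 (homog v))^-1 by rewrite invr_gt0.
pose y := (- lf y0 (homog v))^-1 *: y0.
have ty : tl y by exact: tlZ.
have cVy : co V1 y by exact: coZ.
have cWy : co W y by exact: coZ.
have ey : lf y (homog v) = -1 by rewrite /y lfZl invrN mulNr mulVf // -oppr_eq0 gt_eqF.
have {dy} dy : deep e v y by exact: deepZ.
clearbody y; pose N := - lf y y; have eN : 1 < e * N by move: dy; rewrite /deep ey sqrrN expr1n.
have N1 : e^-1 < N by rewrite -[e^-1]mulr1 ltr_pdivrMl.
(* Pushing back by s lowers N by [2 * s], down to at most twice the inverse of e. The point thus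
   stays strictly inside the horoball, which keeps it in the interior of W. *)
pose s := Num.max 0 ((N - 2 * e^-1) / 2).
have s0 : 0 <= s by rewrite le_max lexx.
pose x := y + (- s) *: homog v; pose N' := N - 2 * s.
have exx : - lf x x = N' by rewrite /x lf_ray // ey /N' /N; ring.
have exv : lf x (homog v) = -1 by rewrite /x lfDl lfZl lf_null // mulr0 addr0.
have [N'1 N'2] : e^-1 < N' /\ N' <= 2 * e^-1.
  rewrite /N' /s; case: (ltP 0 ((N - 2 * e^-1) / 2)) => h; move: h N1 ei; move: (N) (e^-1) => r t.
    by move=> h1 h2 h3; split; lra.
  by move=> h1 h2 h3; split; lra.
have tx : tl x.
  apply: (lf_future_tl _ _ cv); last by rewrite exv oppr_lt0.
  by rewrite -oppr_gt0 exx; exact: lt_trans N'1.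
have cWx : co W x.
  apply/(frame_co _ fW) => u uW; rewrite /x crdD // crdZ // crd_homog //.
  have y1 := (frame_co _ fW).1 cWy; have [uv|_] := eqVneq u v; last by rewrite mulr0 addr0 y1.
  rewrite mulr1 ltNge; apply/negP; rewrite subr_le0 uv => le; pose i := crd W y v.
  have cx : cc (W `\ v) (y + (- i) *: homog v).
    apply/(frame_ccsub _ fW (fsubD1set W v)); split=> [j|j jW].
      rewrite !inE => /andP[jv jW]; rewrite crdD // crdZ // crd_homog // (negbTE jv) mulr0 addr0.
      exact: ltW (y1 j jW).
    rewrite !inE jW andbT negbK => /eqP ->.
    by rewrite crdD // crdZ // crd_homog // eqxx mulr1 subrr.
  have := K1 W _ YW vW cx; rewrite lf_ray // lfDl lfZl lf_null // mulr0 addr0 ey sqrrN expr1n.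
  have h : e * N' <= e * (N - 2 * i) by rewrite ler_pM2l // /N' lerD2l lerN2 ler_pM2l.
  have : 1 < e * N' by rewrite -[X in X < _](mulfV (negbT (gt_eqF e0))) ltr_pM2l.
  move: h; rewrite /N; move: (lf y y) => l h1 h2.
  have -> : - (l + 2 * - i * -1) = - l - 2 * i by ring.
  by move: h1 h2; lra.
have crd0 := (frame_co _ fV1).1 cVy.
pose t := crd V1 y v - s; pose r := comb (V1 `\ v) (crd V1 y).
have ex : x = t *: homog v + r.
  by rewrite /x -{1}(crdK y fV1) (combD1 _ vV1) -/r addrAC -scalerDl.
have er : lf r (homog v) = -1 by move: exv; rewrite ex lfDl lfZl lf_null // mulr0 add0r.
have rr : lf r r <= 0.
  apply: (lf_cc_self (F := V1 `\ v)); first by apply: balls_sub bV1; exact: fsubD1set.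
  by exists (crd V1 y) => // u; rewrite !inE => /andP[_ /crd0/ltW].
have t1 : t <= e^-1.
  have : N' = 2 * t - lf r r by rewrite -exx ex addrC lf_ray // er; ring.
  by move: N'2 rr; move: (e^-1) => i; lra.
have cr u : u \in V1 `\ v -> crd V1 y u <= (c u)^-1.
  move=> uV; have : \sum_(i <- V1 `\ v) crd V1 y i * c i = 1.
    by move: er; rewrite /r lf_comb => e1; rewrite (eq_bigr _ (fun i _ => mulrN (crd V1 y i) _)) sumrN e1 opprK.
  rewrite (big_fsetD1 u) //= => e1; rewrite -[_^-1]mul1r ler_pdivlMr ?c0 // -e1 lerDl.
  rewrite big_seq; apply: sumr_ge0 => i; rewrite in_fsetD1 => /andP[_ iV].
  by rewrite mulr_ge0 ?(ltW (c0 i iV)) // ltW // crd0 //; move: iV; rewrite !inE => /andP[].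
have le : - lf x z <= B.
  rewrite ex lfDl lfZl opprD -mulrN; apply: lerD; first by apply: ler_wpM2r => //; exact: b0.
  rewrite /r lf_comb -sumrN !big_seq; apply: ler_sum => u uV; rewrite -mulrN mulrC.
  by apply: ler_wpM2l; [apply: b0; move: uV; rewrite !inE => /andP[]|exact: cr].
have ge : 0 <= - lf x z by rewrite oppr_ge0; apply: causal_lf; exact: tl_causal.
apply: (HA W x YW tx (co_cc cWx)).
rewrite -sqrrN; apply: (@le_trans _ _ (B ^+ 2)); first by rewrite ler_sqr ?nnegrE // (le_trans ge).
rewrite -(mulrNN (lf x x)) exx -/Z.
have -> : e * B ^+ 2 / Z * (N' * Z) = B ^+ 2 * (e * N') by field; rewrite gt_eqF.
by rewrite ler_peMr ?sqr_ge0 // -ler_pdivrMl // mulr1 ltW.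
Qed.

(** A point of [V1] is either in a fixed ball around the center, which meets finitely many
    tetrahedra of [Y], or so close to a vertex that it is deep in the horoball there, where
    [deep_overlap] applies. *)
Theorem ideal_overlap : overlap_finite L Y.
Proof.
move=> V1 LV1; have fV1 := good_frame gL LV1; have bV1 := good_balls gL LV1.
have E1 : evt (fun e => forall v, v \in V1 -> cover Y e v).
  apply: evt_all => v vV1; have [Q YQ vQ] := vertex_transfer LV1 vV1.
  exact (horoball_cover gY idY YQ vQ).
have [e e0 He] := evt_ex E1.
pose C v := \sum_(u <- V1) - lf (homog u) (homog v).
have [d d0 Hd] := evt_ex (evt_all (s := V1) (fun v (_ : v \in V1) => evt_le (C v) e0)).
have [m m0 Hm] := near_vertex gL idL LV1 d0.
have tz : tl (center V1) by apply: tetra_tl (good_tetra gL LV1) _; exact: co_center.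
have [A HA] := hball_finite m gY tz.
have [A' HA'] := fset_collect (fun v vV1 => deep_overlap LV1 vV1 e0 (He v vV1)).
exists (A `|` A') => W YW [y cV cW]; rewrite inE.
have ty := tetra_tl (good_tetra gL LV1) cV.
case: (Hm y (co_cc cV)) => [le|[v vV1 le]]; first by rewrite (HA W y YW ty (co_cc cW) le).
apply/orP; right; apply: (HA' v W vV1); split=> //; exists y; split=> //.
have sv := idL LV1 vV1; have y0 := (frame_co _ fV1).1 cV.
have a0 : 0 < - lf y (homog v) by rewrite oppr_gt0; apply: tl_lf => //; exact: null_causal.
have h1 := vertex_lf gL idL LV1 vV1 (co_cc cV).
have n0 u : u \in V1 -> 0 <= - lf (homog u) (homog v).
  by move=> uV; rewrite oppr_ge0; apply: causal_lf; [apply/ballE/bV1|exact: null_causal].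
have C1 u : u \in V1 -> - lf (homog u) (homog v) <= C v.
  move=> uV; rewrite /C (big_fsetD1 u) //= lerDl big_seq; apply: sumr_ge0 => i.
  by rewrite !inE => /andP[_ /n0].
have C0 : 0 <= C v by rewrite /C big_seq; apply: sumr_ge0.
have h2 : - lf y (homog v) <= e * crd V1 y v.
  rewrite (vertex_depth gL idL y LV1 vV1).
  apply: (@le_trans _ _ (C v * \sum_(u <- V1 `\ v) crd V1 y u)).
    rewrite mulr_sumr !big_seq; apply: ler_sum => u; rewrite !inE => /andP[_ uV].
    by rewrite mulrC; apply: ler_wpM2r; [exact: ltW (y0 u uV)|exact: C1].
  apply: (@le_trans _ _ (C v * (d * crd V1 y v))); first exact: ler_wpM2l.
  by rewrite mulrA (mulrC (C v)) ler_pM2r ?y0 // Hd.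
rewrite /deep -sqrrN; apply: (@lt_le_trans _ _ (e * (2 * crd V1 y v * - lf y (homog v)))); last by rewrite ler_pM2l.
have -> : e * (2 * crd V1 y v * - lf y (homog v)) = 2 * (e * crd V1 y v) * - lf y (homog v) by ring.
by rewrite expr2 ltr_pM2r //; lra.
Qed.

End TwoIdeal.

End Cusps.

Theorem theorem1p2 (R : realType) (M : hyperbolic_manifold R)
    (hO : orientable M) (hC : cusped M) (t1 t2 : triangulation R)
    (h1 : geometric_ideal_triangulation M t1)
    (h2 : geometric_ideal_triangulation M t2) :
  exists (n : nat) (s : nat -> triangulation R),
    [/\ s 0%N = t1, s n = t2,
        forall i, (i <= n)%N -> geometric_triangulation M (s i)
      & forall i, (i < n)%N -> pachner_move M (s i) (s i.+1)].
Proof.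
have [[/geo_good[g1 e1] id1] [/geo_good[g2 e2] id2]] := (h1, h2).
have c := overlap_connected g1 g2 (ideal_overlap g1 id1 g2 id2) (ideal_overlap g2 id2 g1 id1).
suff : exists (n : nat) (s : nat -> triangulation R),
    [/\ s 0%N = (simplex_orbit M @` lifted t1)%classic, s n = (simplex_orbit M @` lifted t2)%classic,
        forall i, (i <= n)%N -> geometric_triangulation M (s i)
      & forall i, (i < n)%N -> pachner_move M (s i) (s i.+1)].
  by rewrite -e1 -e2.
elim: c => [|K K' cK [n [s [s0 sn sg sp]]] [gK gK' p _] _].
  exists 0%N, (fun=> (simplex_orbit M @` lifted t1)%classic); split=> // i _; exact: good_geo.
exists n.+1, (fun i => if (i <= n)%N then s i else (simplex_orbit M @` K')%classic); split=> //.
- by rewrite ltnn.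
- by move=> i _; case: leqP => [/sg//|_]; exact: good_geo.
move=> i; rewrite ltnS => le; have [->|ne] := eqVneq i n; first by rewrite leqnn ltnn sn.
have lt : (i < n)%N by rewrite ltn_neqAle ne.
by rewrite le lt; exact: sp.
Qed.
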